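(* Let $m\ge 1$, let $X\subset\mathbb{R}^m$ be a Jordan measurable set, let $K\subset X$ be a set of Lebesgue measure $0$, let $G:X\to\mathbb{R}^m$ be a Lipschitz map which is strongly differentiable at almost all points of $\operatorname{int}X$ and injective on $X\setminus K$, and let $f:G(X)\to\mathbb{R}$ be any bounded function. Then: 1. There exists an integrable function $\overline{g}:X\to\mathbb{R}^{m\times m}$ such that $\overline{g}(x)=J_G(x)$ for almost all $x\in\operatorname{int}X$. 2. For each integrable function $\overline{h}:X\to\mathbb{R}^{m\times m}$ such that $\overline{h}(x)=J_G(x)$ for almost all $x\in\operatorname{int}X$, the function $$\psi:X\to\mathbb{R},\qquad \psi(x):=f(G(x))\cdot|\det\overline{h}(x)|$$ is integrable if and only if $f$ is integrable, and $$\int_{G(X)}f=\int_X\psi$$ holds whenever one of $f$ and $\psi$ is integrable (that is, whenever both are).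
   Context: ''Almost all'' refers to Lebesgue measure on $\mathbb{R}^m$. ''Integrable'' means Riemann integrable: for a Jordan measurable set $X\subset\mathbb{R}^m$, a function $X\to\mathbb{R}$ is integrable if it is bounded and its lower and upper Darboux integrals (formed with finite partitions of $X$ into Jordan measurable sets with pairwise disjoint interiors) agree; the integral is the common value. A function $X\to\mathbb{R}^{m\times m}$ is integrable if all its entries are integrable. Under the hypotheses of the statement $G(X)$ is Jordan measurable, so that integrability of $f$ on $G(X)$ is meaningful. Strong differentiability: let $U\subset\mathbb{R}^m$, let $u$ be an interior point of $U$. A function $F:U\to\mathbb{R}^n$ is strongly differentiable at $u$ if there is a linear map $A:\mathbb{R}^m\to\mathbb{R}^n$ such that $\frac{1}{\|x-y\|}\,[F(x)-F(y)-A(x-y)]\to 0$ as $(x,y)\to(u,u)$, $x\ne y$. In this case $F$ is differentiable at $u$ with derivative $A$. $J_G(x)$ denotes the Jacobi matrix of $G$ at an interior point $x$ of the domain where $G$ is differentiable. *)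

(* Defs.v *)
From HB Require Import structures.
From mathcomp Require Import all_boot all_order all_algebra.
From mathcomp Require Import all_classical all_reals all_analysis.

Set Implicit Arguments.
Unset Strict Implicit.
Unset Printing Implicit Defensive.

Import Order.TTheory GRing.Theory Num.Theory.
Import numFieldNormedType.Exports.

Local Open Scope classical_set_scope.
Local Open Scope ring_scope.

(* R^m is 'rV[R]_m, with the library's max norm.  A function defined on a
   subset A of R^m is a total function of which only the values on A matter. *)

Section content.
Context {R : realType} {m : nat}.
Implicit Types (b : 'rV[R]_m * 'rV[R]_m) (A : set 'rV[R]_m).

(* Half-open, so that boxes of a grid are disjoint; empty, of volume 0, as soon
   as b.2 0 i <= b.1 0 i for some i. *)
Definition box b : set 'rV[R]_m :=
  [set x | forall i, b.1 0 i <= x 0 i < b.2 0 i].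

Definition box_vol b : R := \prod_i Num.max 0 (b.2 0 i - b.1 0 i).

Definition lebesgue_outer A : \bar R :=
  ereal_inf [set (\sum_(0 <= k <oo) (box_vol (B k))%:E)%E
            | B in [set B : nat -> 'rV[R]_m * 'rV[R]_m
                   | A `<=` \bigcup_k box (B k)]].

Definition lebesgue_null A : Prop := lebesgue_outer A = 0%E.

Definition outer_content A : R :=
  inf [set v | exists n (B : 'I_n -> 'rV[R]_m * 'rV[R]_m),
         A `<=` \bigcup_i box (B i) /\ v = \sum_i box_vol (B i)].

Definition inner_content A : R :=
  sup [set v | exists n (B : 'I_n -> 'rV[R]_m * 'rV[R]_m),
         [/\ \bigcup_i box (B i) `<=` A,
             trivIset setT (fun i => box (B i))
           & v = \sum_i box_vol (B i)]].

(* For bounded A both contents are an inf, resp. a sup, of a nonempty set of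
   reals bounded below, resp. above. *)
Definition jordan_measurable A : Prop :=
  bounded_set A /\ inner_content A = outer_content A.

End content.

Section riemann.
Context {R : realType} {m : nat}.
Implicit Types (A : set 'rV[R]_m) (f : 'rV[R]_m -> R).

Definition jordan_partition A n (P : 'I_n -> set 'rV[R]_m) : Prop :=
  [/\ \bigcup_i P i = A,
      forall i, jordan_measurable (P i)
    & forall i j, i != j -> (P i)° `&` (P j)° = set0].

(* An empty cell contributes 0 to the sums below, its content being 0. *)
Definition lower_integral A f : R :=
  sup [set s | exists n (P : 'I_n -> set 'rV[R]_m), jordan_partition A P /\
         s = \sum_i inf (f @` P i) * outer_content (P i)].

Definition upper_integral A f : R :=
  inf [set s | exists n (P : 'I_n -> set 'rV[R]_m), jordan_partition A P /\
         s = \sum_i sup (f @` P i) * outer_content (P i)].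

(* Jordan measurability of the domain is part of integrability: without it,
   there is no partition and both Darboux integrals are junk values. *)
Definition riemann_integrable A f : Prop :=
  [/\ jordan_measurable A, [bounded f x | x in A]
    & lower_integral A f = upper_integral A f].

(* The common value of the Darboux integrals of an integrable function. *)
Definition riemann_integral A f : R := lower_integral A f.

Definition mx_riemann_integrable p q A (h : 'rV[R]_m -> 'M[R]_(p, q)) : Prop :=
  forall i j, riemann_integrable A (fun x => h x i j).

End riemann.

Section differentiability.
Context {R : realType} {m n : nat}.
Implicit Types (U : set 'rV[R]_m) (F : 'rV[R]_m -> 'rV[R]_n).

Definition strongly_differentiable U F (u : 'rV[R]_m) : Prop :=
  U° u /\ exists A : {linear 'rV[R]_m -> 'rV[R]_n},
    (fun p : 'rV[R]_m * 'rV[R]_m =>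
       `|p.1 - p.2|^-1 *: (F p.1 - F p.2 - A (p.1 - p.2)))
    @ within [set p | [/\ U p.1, U p.2 & p.1 != p.2]] (nbhs (u, u))
    --> (0 : 'rV[R]_n).

(* 'J F x acts on row vectors by right multiplication; transposing it puts
   the partial derivative of F_i in direction j at entry (i, j). *)
Definition jacobi_mx F (x : 'rV[R]_m) : 'M[R]_(n, m) := ('J F x)^T.

Definition ae_jacobi_mx U F (h : 'rV[R]_m -> 'M[R]_(n, m)) : Prop :=
  lebesgue_null (U° `\` [set x | differentiable F x /\ h x = jacobi_mx F x]).

End differentiability.

(* Main.v *)
(** Everything is expressed by comparison with step functions, i.e. finite
combinations of indicators of boxes: the upper integral of F is at most v when
F lies below step functions of integral at most v + e.  By compactness, up to
boxes of total volume e, the set X is a finite disjoint union of boxes Q on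
which G is as close as we like to an affine map with linear part of
determinant +-a and on which |det h| is close to a: all other points of the
closure of X (boundary, points without strong differentiability, points where
h is not the Jacobi matrix, oscillation points of h) form a null set.

Pushing forward a step function that dominates psi bounds the upper integral of
f by that of psi; this needs no injectivity.  Conversely, a cell Q with a <> 0
contains a slightly smaller closed box whose image lies inside the image of Q
(local surjectivity, from Banach's fixed point theorem), hence inside an
elementary set E contained in G(Q).  The sets E of distinct cells are disjoint,
because a common box would be covered by G(K), which is null.  Pulling back,
through the inverse of G on each Q, a step function that dominates f bounds the
upper integral of psi.  So f and psi have the same upper integral for every
bounded f >= 0; adding constants to f gives the same for signed f, and hence
for lower integrals. *)

(* Since [f] is merely bounded, it need not be measurable, and theorems on the Lebesgue integral do
   not reach it. Upper integrals make sense for every bounded function, which is why both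
   comparisons are made for them. Strong differentiability gives an affine approximation for all
   pairs of points of a box, not only for pairs containing its centre; hence the volume bounds on
   every smaller box and the contraction behind local surjectivity. Adding a constant M to [f] adds
   M times the content of [G(X)] to one upper integral and M times the integral of [|\det h|] to the
   other. So both numbers must first be shown to exist and to agree: pushing with [f = 1] bounds the
   outer content of [G(X)], and pulling with [f = 1] shows that the sets E fill [G(X)] up to a small
   content. This forces the sets E to be chosen before [f]. Cells with a = 0 yield no set E; [psi]
   is small there. A null set K may be dense, so [G(K)] need not have content 0; what is used is
   that it contains no box. *)
Require Import Defs.
From HB Require Import structures.
From mathcomp Require Import all_boot all_order all_algebra fingroup perm.
From mathcomp Require Import all_classical all_reals all_analysis.
From mathcomp Require Import ring lra.

Set Implicit Arguments.
Unset Strict Implicit.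
Unset Printing Implicit Defensive.

Import Order.TTheory GRing.Theory Num.Theory.
Import numFieldNormedType.Exports.

Local Open Scope classical_set_scope.
Local Open Scope ring_scope.

(** * Boxes, grids and step functions *)

Lemma sorted_nth_le (R : realType) (p : seq R) (j k : nat) :
  sorted <=%R p -> (k < size p)%N -> (j <= k)%N -> p`_j <= p`_k.
Proof.
move=> sp kp jk; apply: (sorted_leq_nth le_trans le_refl 0 sp) => //.
by rewrite inE (leq_ltn_trans jk).
Qed.

Lemma sorted_gap (R : realType) (p : seq R) (a : R) (k : nat) :
  sorted <=%R p -> a \in p -> (k.+1 < size p)%N -> p`_k < a -> p`_k.+1 <= a.
Proof.
move=> sp /(nthP 0)[j jp <-] kp pkj.
apply: sorted_nth_le => //; rewrite ltnNge; apply/negP => jk; move: pkj; rewrite ltNge => /negP; apply.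
by apply: sorted_nth_le => //; exact: ltnW.
Qed.

(* Telescoping sum of the increments of t |-> min (max t a) b along p. *)
Lemma sum_gaps (R : realType) (p : seq R) (a b : R) :
  sorted <=%R p -> a \in p -> b \in p ->
  \sum_(k < (size p).-1) (p`_k.+1 - p`_k) * (a <= p`_k < b)%R%:R
    = Num.max 0 (b - a).
Proof.
move=> sp ap bp; have p0 : (0 < size p)%N by case: (p) ap.
have gap c k := @sorted_gap R p c k sp.
have [ab|ba] := leP a b; last first.
  rewrite big1 => [|k _]; last first.
    by case: andP => [[h1 h2]|]; rewrite ?mulr0//; lra.
  by rewrite max_l//; lra.
rewrite max_r; last lra.
pose c x := Num.min (Num.max x a) b.
transitivity (\sum_(0 <= k < (size p).-1) (c p`_k.+1 - c p`_k)).
  rewrite big_mkord; apply: eq_bigr => k _.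
  have kp : (k.+1 < size p)%N by rewrite -ltn_predRL.
  have p1 : p`_k <= p`_k.+1.
    exact: sorted_nth_le.
  have ga := gap a k ap kp; have gb := gap b k bp kp.
  rewrite /c; have [h1|h1] /= := leP a p`_k.
    have [h2|h2] /= := ltP p`_k b.
      have := gb h2; rewrite !mulr1 => h3.
      by rewrite !max_l ?min_l//; lra.
    by rewrite !max_l ?min_r//; lra.
  by have := ga h1 => h3; rewrite mulr0 !max_r ?subrr//; lra.
have le0 x : x \in p -> p`_0 <= x.
  move=> /(nthP 0)[j jp <-].
  exact: sorted_nth_le.
have leN x : x \in p -> x <= p`_(size p).-1.
  move=> /(nthP 0)[j jp <-].
  by apply: sorted_nth_le => //; rewrite ?prednK// -ltnS prednK.
rewrite telescope_sumr// /c (max_l (leN _ ap)) (max_r (le0 _ ap)).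
by rewrite min_r ?leN// min_l.
Qed.

Section steps.
Context {R : realType} {m : nat}.
Local Notation V := 'rV[R]_m.
Local Notation Box := (V * V)%type.
Implicit Types (b : Box) (x : V) (s t : seq (R * Box)) (F : V -> R).

Lemma box_vol_ge0 b : 0 <= box_vol b.
Proof. by apply: prodr_ge0 => i _; rewrite le_max lexx. Qed.

Lemma box_vol_nonempty b x : box b x ->
  box_vol b = \prod_i (b.2 0 i - b.1 0 i).
Proof.
by move=> bx; apply: eq_bigr => i _; have := bx i => ?; rewrite max_r//; lra.
Qed.

Lemma box_empty_vol b : ~ (exists x, box b x) -> box_vol b = 0.
Proof.
move=> nb; have [/forallP h|] := boolP [forall i, b.1 0 i < b.2 0 i].
  exfalso; apply: nb; exists b.1 => i; apply/andP; split => //.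
move=> /forallPn[i]; rewrite -leNgt => h.
by rewrite /box_vol (bigD1 i)//= max_l ?mul0r//; lra.
Qed.

(* A common refinement: the cells are bounded by consecutive coordinates, pooled
   over all boxes and all directions. *)
Lemma box_grid (bs : seq Box) : exists (I : finType) (C : I -> Box),
  [/\ trivIset setT (fun i => box (C i)),
      (forall b i x y, b \in bs -> box (C i) x -> box (C i) y ->
         box b x -> box b y),
      (forall b x, b \in bs -> box b x -> exists i, box (C i) x) &
      forall b, b \in bs ->
        box_vol b = \sum_(i | `[<box (C i) `<=` box b>]) box_vol (C i)].
Proof.
pose p := sort <=%R (flatten [seq [seq b.1 0 i | i : 'I_m] ++
                                  [seq b.2 0 i | i : 'I_m] | b <- bs]).
have sp : sorted <=%R p by apply: sort_sorted; exact: le_total.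
have p1 b i : b \in bs -> b.1 0 i \in p.
  move=> bb; rewrite mem_sort; apply/flatten_mapP; exists b => //.
  by rewrite mem_cat; apply/orP; left; apply: map_f; rewrite mem_enum.
have p2 b i : b \in bs -> b.2 0 i \in p.
  move=> bb; rewrite mem_sort; apply/flatten_mapP; exists b => //.
  by rewrite mem_cat; apply/orP; right; apply: map_f; rewrite mem_enum.
pose C (phi : {ffun 'I_m -> 'I_((size p).-1)}) : Box :=
  (\row_i p`_(phi i), \row_i p`_(phi i).+1).
have Kp (k : 'I_((size p).-1)) : (k.+1 < size p)%N by rewrite -ltn_predRL.
have mono (j k : nat) := @sorted_nth_le R p j k sp.
have cst b phi x y : b \in bs -> box (C phi) x -> box (C phi) y ->
    box b x -> box b y.
  move=> bb Cx Cy bx i; move: (Cx i) (Cy i) (bx i); rewrite !mxE.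
  have g1 := sorted_gap sp (p1 b i bb) (Kp (phi i)).
  have g2 := sorted_gap sp (p2 b i bb) (Kp (phi i)).
  have [h1|h1] := ltP p`_(phi i) (b.1 0 i); first by have := g1 h1; lra.
  have [h2|h2] := ltP p`_(phi i) (b.2 0 i); first by have := g2 h2; lra.
  by lra.
exists {ffun 'I_m -> 'I_((size p).-1)}, C; split => //.
- apply/trivIsetP => phi psi _ _ /eqP np; apply/seteqP; split => // x [/= Cx Cy].
  apply: np; apply/ffunP => i; apply/val_inj/eqP; rewrite eqn_leq.
  apply/andP; split; rewrite leqNgt; apply/negP => h.
    by move: (Cx i) (Cy i); rewrite !mxE; have := mono _ _ (ltnW (Kp (phi i))) h; lra.
  by move: (Cx i) (Cy i); rewrite !mxE; have := mono _ _ (ltnW (Kp (psi i))) h; lra.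
- move=> b x bb bx.
  have ex i : exists k : 'I_((size p).-1), p`_k <= x 0 i < p`_k.+1.
    have hx : has (fun y => x 0 i < y) p.
      by apply/hasP; exists (b.2 0 i); [exact: p2|have := bx i; lra].
    pose j := find (fun y => x 0 i < y) p.
    have jp : (j < size p)%N by rewrite -has_find.
    have pj : x 0 i < p`_j by exact: nth_find.
    have j0 : (0 < j)%N.
      rewrite lt0n; apply/eqP => j0; move: pj; rewrite j0.
      have : p`_0 <= b.1 0 i.
        have /(nthP 0)[l lp <-] := p1 b i bb; exact: mono.
      by have := bx i; lra.
    have kp : (j.-1 < (size p).-1)%N by rewrite -ltnS !prednK// (leq_ltn_trans _ jp).
    exists (Ordinal kp) => /=; rewrite prednK// pj andbT leNgt.
    by rewrite (before_find 0)// prednK.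
  have /choice[phi hphi] := ex.
  by exists [ffun i => phi i] => i; rewrite !mxE ffunE.
- move=> b bb; rewrite /box_vol.
  (* Each side of [b] is a sum of gaps between consecutive coordinates. Expanding the product of
     these sums gives one term per cell [phi]: its volume if the cell lies in [b], and 0
     otherwise. *)
  under eq_bigr => i _ do rewrite -(sum_gaps sp (p1 b i bb) (p2 b i bb)).
  rewrite bigA_distr_bigA/= [RHS]big_mkcond/=; apply: eq_bigr => phi _.
  rewrite big_split/=.
  have Evol : \prod_i Num.max 0 ((C phi).2 0 i - (C phi).1 0 i) =
         \prod_i (p`_(phi i).+1 - p`_(phi i)).
    apply: eq_bigr => i _; rewrite !mxE max_r// subr_ge0; apply: mono => //.
  (* A cell of volume 0 is empty and so contained in every box; its term is 0 on both sides. *)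
  rewrite Evol; have [z|z] := eqVneq (\prod_i (p`_(phi i).+1 - p`_(phi i))) 0.
    by rewrite z mul0r; case: asboolP.
  have Cc : box (C phi) (C phi).1.
    move=> i; rewrite !mxE lexx/= lt_neqAle mono// andbT.
    by move/prodf_neq0: z => /(_ i isT); rewrite subr_eq0 eq_sym.
  case: asboolP => h.
    rewrite [X in _ * X]big1 ?mulr1// => i _; move: (h _ Cc i).
    by rewrite !mxE => ->.
  have : ~ box b (C phi).1 by move=> bC; apply: h => y Cy; exact: cst Cc Cy bC.
  move=> /existsNP[i]; rewrite !mxE => /negP/negbTE hi.
  by rewrite [X in _ * X](bigD1 i)//= hi mul0r mulr0.
Qed.

End steps.

Section stepfun.
Context {R : realType} {m : nat}.
Local Notation V := 'rV[R]_m.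
Local Notation Box := (V * V)%type.
Implicit Types (b c : Box) (x : V) (s t : seq (R * Box)) (F : V -> R).

Definition stval s x : R := \sum_(p <- s) p.1 * \1_(box p.2) x.

Definition stint s : R := \sum_(p <- s) p.1 * box_vol p.2.

Definition boxI b c : Box :=
  (\row_i Num.max (b.1 0 i) (c.1 0 i), \row_i Num.min (b.2 0 i) (c.2 0 i)).

Definition sscale (a : R) s := [seq (a * p.1, p.2) | p <- s].

Definition smul s t :=
  [seq (p.1 * q.1, boxI p.2 q.2) | p <- s, q <- t].

Lemma boxIE b c : box (boxI b c) = box b `&` box c.
Proof.
apply/seteqP; split => [x h|x [h1 h2] i].
  by split=> i; have := h i; rewrite !mxE ge_max lt_min => /andP[/andP[? ?] /andP[? ?]]; apply/andP.
move: (h1 i) (h2 i); rewrite !mxE ge_max lt_min => /andP[? ?] /andP[? ?].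
by apply/andP; split; apply/andP.
Qed.

Lemma stval_nil x : stval [::] x = 0. Proof. exact: big_nil. Qed.
Lemma stint_nil : stint [::] = 0. Proof. exact: big_nil. Qed.

Lemma stval_cons p s x : stval (p :: s) x = p.1 * \1_(box p.2) x + stval s x.
Proof. exact: big_cons. Qed.
Lemma stint_cons p s : stint (p :: s) = p.1 * box_vol p.2 + stint s.
Proof. exact: big_cons. Qed.

Lemma stval_cat s t x : stval (s ++ t) x = stval s x + stval t x.
Proof. exact: big_cat. Qed.
Lemma stint_cat s t : stint (s ++ t) = stint s + stint t.
Proof. exact: big_cat. Qed.

Lemma stval_scale a s x : stval (sscale a s) x = a * stval s x.
Proof. by rewrite /stval big_map mulr_sumr; apply: eq_bigr => p _; rewrite mulrA. Qed.
Lemma stint_scale a s : stint (sscale a s) = a * stint s.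
Proof. by rewrite /stint big_map mulr_sumr; apply: eq_bigr => p _; rewrite mulrA. Qed.

Lemma stval_mul s t x : stval (smul s t) x = stval s x * stval t x.
Proof.
rewrite /stval big_allpairs_dep/= mulr_suml; apply: eq_bigr => p _.
rewrite mulr_sumr; apply: eq_bigr => q _.
by rewrite boxIE indicI/= mulrACA.
Qed.

Record grid (bs : seq Box) (I : finType) (C : I -> Box) : Prop := Grid {
  grid_triv : trivIset setT (fun i => box (C i));
  grid_cst : forall b i x y, b \in bs -> box (C i) x -> box (C i) y ->
     box b x -> box b y;
  grid_cover : forall b x, b \in bs -> box b x -> exists i, box (C i) x;
  grid_vol : forall b, b \in bs ->
     box_vol b = \sum_(i | `[<box (C i) `<=` box b>]) box_vol (C i) }.

Lemma exists_grid bs : exists (I : finType) (C : I -> Box), grid bs C.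
Proof. by have [I [C [? ? ? ?]]] := box_grid bs; exists I, C; split. Qed.

(** On a nonempty cell of a grid for the boxes of [s], this is the value of [s] there
    ([grid_stval]). On an empty cell it is the sum of all coefficients, a meaningless number made
    harmless by the volume 0 of the cell. *)
Definition scell s c : R := \sum_(p <- s | `[<box c `<=` box p.2>]) p.1.

Section with_grid.
Variables (bs : seq Box) (I : finType) (C : I -> Box) (gC : grid bs C).
Variable s : seq (R * Box).
Hypothesis sbs : {subset [seq p.2 | p <- s] <= bs}.

Lemma grid_stval i x : box (C i) x -> stval s x = scell s (C i).
Proof.
move=> Cx; rewrite /stval /scell [RHS]big_mkcond/= big_seq [RHS]big_seq.
apply: eq_bigr => p ps; have bp : p.2 \in bs by apply: sbs; apply: map_f.
case: asboolP => h; first by rewrite indicE mem_set ?mulr1//; exact: h.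
rewrite indicE memNset ?mulr0// => bx; apply: h => y Cy.
exact: (grid_cst gC bp Cx Cy bx).
Qed.

Lemma grid_stval0 x : (forall i, ~ box (C i) x) -> stval s x = 0.
Proof.
move=> nC; rewrite /stval big_seq big1// => p ps.
rewrite indicE memNset ?mulr0// => bx.
have [i Ci] := grid_cover gC (sbs (map_f _ ps)) bx; exact: nC Ci.
Qed.

Lemma grid_stint : stint s = \sum_i scell s (C i) * box_vol (C i).
Proof.
rewrite /scell; under eq_bigr => i _ do rewrite big_mkcond/= mulr_suml.
rewrite exchange_big/= /stint big_seq [RHS]big_seq; apply: eq_bigr => p ps.
rewrite (grid_vol gC (sbs (map_f _ ps))) mulr_sumr big_mkcond/=.
by apply: eq_bigr => i _; case: ifP; rewrite ?mul0r.
Qed.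

End with_grid.

(** On a common grid every nonempty cell carries an actual value of the function. Through
    [le_stint], this makes the integral depend on the function only and not on the list that
    represents it. *)
Lemma stint_ge0 s : (forall x, 0 <= stval s x) -> 0 <= stint s.
Proof.
move=> s0; have [I [C gC]] := exists_grid [seq p.2 | p <- s].
rewrite (grid_stint gC)//; apply: sumr_ge0 => i _.
have [[x Cx]|/box_empty_vol->] := pselect (exists x, box (C i) x); last by rewrite mulr0.
by rewrite -(grid_stval gC _ Cx)// mulr_ge0// box_vol_ge0.
Qed.

Lemma le_stint s t : (forall x, stval s x <= stval t x) -> stint s <= stint t.
Proof.
move=> st; suff : 0 <= stint (t ++ sscale (-1) s).
  by rewrite stint_cat stint_scale; lra.
apply: stint_ge0 => x; rewrite stval_cat stval_scale; have := st x; lra.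
Qed.

Lemma stint1 b : stint [:: (1, b)] = box_vol b.
Proof. by rewrite stint_cons stint_nil mul1r addr0. Qed.
Lemma stval1 b x : stval [:: (1, b)] x = \1_(box b) x.
Proof. by rewrite stval_cons stval_nil mul1r addr0. Qed.

(** Inclusion-exclusion for two sets, as products of step functions are step functions. Signed
    coefficients spare a decomposition into disjoint boxes. *)
Lemma union_step (bs : seq Box) :
  exists e, forall x, stval e x = \1_(\bigcup_(b in [set` bs]) box b) x.
Proof.
elim: bs => [|b bs [e he]].
  by exists [::] => x; rewrite stval_nil indicE memNset// => -[].
exists ((1, b) :: e ++ sscale (-1) (smul [:: (1, b)] e)) => x.
rewrite -cat1s !stval_cat stval_scale stval_mul stval1 he !indicE.
have -> : \bigcup_(b0 in [set` b :: bs]) box b0 =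
    box b `|` \bigcup_(b in [set` bs]) box b.
  apply/seteqP; split => [y [c /= + cy]|y [by_|[c /= cb cy]]].
  - by rewrite inE => /orP[/eqP <-|cb]; [left|right; exists c].
  - by exists b => //=; rewrite mem_head.
  - by exists c => //=; rewrite inE cb orbT.
by rewrite in_setU; case: (_ \in _); case: (_ \in _) => /=; lra.
Qed.

(* The upper integral of F over the whole space is at most v. *)
Definition ub F (v : R) := forall e, 0 < e ->
  exists s, (forall x, F x <= stval s x) /\ stint s <= v + e.

Lemma ub_mono F F' v : (forall x, F x <= F' x) -> ub F' v -> ub F v.
Proof.
move=> FF' h e e0; have [s [h1 h2]] := h e e0; exists s; split => // x.
exact: le_trans (FF' x) (h1 x).
Qed.

Lemma ub_le F v w : v <= w -> ub F v -> ub F w.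
Proof. by move=> vw h e e0; have [s [h1 h2]] := h e e0; exists s; split => //; lra. Qed.

Lemma ub_add F F' v v' : ub F v -> ub F' v' -> ub (fun x => F x + F' x) (v + v').
Proof.
move=> h h' e e0; have e20 : 0 < e / 2 by lra.
have [s [h1 h2]] := h _ e20; have [s' [h1' h2']] := h' _ e20.
exists (s ++ s'); split => [x|]; rewrite ?stval_cat ?stint_cat; last lra.
by have := h1 x; have := h1' x; lra.
Qed.

Lemma ub_scale a F v : 0 <= a -> ub F v -> ub (fun x => a * F x) (a * v).
Proof.
move=> a0 h e e0; have e'0 : 0 < e / (a + 1) by rewrite divr_gt0//; lra.
have [s [h1 h2]] := h _ e'0; exists (sscale a s); split => [x|].
  by rewrite stval_scale ler_wpM2l.
rewrite stint_scale (le_trans (ler_wpM2l a0 h2))// mulrDr lerD2l.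
by rewrite mulrA ler_pdivrMr; [nra|lra].
Qed.

Lemma ub_step s : ub (stval s) (stint s).
Proof. by move=> e e0; exists s; split => //; lra. Qed.

Lemma ub0 : ub (fun=> 0) 0.
Proof. by move=> e e0; exists [::]; split=> [x|]; rewrite ?stval_nil// stint_nil; lra. Qed.

Lemma ub_box b : ub (\1_(box b)) (box_vol b).
Proof. by rewrite -stint1; apply: ub_mono (ub_step _) => x; rewrite stval1. Qed.

Lemma ub_sum (J : Type) (r : seq J) (P : pred J) (F : J -> V -> R) (v : J -> R) :
  (forall j, P j -> ub (F j) (v j)) ->
  ub (fun x => \sum_(j <- r | P j) F j x) (\sum_(j <- r | P j) v j).
Proof.
move=> h; elim: r => [|j r ih].
  by rewrite big_nil; apply: ub_mono ub0 => x; rewrite big_nil.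
rewrite big_cons; case: ifP => Pj.
  by apply: ub_mono (ub_add (h _ Pj) ih) => x; rewrite big_cons Pj.
by apply: ub_mono ih => x; rewrite big_cons Pj.
Qed.

Lemma ub_ge s F v : (forall x, stval s x <= F x) -> ub F v -> stint s <= v.
Proof.
move=> sF h; apply/ler_addgt0Pr => e /h[t [h1 h2]].
by apply: le_trans h2; apply: le_stint => x; exact: le_trans (sF x) (h1 x).
Qed.

(** Absorbs an error proportional to [e], so that later estimates may carry any constant that does
    not depend on [e]. *)
Lemma ub_lim F v C : 0 <= C -> (forall e, 0 < e -> ub F (v + C * e)) -> ub F v.
Proof.
move=> C0 h e e0; have e'0 : 0 < e / 2 / (C + 1) by rewrite divr_gt0//; lra.
have [|s [h1 h2]] := h _ e'0 (e / 2); first lra.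
exists s; split => //; apply: le_trans h2 _.
have : C * (e / 2 / (C + 1)) <= e / 2 by rewrite mulrA ler_pdivrMr; [nra|lra].
lra.
Qed.

Lemma ub_ge0 F v w : ub F v -> ub (fun x => - F x) w -> 0 <= v + w.
Proof.
move=> h1 h2; rewrite -stint_nil; apply: ub_ge (ub_add h1 h2) => x.
by rewrite stval_nil subrr.
Qed.

(** The second clause says that the lower integral of [F] is at least [w]. By [ub_ge0] neither bound
    can be improved, so [w] is the integral of [F] over the whole space. *)
Definition integ F w := ub F w /\ ub (fun x => - F x) (- w).

Lemma eq_integ F F' w : F =1 F' -> integ F w -> integ F' w.
Proof.
by move=> E [h1 h2]; split; [apply: ub_mono h1 | apply: ub_mono h2] => x; rewrite E.
Qed.

Lemma integ_step s : integ (stval s) (stint s).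
Proof.
split; first exact: ub_step.
have -> : - stint s = stint (sscale (-1) s) by rewrite stint_scale; lra.
by apply: ub_mono (ub_step _) => x; rewrite stval_scale; lra.
Qed.

Lemma integ_opp F w : integ F w -> integ (fun x => - F x) (- w).
Proof.
by move=> [h1 h2]; split => //; rewrite opprK; apply: ub_mono h1 => x; rewrite opprK.
Qed.

Lemma integ_add F F' w w' : integ F w -> integ F' w' ->
  integ (fun x => F x + F' x) (w + w').
Proof.
move=> [h1 h2] [h3 h4]; split; first exact: ub_add.
by rewrite opprD; apply: ub_mono (ub_add h2 h4) => x; rewrite opprD.
Qed.

Lemma integ_sandwich F :
  (forall e, 0 < e -> exists s t, [/\ forall x, stval s x <= F x,
     forall x, F x <= stval t x & stint t - stint s <= e]) <->
  exists w, integ F w.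
Proof.
split=> [h|[w [h1 h2]] e e0]; last first.
  have e20 : 0 < e / 2 by lra.
  have [t [h3 h4]] := h1 _ e20; have [s [h5 h6]] := h2 _ e20.
  exists (sscale (-1) s), t; split => [x| |]//; last by rewrite stint_scale; lra.
  by rewrite stval_scale; have := h5 x; lra.
pose S := [set stint s | s in [set s | forall x, stval s x <= F x]].
have [s0 [t0 [hs0 ht0 _]]] := h 1 ltr01.
have ubS t : (forall x, F x <= stval t x) -> ubound S (stint t).
  move=> Ft _ [s sF <-]; apply: le_stint => x; exact: le_trans (sF x) (Ft x).
have hS : has_sup S by split; [exists (stint s0), s0|exists (stint t0); exact: ubS].
exists (sup S); split => e e0; have [s [t [hs ht st]]] := h e e0.
  exists t; split => //; have : stint s <= sup S by apply: sup_upper_bound => //; exists s.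
  lra.
exists (sscale (-1) s); split=> [x|]; first by rewrite stval_scale; have := hs x; lra.
have : sup S <= stint t by apply: ge_sup; [case: hS|exact: ubS].
rewrite stint_scale; lra.
Qed.

Lemma integ_mul F e : (forall x, 0 <= stval e x <= 1) -> (exists w, integ F w) ->
  exists w, integ (fun x => F x * stval e x) w.
Proof.
move=> e01 /integ_sandwich h; apply/integ_sandwich => d d0.
have [s [t [hs ht st]]] := h d d0; exists (smul s e), (smul t e); split => [x|x|].
- by rewrite stval_mul ler_wpM2r//; have := e01 x; lra.
- by rewrite stval_mul ler_wpM2r//; have := e01 x; lra.
apply: le_trans st.
suff : stint (smul t e ++ sscale (-1) (smul s e)) <= stint (t ++ sscale (-1) s).
  by rewrite !stint_cat !stint_scale; lra.
apply: le_stint => x; rewrite !stval_cat !stval_scale !stval_mul.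
by have := e01 x; have := hs x; have := ht x; nra.
Qed.

End stepfun.

(** * Jordan content and the Riemann integral *)

Lemma boundedP (R : realType) (U W : normedModType R) (f : U -> W) (A : set U) :
  [bounded f x | x in A] <-> exists M, forall x, A x -> `|f x| <= M.
Proof.
split=> [/ex_strict_bound_gt0[M _ hM]|[M hM]].
  by exists M => x Ax; apply: ltW; exact: hM.
by exists M; split => [|N MN x Ax]; [exact: num_real|exact: le_trans (hM x Ax) (ltW MN)].
Qed.

Lemma ler_entry_norm (R : realType) (m n : nat) (x : 'M[R]_(m, n)) i j : `|x i j| <= `|x|.
Proof.
rewrite [leRHS]/Num.Def.normr/= mx_normrE.
by apply/bigmax_geP; right => /=; exists (i, j).
Qed.

Lemma mx_norm_le (R : realType) (m n : nat) (x : 'M[R]_(m, n)) M :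
  0 <= M -> (forall i j, `|x i j| <= M) -> `|x| <= M.
Proof.
move=> M0 h; rewrite [leLHS]/Num.Def.normr/= mx_normrE.
by apply: bigmax_le => // -[i j] _; exact: h.
Qed.

Section contents.
Context {R : realType} {m : nat}.
Local Notation V := 'rV[R]_m.
Local Notation Box := (V * V)%type.
Implicit Types (b c : Box) (x : V) (s t : seq (R * Box)) (F : V -> R) (A : set V).

Definition boxes (bs : seq Box) : set V := \bigcup_(b in [set` bs]) box b.

Lemma boxes_cat bs bs' : boxes (bs ++ bs') = boxes bs `|` boxes bs'.
Proof.
apply/seteqP; split=> x; last first.
  by case=> [] [b /= bb xb]; exists b => //=; rewrite mem_cat bb ?orbT.
by case=> b /=; rewrite mem_cat => /orP[] bb xb; [left|right]; exists b.
Qed.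

Lemma boxes_cons b bs : boxes (b :: bs) = box b `|` boxes bs.
Proof.
rewrite -cat1s boxes_cat; congr (_ `|` _); apply/seteqP; split => x.
  by case=> c /=; rewrite inE => /eqP->.
by exists b => //=; rewrite inE.
Qed.

Lemma boxes_tnth bs x : boxes bs x -> exists i, box (tnth (in_tuple bs) i) x.
Proof. by move=> [b /= bb xb]; have /tnthP[i ei] : b \in in_tuple bs by []; exists i; rewrite -ei. Qed.

Lemma indic_le1 A x : 0 <= (\1_A x : R) <= 1.
Proof. by rewrite indicE; case: (_ \in _); rewrite /= ?lexx ler01. Qed.

Lemma sum_indic_le (J : finType) (D : J -> set V) A x :
  trivIset setT D -> \bigcup_j D j `<=` A -> \sum_j \1_(D j) x <= (\1_A x : R).
Proof.
move=> tD DA; have [[j Dj]|h] := pselect (exists j, D j x); last first.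
  rewrite big1 => [|j _]; first by have := indic_le1 A x; lra.
  by rewrite indicE memNset// => Dj; apply: h; exists j.
rewrite (bigD1 j)//= big1 => [|k kj].
  by rewrite addr0 !indicE !mem_set//; apply: DA; exists j.
rewrite indicE memNset// => Dk; move/eqP: kj; apply.
by apply: tD => //; exists x.
Qed.

Lemma stint_family n (B : 'I_n -> Box) :
  stint [seq (1, B i) | i <- enum 'I_n] = \sum_i box_vol (B i).
Proof. by rewrite /stint big_map big_enum/=; apply: eq_bigr => i _; rewrite mul1r. Qed.

Lemma stval_family_le n (B : 'I_n -> Box) A x :
  trivIset setT (fun i => box (B i)) -> (forall i, box (B i) `<=` A) ->
  stval [seq (1, B i) | i <- enum 'I_n] x <= \1_A x.
Proof.
move=> tB BA; rewrite /stval big_map big_enum/=; under eq_bigr do rewrite mul1r.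
by apply: sum_indic_le => // y [i _ By]; exact: BA By.
Qed.

Lemma disjoint_vol_le n (B : 'I_n -> Box) A w :
  trivIset setT (fun i => box (B i)) -> (forall i, box (B i) `<=` A) -> ub (\1_A) w ->
  \sum_i box_vol (B i) <= w.
Proof.
by move=> tB BA; rewrite -stint_family; apply: ub_ge => x; exact: stval_family_le.
Qed.

Lemma ub_disjoint n (B : 'I_n -> Box) A :
  trivIset setT (fun i => box (B i)) -> (forall i, box (B i) `<=` A) ->
  ub (fun x => - \1_A x) (- \sum_i box_vol (B i)).
Proof.
move=> tB BA; rewrite -stint_family; apply: ub_mono (integ_step _).2 => x.
by rewrite lerN2; exact: stval_family_le.
Qed.

Lemma ub_indicS A B (v : R) : A `<=` B -> ub (\1_B) v -> ub (\1_A) v.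
Proof.
move=> AB; apply: ub_mono => x; rewrite !indicE ler_nat.
by case: (boolP (x \in A)) => // /set_mem/AB Bx; rewrite mem_set.
Qed.

Lemma ub_boxes bs : ub (\1_(boxes bs)) (\sum_(b <- bs) box_vol b : R).
Proof.
have := @ub_sum R m _ bs xpredT (fun b x => \1_(box b) x) _ (fun b _ => ub_box b).
apply: ub_mono => x; have [[b bb bx]|h] := pselect (boxes bs x); last first.
  by rewrite indicE memNset// sumr_ge0// => b _; have := indic_le1 (box b) x; lra.
rewrite (big_rem b)//= !indicE !mem_set//; last by exists b.
by rewrite lerDl sumr_ge0// => c _; have := indic_le1 (box c) x; lra.
Qed.

(** A dominating step function may take values far from 0 and 1. The grid cells on which its value
    is at least 1 cover [A], and its value is nonnegative on the other nonempty cells, so discarding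
    these does not increase the sum. *)
Lemma ub_cover A v e : ub (\1_A) v -> 0 < e ->
  exists bs, A `<=` boxes bs /\ \sum_(b <- bs) box_vol b <= v + e :> R.
Proof.
move=> h e0; have [s [As sv]] := h e e0.
have [I [C gC]] := exists_grid [seq p.2 | p <- s].
exists [seq C i | i <- enum [pred i | 1 <= scell s (C i)]]; split => [x Ax|].
  have := As x; rewrite indicE mem_set//= => s1.
  have [[i Ci]|nC] := pselect (exists i, box (C i) x); last first.
    move: s1; rewrite (grid_stval0 gC)// ?ler10// => i Ci; apply: nC; by exists i.
  exists (C i) => //=; apply: map_f; rewrite mem_enum inE.
  by rewrite -(grid_stval gC _ Ci).
apply: le_trans sv; rewrite (grid_stint gC)// big_map big_enum/=.
rewrite big_mkcond/=; apply: ler_sum => i _.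
have [[x Cx]|/box_empty_vol->] := pselect (exists x, box (C i) x); last first.
  by rewrite mulr0; case: ifP.
have s0 : 0 <= scell s (C i).
  by rewrite -(grid_stval gC _ Cx)//; apply: le_trans (As x); have := indic_le1 A x; lra.
have := box_vol_ge0 (C i).
by rewrite inE; case: ifP => ?; nra.
Qed.

(** Here [s] dominates minus the indicator of [A]: it is at least -1 everywhere and at least 0 on a
    cell that leaves [A]. The cells contained in [A] therefore have total volume at least
    [- stint s]. *)
Lemma ub_pack A v e : ub (fun x => - \1_A x) (- v) -> 0 < e ->
  exists n (B : 'I_n -> Box), [/\ trivIset setT (fun i => box (B i)),
    \bigcup_i box (B i) `<=` A & v - e <= \sum_i box_vol (B i) :> R].
Proof.
move=> h e0; have [s [As sv]] := h e e0.
have [I [C gC]] := exists_grid [seq p.2 | p <- s].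
pose J := [pred i | `[<box (C i) `<=` A>]].
exists #|J|, (fun k => C (enum_val k)); split => [|x [k _ Cx]|].
- apply/trivIsetP => i j _ _ ij; have /trivIsetP := grid_triv gC; apply => //.
  by apply: contraNN ij => /eqP/enum_val_inj->.
- by have := enum_valP k; move=> /asboolP CA; exact (CA x Cx).
rewrite -(@big_enum_val _ _ _ _ J (fun i => box_vol (C i))).

suff : - stint s <= \sum_(i in J) box_vol (C i) by lra.
rewrite (grid_stint gC)// -sumrN [leRHS]big_mkcond/=; apply: ler_sum => i _.
have [[x Cx]|/box_empty_vol->] := pselect (exists x, box (C i) x); last first.
  by rewrite mulr0 oppr0; case: ifP.
have s1 : -1 <= scell s (C i).
  by rewrite -(grid_stval gC _ Cx)//; apply: le_trans (As x); have := indic_le1 A x; lra.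
have := box_vol_ge0 (C i).
rewrite inE; case: asboolP => [_|CA]; first nra.
have [y [Cy nAy]] : exists y, box (C i) y /\ ~ A y.
  by apply: contrapT => hn; apply: CA => y Cy; apply: contrapT => nA; apply: hn; exists y.
have := As y; rewrite (grid_stval gC _ Cy)// indicE memNset//=; nra.
Qed.

Lemma outer_le A v : ub (\1_A) v -> outer_content A <= v.
Proof.
move=> h; apply/ler_addgt0Pr => e e0; have [bs [Abs sv]] := ub_cover h e0.
apply: le_trans sv; apply: ge_inf.
  by exists 0 => _ [n [B [_ ->]]]; apply: sumr_ge0 => i _; exact: box_vol_ge0.
exists (size bs), (tnth (in_tuple bs)); split=> [x Ax|].
  by have [i xb] := boxes_tnth (Abs _ Ax); exists i.
by rewrite big_tnth.
Qed.

Lemma outer_ub A : (exists w : R, ub (\1_A) w) -> ub (\1_A) (outer_content A).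
Proof.
move=> [w hw]; apply: (@ub_lim _ _ _ _ 1) => // e e0; rewrite mul1r.
rewrite /outer_content; set S := (X in inf X).
have [|_ [n [B [AB ->]]] hv] := @inf_adherent R S e e0.
  split; last first.
    by exists 0 => _ [n [B [_ ->]]]; apply: sumr_ge0 => i _; exact: box_vol_ge0.
  have [bs [Abs sv]] := ub_cover hw ltr01.
  exists (\sum_(b <- bs) box_vol b), (size bs), (tnth (in_tuple bs)); split=> [x Ax|].
    by have [i xb] := boxes_tnth (Abs _ Ax); exists i.
  by rewrite big_tnth.
apply: ub_le (ltW hv) _.
have -> : \sum_i box_vol (B i) = \sum_(b <- [seq B i | i <- enum 'I_n]) box_vol b.
  by rewrite big_map big_enum.
apply: ub_indicS (ub_boxes _) => x /AB[i _ Bi].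
by exists (B i) => //=; apply: map_f; rewrite mem_enum.
Qed.

Lemma outer_ge0 A : 0 <= outer_content A.
Proof.
rewrite /outer_content; set S := (X in inf X).
have lS : lbound S 0 by move=> _ [n [B [_ ->]]]; apply: sumr_ge0 => i _; exact: box_vol_ge0.
by have [->|/set0P S0] := eqVneq S set0; [rewrite inf0|exact: lb_le_inf].
Qed.

Lemma ub_le_inner A v : (exists w : R, ub (\1_A) w) ->
  ub (fun x => - \1_A x) (- v) -> v <= inner_content A.
Proof.
move=> [w hw] h; apply/ler_addgt0Pr => e e0; have [n [B [tB BA Bv]]] := ub_pack h e0.
suff : \sum_i box_vol (B i) <= inner_content A by lra.
apply: sup_upper_bound; last by exists n, B.
split; first by exists (\sum_i box_vol (B i)), n, B.
exists w => _ [k [D [DA tD ->]]]; apply: disjoint_vol_le tD _ hw => i x Dx.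
by apply: DA; exists i.
Qed.

End contents.

Section jordan.
Context {R : realType} {m : nat}.
Local Notation V := 'rV[R]_m.
Local Notation Box := (V * V)%type.
Implicit Types (b c : Box) (x : V) (s t : seq (R * Box)) (F f : V -> R) (A : set V).

Definition cube x (r : R) : Box := (x - const_mx r, x + const_mx r).

Lemma cubeE x r y : box (cube x r) y <-> forall i, - r <= y 0 i - x 0 i < r.
Proof.
by split=> h i; have := h i; rewrite !mxE => /andP[h1 h2]; apply/andP; split; lra.
Qed.

Lemma bounded_ubP A : bounded_set A <-> exists w : R, ub (\1_A) w.
Proof.
split=> [/boundedP[M hM]|[w hw]].
  exists (box_vol (cube 0 (M + 1))); apply: ub_indicS (ub_box _) => x Ax.
  apply/cubeE => i; rewrite mxE subr0.
  by have := le_trans (ler_entry_norm x 0 i) (hM x Ax); rewrite ler_norml; lra.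
have [bs [Abs _]] := ub_cover hw ltr01; apply/boundedP.
exists (\sum_(b <- bs) (`|b.1| + `|b.2|)) => x /Abs[b /= bb xb].
rewrite (big_rem b)//=.
have S0 : 0 <= \sum_(y <- rem b bs) (`|y.1| + `|y.2|) by apply: sumr_ge0.
apply: mx_norm_le => [|i j]; first by rewrite !addr_ge0.
rewrite ord1; have := xb j; have := ler_entry_norm b.1 0 j; have := ler_entry_norm b.2 0 j.
rewrite !ler_norml; have := normr_ge0 b.1; have := normr_ge0 b.2; lra.
Qed.

Lemma jordanP A : jordan_measurable A <-> exists w : R, integ (\1_A) w.
Proof.
split=> [[/bounded_ubP[w hw] io]|[w [h1 h2]]].
  exists (outer_content A); split; first by apply: outer_ub; exists w.
  rewrite -io; apply: (@ub_lim _ _ _ _ 1) => // e e0; rewrite mul1r.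
  rewrite /inner_content; set S := (X in sup X).
  have [|_ [n [B [BA tB ->]]] hv] := @sup_adherent R S e e0.
    split; first by exists (\sum_(i < 0) 0), 0%N, (fun=> (0, 0)); split => [x [[]]//|[]//|]; rewrite !big_ord0.
    exists w => _ [n [B [BA tB ->]]]; apply: disjoint_vol_le tB _ hw => i x Bx.
    by apply: BA; exists i.
  apply: ub_le (ub_disjoint tB _); first lra.
  by move=> i x Bx; apply: BA; exists i.
have bA : bounded_set A by apply/bounded_ubP; exists w.
split => //; apply/eqP; rewrite eq_le; apply/andP; split; last first.
  by rewrite (le_trans (outer_le h1))// ub_le_inner//; exists w.
apply: ge_sup; first by exists (\sum_(i < 0) 0), 0%N, (fun=> (0, 0)); split => [x [[]]//|[]//|]; rewrite !big_ord0.
move=> _ [n [B [BA tB ->]]].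
apply: disjoint_vol_le tB _ (outer_ub (ex_intro _ w h1)) => i x Bx.
by apply: BA; exists i.
Qed.

Lemma integ_content A w : integ (\1_A) w -> outer_content A = w.
Proof.
move=> [h1 h2]; apply/eqP; rewrite eq_le outer_le//=.
have := ub_ge0 (outer_ub (ex_intro _ w h1)) h2; lra.
Qed.

Lemma jordan_integ A : jordan_measurable A -> integ (\1_A) (outer_content A).
Proof. by move=> /jordanP[w hw]; rewrite (integ_content hw). Qed.

Definition obox b : set V := [set x | forall i, b.1 0 i < x 0 i < b.2 0 i].

Lemma obox_sub b : obox b `<=` box b.
Proof. by move=> x h i; have /andP[h1 h2] := h i; rewrite (ltW h1). Qed.

Lemma obox_open b : open (obox b).
Proof.
rewrite openE => x bx.
suff : \forall y \near (x : V), forall i, b.1 0 i < (y : V) 0 i < b.2 0 i by [].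
apply: (@filter_forall V _ (fun i (y : V) => b.1 0 i < y 0 i < b.2 0 i) (nbhs x)) => i.
have /andP[h1 h2] := bx i.
have cx : (fun y : V => y 0 i) @ x --> x 0 i by exact: coord_continuous.
apply: filterS2 (cvgr_gt _ cx _ h1) (cvgr_lt _ cx _ h2) => y h3 h4.
by apply/andP.
Qed.

Lemma obox_interior b A x : box b `<=` A -> obox b x -> A° x.
Proof.
move=> bA bx; apply: (@interiorS _ (obox b)); first exact: subset_trans (@obox_sub b) bA.
by rewrite (interior_id (obox b)).1//; exact: obox_open.
Qed.

Lemma box_meet_obox b x : box b x -> exists y, obox b y.
Proof.
move=> bx; exists (\row_i ((b.1 0 i + b.2 0 i) / 2)) => i; rewrite mxE.
by have := bx i; lra.
Qed.

(** The cells of a Jordan partition may share boundary points, so their indicators may add up to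
    more than 1. Packings of the cells by boxes do not: two boxes of different cells that meet would
    share an open box, lying in both interiors. *)
Lemma content_additive A n (P : 'I_n -> set V) : jordan_partition A P ->
  \sum_i outer_content (P i) <= outer_content A.
Proof.
move=> [PA jP dP]; apply/ler_addgt0Pr => e e0.
(* [n.+1] rather than [n], because the partition may have no cells. *)
have e'0 : 0 < e / n.+1%:R by rewrite divr_gt0.
have pk i : exists bs : seq Box, [/\ forall b, b \in bs -> box b `<=` P i,
    forall x, stval [seq (1, b) | b <- bs] x <= \1_(P i) x &
    outer_content (P i) - e / n.+1%:R <= stint [seq (1, b) | b <- bs]].
  have [k [B [tB BP Bv]]] := ub_pack (jordan_integ (jP i)).2 e'0.
  have BP' j : box (B j) `<=` P i by move=> x Bx; apply: BP; exists j.
  exists [seq B i | i <- enum 'I_k]; rewrite -map_comp stint_family; split=> // [b|x].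
    by move=> /mapP[j _ ->]; exact: BP'.
  exact: stval_family_le.
have {pk} /choice[bs hbs] := pk.
have bA : exists w : R, ub (\1_A) w.
  exists (\sum_i outer_content (P i)).
  apply: ub_mono (ub_sum _ (fun i _ => (jordan_integ (jP i)).1)) => x /=.
  have [Ax|nA] := pselect (A x); last first.
    by rewrite indicE memNset// sumr_ge0// => i _; have := indic_le1 (P i) x (R := R); lra.
  have [i _ Px] : (\bigcup_i P i) x by rewrite PA.
  rewrite (bigD1 i)//= !indicE !mem_set// lerDl.
  by rewrite sumr_ge0// => j _; have := indic_le1 (P j) x (R := R); lra.
pose S := flatten [seq [seq (1 : R, b) | b <- bs i] | i <- enum 'I_n].
have SE x : stval S x = \sum_i stval [seq (1, b) | b <- bs i] x.
  by rewrite /stval big_flatten/= big_map big_enum.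
have SI : stint S = \sum_i stint [seq (1, b) | b <- bs i].
  by rewrite /stint big_flatten/= big_map big_enum.
suff : stint S <= outer_content A.
  rewrite SI => h; suff : \sum_i outer_content (P i) <= \sum_i (stint [seq (1, b) | b <- bs i] + e / n.+1%:R).
    rewrite big_split/= sumr_const card_ord -[_ / _ *+ _]mulr_natr => h1.
    have : e / n.+1%:R * n%:R <= e.
      by rewrite mulrAC ler_pdivrMr// ler_pM2l// ler_nat.
    by move=> h2; exact: le_trans h1 (lerD h h2).
  by apply: ler_sum => i _; have [_ _] := hbs i; rewrite lerBlDr.
apply: ub_ge (outer_ub bA) => x; rewrite SE.
have s0 i y : 0 <= stval [seq (1, b) | b <- bs i] y.
  rewrite /stval big_map sumr_ge0// => b _; rewrite mul1r.
  by have := indic_le1 (box b) y (R := R); lra.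
have spos i y : 0 < stval [seq (1, b) | b <- bs i] y -> exists2 b, b \in bs i & box b y.
  move=> h; apply: contrapT => nb; move: h; rewrite /stval big_map big_seq big1 ?ltxx// => b bb.
  by rewrite indicE memNset ?mulr0// => by_; apply: nb; exists b.
have [[i si]|h] := pselect (exists i, 0 < stval [seq (1, b) | b <- bs i] x); last first.
  rewrite big1 => [|i _]; first by have := indic_le1 A x (R := R); lra.
  by apply/eqP; rewrite eq_le s0 andbT leNgt; apply/negP => ?; apply: h; exists i.
rewrite (bigD1 i)//= big1 ?addr0 => [|j ji].
  have [_ h _] := hbs i; apply: le_trans (h x) _; rewrite !indicE ler_nat.
  by case: (boolP (x \in P i)) => // /set_mem Px; rewrite mem_set// -PA; exists i.
apply/eqP; rewrite eq_le s0 andbT leNgt; apply/negP => /spos[c cj cx].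
have [b bi bx] := spos _ _ si.
have [y by_] : exists y, obox (boxI b c) y.
  by apply: (@box_meet_obox _ x); rewrite boxIE.
suff : ((P i)° `&` (P j)°) y by rewrite dP// eq_sym.
have sb : box (boxI b c) `<=` P i.
  by rewrite boxIE => z [bz _]; have [h _ _] := hbs i; exact: (h b).
have sc : box (boxI b c) `<=` P j.
  by rewrite boxIE => z [_ cz]; have [h _ _] := hbs j; exact: (h c).
by split; [exact: obox_interior sb _|exact: obox_interior sc _].
Qed.

Lemma content_partition A n (P : 'I_n -> set V) : jordan_partition A P ->
  \sum_i outer_content (P i) = outer_content A.
Proof.
move=> pP; apply/eqP; rewrite eq_le content_additive//=; have [PA jP dP] := pP.
apply: outer_le; apply: ub_mono (ub_sum _ (fun i _ => (jordan_integ (jP i)).1)) => x /=.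
have [Ax|nA] := pselect (A x); last first.
  by rewrite indicE memNset// sumr_ge0// => i _; have := indic_le1 (P i) x (R := R); lra.
have [i _ Px] : (\bigcup_i P i) x by rewrite PA.
rewrite (bigD1 i)//= !indicE !mem_set// lerDl.
by rewrite sumr_ge0// => j _; have := indic_le1 (P j) x (R := R); lra.
Qed.

End jordan.

(** * Darboux integrals compared with integrals of step functions *)

Section riemann.
Context {R : realType} {m : nat}.
Local Notation V := 'rV[R]_m.
Local Notation Box := (V * V)%type.
Implicit Types (b c : Box) (x : V) (s t : seq (R * Box)) (F f : V -> R) (A : set V).

Lemma integ_indicM A s : jordan_measurable A -> (forall x, 0 <= stval s x <= 1) ->
  exists w, integ (fun x => \1_A x * stval s x) w.
Proof. by move=> /jordanP jA s01; apply: integ_mul. Qed.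

Lemma jordanI_box A b : jordan_measurable A -> jordan_measurable (A `&` box b).
Proof.
move=> jA; apply/jordanP; have [x|w hw] := integ_indicM jA (s := [:: (1, b)]).
  by rewrite stval1; exact: indic_le1.
by exists w; apply: eq_integ hw => x; rewrite stval1 indicI.
Qed.

Lemma jordanD_boxes A (bs : seq Box) : jordan_measurable A ->
  jordan_measurable (A `\` boxes bs).
Proof.
move=> jA; have [e he] := union_step bs.
have [x|w hw] := integ_indicM jA (s := e); first by rewrite he; exact: indic_le1.
apply/jordanP; have /jordanP[v hv] := jA; exists (v - w).
apply: eq_integ (integ_add hv (integ_opp hw)) => x; rewrite he !indicE.
by rewrite in_setD; do 2 case: (_ \in _) => /=; lra.
Qed.

Lemma outer_set0 : outer_content (set0 : set V) = 0.
Proof.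
apply/eqP; rewrite eq_le outer_ge0 andbT; apply: outer_le; apply: ub_mono ub0 => x.
by rewrite indicE in_set0.
Qed.

Lemma outer_box_le A b : A `<=` box b -> outer_content A <= box_vol b.
Proof. by move=> Ab; apply: outer_le; apply: ub_indicS Ab (ub_box b). Qed.

Lemma outer_box b : outer_content (box b) = box_vol b.
Proof.
apply: integ_content; have := integ_step [:: (1, b)]; rewrite stint1.
by apply: eq_integ => x; rewrite stval1.
Qed.

Section fixA.
Variables (A : set V) (f : V -> R) (M : R).
Hypotheses (jA : jordan_measurable A) (fM : forall x, A x -> `|f x| <= M).

Let M0 (P : set V) : P `<=` A -> has_sup (f @` P) \/ P = set0.
Proof.
move=> PA; have [->|/set0P[x Px]] := eqVneq P set0; [by right|left].
split; first by exists (f x), x.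
by exists M => _ [y /PA/fM + <-]; rewrite ler_norml => /andP[].
Qed.

Lemma sup_ge P x : P `<=` A -> P x -> f x <= sup (f @` P).
Proof.
move=> PA Px; have [hs|P0] := M0 PA; last by rewrite P0 in Px.
by apply: sup_upper_bound => //; exists x.
Qed.

Lemma upper_sum_ge n (P : 'I_n -> set V) : jordan_partition A P ->
  - M * outer_content A <= \sum_i sup (f @` P i) * outer_content (P i).
Proof.
move=> pP; rewrite -(content_partition pP) mulr_sumr; apply: ler_sum => i _.
have PA : P i `<=` A by have [<- _ _] := pP; move=> x Px; exists i.
have [P0|/set0P[x Px]] := eqVneq (P i) set0; first by rewrite P0 outer_set0 !mulr0.
apply: ler_wpM2r; first exact: outer_ge0.
apply: le_trans (sup_ge PA Px); have := fM (PA _ Px); rewrite ler_norml; lra.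
Qed.

Lemma trivial_partition : jordan_partition A (fun _ : 'I_1 => A).
Proof.
split => // [|i j]; last by rewrite !ord1.
by apply/seteqP; split=> [x [] //|x Ax]; exists ord0.
Qed.

(** A dominating step function yields a Jordan partition: the traces on [A] of its grid cells, and
    the part of [A] outside the grid. *)
Lemma upper_le v : ub (fun x => f x * \1_A x) v -> upper_integral A f <= v.
Proof.
move=> h; apply/ler_addgt0Pr => e e0; have [s [fs sv]] := h e e0.
apply: le_trans sv.
have [I [C gC]] := exists_grid [seq p.2 | p <- s].
pose rest := A `\` boxes (codom C).
pose P (k : 'I_(#|I|.+1)) := if unlift ord0 k is Some j
  then A `&` box (C (enum_val j)) else rest.
have PA k : P k `<=` A by rewrite /P; case: unlift => [j|] x [].
have jP k : jordan_measurable (P k).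
  by rewrite /P; case: unlift => [j|]; [exact: jordanI_box|exact: jordanD_boxes].
have PP k l x : P k x -> P l x -> k = l.
  rewrite /P; case: unliftP => [j ->|->]; case: unliftP => [i ->|->] //.
  - move=> [_ h1] [_ h2]; congr lift; apply: enum_val_inj.
    by apply: (grid_triv gC) => //; exists x.
  - by move=> [_ h1] [_ h2]; case: h2; exists (C (enum_val j)) => //; exact: codom_f.
  - by move=> [_ h1] [_ h2]; case: h1; exists (C (enum_val i)) => //; exact: codom_f.
have pP : jordan_partition A P.
  split => //; last first.
    move=> k l kl; apply/seteqP; split => // x [/interior_subset h1 /interior_subset h2].
    by move/eqP: kl; apply; exact: PP h1 h2.
  apply/seteqP; split => [x [k _ /PA]//|x Ax].
  have [[b /= /codomP[i ->] Cx]|nb] := pselect (boxes (codom C) x).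
    by exists (lift ord0 (enum_rank i)) => //; rewrite /P liftK enum_rankK.
  by exists ord0 => //; rewrite /P unlift_none.
have : upper_integral A f <= \sum_i sup (f @` P i) * outer_content (P i).
  apply: ge_inf; last by exists #|I|.+1, P.
  by exists (- M * outer_content A) => _ [n [Q [pQ ->]]]; exact: upper_sum_ge.
move=> /le_trans; apply.
(* Outside the grid [s] vanishes, so [f] is at most 0 on [rest] and its term is at most 0. *)
rewrite (grid_stint gC)// big_ord_recl -[leRHS]add0r; apply: lerD.
  have [P0|/set0P[y Py]] := eqVneq (P ord0) set0; first by rewrite P0 outer_set0 mulr0.
  rewrite mulr_le0_ge0 ?outer_ge0//; apply: ge_sup; first by exists (f y), y.
  move=> _ [x + <-]; rewrite /P unlift_none => -[Ax nx].
  have := fs x; rewrite indicE mem_set// mulr1 (grid_stval0 gC)// => i Ci.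
  by apply: nx; exists (C i) => //; exact: codom_f.
rewrite (reindex (fun j : 'I_#|I| => enum_val j : I)) /=; last first.
  by exists enum_rank => i _; rewrite ?enum_valK ?enum_rankK.
apply: ler_sum => k _; rewrite {1 2}/P liftK; set i := enum_val k.
have sge y : box (C i) y -> ~ A y -> 0 <= scell s (C i).
  move=> Cy nA; rewrite -(grid_stval gC _ Cy)//; have := fs y.
  by rewrite indicE memNset// mulr0.
have [P0|/set0P[y Py]] := eqVneq (A `&` box (C i)) set0.
  rewrite P0 outer_set0 mulr0.
  have [[y Cy]|/box_empty_vol->] := pselect (exists y, box (C i) y); last by rewrite mulr0.
  rewrite mulr_ge0 ?box_vol_ge0//; apply: (sge y) => // Ay.
  by have : (A `&` box (C i)) y by []; rewrite P0.
have supc : sup (f @` (A `&` box (C i))) <= scell s (C i).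
  apply: ge_sup; first by exists (f y), y.
  move=> _ [x [Ax Cx] <-]; have := fs x.
  by rewrite indicE mem_set// mulr1 (grid_stval gC _ Cx).
apply: le_trans (ler_wpM2r (outer_ge0 _) supc) _.
(* A nonnegative value only profits from replacing the content of the trace by the volume of the
   cell. A negative value forces the cell into [A], since [s] is at least 0 outside [A]; content and
   volume then agree. *)
have [s0|s0] := leP 0 (scell s (C i)).
  by apply: ler_wpM2l => //; apply: outer_box_le => x [].
suff -> : A `&` box (C i) = box (C i) by rewrite outer_box.
apply/seteqP; split => [x []//|x Cx]; split => //; apply: contrapT => nA.
by have := sge x Cx nA; lra.
Qed.

Lemma upper_ub : ub (fun x => f x * \1_A x) (upper_integral A f).
Proof.
apply: (@ub_lim _ _ _ _ 1) => // e e0; rewrite mul1r.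
rewrite /upper_integral; set S := (X in inf X).
have [|_ [n [P [pP ->]]] hv] := @inf_adherent R S e e0.
  split; first by eexists; exists 1%N, (fun=> A); split; [exact: trivial_partition|reflexivity].
  by exists (- M * outer_content A) => _ [n [Q [pQ ->]]]; exact: upper_sum_ge.
apply: ub_le (ltW hv) _; have [PA jP _] := pP.
have PiA i : P i `<=` A by rewrite -PA => x Px; exists i.
have [jA1 jA2] := jordan_integ jA.
have [[x0 Ax0]|A0] := pselect (exists x, A x); last first.
  rewrite big1 => [|i _]; last first.
    suff -> : P i = set0 by rewrite outer_set0 mulr0.
    by apply/seteqP; split => // x /PiA Ax; apply: A0; exists x.
  by apply: ub_mono ub0 => x; rewrite indicE memNset ?mulr0// => Ax; apply: A0; exists x.
have M0' : 0 <= M by exact: le_trans (normr_ge0 _) (fM Ax0).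
(* Adding [M] makes the coefficients of nonempty cells nonnegative, as [ub_scale] requires and as
   overlaps of the cells demand. The surplus is removed through the lower bound on the indicator of
   [A], which is where Jordan measurability of [A] enters. *)
have -> : \sum_i sup (f @` P i) * outer_content (P i) =
    \sum_i (sup (f @` P i) + M) * outer_content (P i) + M * (- outer_content A).
  under [in RHS]eq_bigr do rewrite mulrDl.
  have E : \sum_i M * outer_content (P i) = M * outer_content A.
    by rewrite -mulr_sumr (content_partition pP).
  rewrite big_split/= E.
  by rewrite [M * - _]mulrN addrK.
have h i : ub (fun x => (sup (f @` P i) + M) * \1_(P i) x)
      ((sup (f @` P i) + M) * outer_content (P i)).
  have [P0|/set0P[x Px]] := eqVneq (P i) set0.
    rewrite P0 outer_set0 mulr0; apply: ub_mono ub0 => x.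
    by rewrite indicE in_set0 mulr0.
  apply: ub_scale; last exact: (jordan_integ (jP i)).1.
  have := sup_ge (PiA i) Px; have := fM (PiA _ _ Px); rewrite ler_norml; lra.
apply: ub_mono (ub_add (ub_sum _ (fun i _ => h i)) (ub_scale M0' jA2)) => x /=.
have hpos i : 0 <= (sup (f @` P i) + M) * \1_(P i) x.
  have [Px|nP] := pselect (P i x); last by rewrite indicE memNset// mulr0.
  rewrite indicE mem_set// mulr1; have := sup_ge (PiA i) Px; have := fM (PiA _ _ Px).
  rewrite ler_norml; lra.
have [Ax|nA] := pselect (A x); last first.
  by rewrite indicE memNset// oppr0 !mulr0 addr0 sumr_ge0.
have [i _ Px] : (\bigcup_i P i) x by rewrite PA.
rewrite (bigD1 i)//= !indicE !mem_set//= mulrN !mulr1.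
have : 0 <= \sum_(j < n | j != i) (sup [set f x | x in P j] + M) * \1_(P j) x.
  by apply: sumr_ge0.
by have := sup_ge (PiA i) Px; lra.
Qed.

End fixA.

Lemma lower_integralE A f : lower_integral A f = - upper_integral A (fun x => - f x).
Proof.
rewrite /upper_integral /lower_integral [X in _ = - X]/inf opprK; congr sup.
have E (P : set V) : inf (f @` P) = - sup ((fun x => - f x) @` P).
  by rewrite /inf; congr (- sup _); rewrite image_comp.
apply/seteqP; split => [_ [n [P [pP ->]]]|_ [_ [n [P [pP ->]]] <-]].
  exists (\sum_i sup ((fun x => - f x) @` P i) * outer_content (P i)); first by exists n, P.
  by rewrite -sumrN; apply: eq_bigr => i _; rewrite E mulNr.
by exists n, P; split => //; rewrite -sumrN; apply: eq_bigr => i _; rewrite E mulNr.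
Qed.

Lemma riemann_integ A f : riemann_integrable A f ->
  integ (fun x => f x * \1_A x) (riemann_integral A f).
Proof.
move=> [jA /boundedP[M fM] lu].
have fM' x : A x -> `|- f x| <= M by rewrite normrN; exact: fM.
rewrite /riemann_integral; split; first by rewrite lu; exact: upper_ub fM.
rewrite lower_integralE opprK; apply: ub_mono (upper_ub jA fM') => x.
by rewrite mulNr.
Qed.

Lemma integ_riemann A f w : jordan_measurable A -> [bounded f x | x in A] ->
  integ (fun x => f x * \1_A x) w ->
  riemann_integrable A f /\ riemann_integral A f = w.
Proof.
move=> jA bf; have /boundedP[M fM] := bf.
have fM' x : A x -> `|- f x| <= M by rewrite normrN; exact: fM.
move=> [h1 h2].
have u1 := upper_le jA fM h1.
have h2' : ub (fun x => - f x * \1_A x) (- w) by apply: ub_mono h2 => x; rewrite mulNr.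
have u2 := upper_le jA fM' h2'.
have u3 : 0 <= upper_integral A f + upper_integral A (fun x => - f x).
  apply: (ub_ge0 (upper_ub jA fM)); apply: ub_mono (upper_ub jA fM') => x.
  by rewrite mulNr.
by rewrite /riemann_integrable /riemann_integral lower_integralE; split; [split|] => //; lra.
Qed.

End riemann.

(** * Null sets and finite covers *)

(** Factors are exchanged one at a time; [1 <= M] lets the highest power of [M] bound all the
    others. It serves both volumes, as products of sides, and determinants. *)
Lemma prod_lipschitz (R : realType) (J : Type) (r : seq J) (a b : J -> R) (M d : R) :
  1 <= M -> (forall j, `|a j| <= M) -> (forall j, `|b j| <= M) ->
  (forall j, `|a j - b j| <= d) ->
  `|\prod_(j <- r) a j - \prod_(j <- r) b j| <= (size r)%:R * M ^+ size r * d.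
Proof.
move=> M1 aM bM abd; have M0 : 0 <= M by lra.
have bb s : `|\prod_(j <- s) b j| <= M ^+ size s.
  elim: s => [|j s ih]; first by rewrite big_nil normr1.
  by rewrite big_cons normrM exprS ler_pM.
elim: r => [|j r ih]; first by rewrite !big_nil subrr normr0 !mul0r.
have d0 : 0 <= d by apply: le_trans (abd j).
rewrite !big_cons.
have -> : a j * \prod_(j0 <- r) a j0 - b j * \prod_(j0 <- r) b j0 =
  a j * (\prod_(j0 <- r) a j0 - \prod_(j0 <- r) b j0) +
  (a j - b j) * \prod_(j0 <- r) b j0 by ring.
apply: le_trans (ler_normD _ _) _; rewrite !normrM.
have h1 := ler_pM (normr_ge0 _) (normr_ge0 _) (aM j) ih.
have h2 := ler_pM (normr_ge0 _) (normr_ge0 _) (abd j) (bb r).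
apply: le_trans (lerD h1 h2) _.
have E : M ^+ size r <= M ^+ (size r).+1 by rewrite exprS ler_peMl// exprn_ge0.
have := ler_wpM2l d0 E.
rewrite /= -[(size r).+1]addn1 natrD.
have -> : M * ((size r)%:R * M ^+ size r * d) = (size r)%:R * M ^+ (size r + 1) * d.
  by rewrite addn1 exprS; ring.
rewrite addn1; lra.
Qed.

Lemma sum_geometric_half (R : realType) (e : R) n : 0 <= e ->
  \sum_(k < n) e * 2^-1 ^+ k.+1 <= e.
Proof.
move=> e0; suff -> : \sum_(k < n) e * 2^-1 ^+ k.+1 = e * (1 - 2^-1 ^+ n).
  have : 0 <= (2^-1 : R) ^+ n by rewrite exprn_ge0// invr_ge0.
  by move=> ?; rewrite ler_piMr//; lra.
elim: n => [|n ih]; first by rewrite big_ord0 expr0 subrr mulr0.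
by rewrite big_ord_recr/= ih exprS; field.
Qed.

Section nullsets.
Context {R : realType} {m : nat}.
Local Notation V := 'rV[R]_m.
Local Notation Box := (V * V)%type.
Implicit Types (b c : Box) (x : V) (s t : seq (R * Box)) (F f : V -> R) (A N : set V).

(* A negative d shrinks the box. *)
Definition enlarge b (d : R) : Box := (b.1 - const_mx d, b.2 + const_mx d).

Lemma enlarge_obox b d x : 0 < d -> box b x -> obox (enlarge b d) x.
Proof. by move=> d0 h i; have := h i; rewrite !mxE; lra. Qed.

Lemma enlarge_vol b : exists2 C, 0 <= C &
  forall d, `|d| <= 1 -> `|box_vol (enlarge b d) - box_vol b| <= C * `|d|.
Proof.
(* The 2 covers the change of a side by [2 * d] with [|d| <= 1], and the 1 gives [1 <= M]. *)
pose M := 1 + (`|b.1| + `|b.2| + 2).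
have M1 : 1 <= M by rewrite /M; have := normr_ge0 b.1; have := normr_ge0 b.2; lra.
exists (m%:R * M ^+ m * 2) => [|d d1].
  by rewrite !mulr_ge0// exprn_ge0//; lra.
have hm : size (index_enum 'I_m) = m.
  by rewrite -[RHS]card_ord -sum1_card -sum1_size.
have hb i : `|Num.max 0 (b.2 0 i - b.1 0 i)| <= M.
  have := ler_entry_norm b.1 0 i; have := ler_entry_norm b.2 0 i.
  by rewrite [`|Num.max _ _|]ger0_norm ?le_max ?lexx// ge_max /M !ler_norml; lra.
suff : `|box_vol (enlarge b d) - box_vol b| <=
    (size (index_enum 'I_m))%:R * M ^+ size (index_enum 'I_m) * (2 * `|d|).
  by rewrite hm mulrA.
apply: prod_lipschitz => // i; rewrite !mxE.
  have := ler_entry_norm b.1 0 i; have := ler_entry_norm b.2 0 i.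
  rewrite [`|Num.max _ _|]ger0_norm ?le_max ?lexx// ge_max /M !ler_norml; 
  have [k1 k2] : -1 <= d /\ d <= 1 by apply/andP; rewrite -ler_norml.
  by move=> /andP[k3 k4] /andP[k5 k6]; apply/andP; split; lra.
have d2 : - `|d| <= d <= `|d| by rewrite -ler_norml.
rewrite ler_norml.
by case: (leP 0 (b.2 0 i - b.1 0 i)) => h1; case: (leP 0 (_ + d - _)) => h2; lra.
Qed.

Lemma enlarge_small b e : 0 < e -> exists d, [/\ 0 < d,
   box_vol (enlarge b d) <= box_vol b + e & box_vol b - e <= box_vol (enlarge b (- d))].
Proof.
move=> e0; have [C C0 hC] := enlarge_vol b.
have C1 : 0 < C + 1 by lra.
exists (Num.min 1 (e / (C + 1))); set d := Num.min _ _.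
have d0 : 0 < d by rewrite lt_min ltr01 divr_gt0.
have Cd : C * d <= e.
  have : d * (C + 1) <= e by rewrite -ler_pdivlMr// ge_min lexx orbT.
  lra.
have d1 : `|d| <= 1 by rewrite gtr0_norm// ge_min lexx.
have := hC d d1; have := hC (- d); rewrite normrN gtr0_norm// -[d]gtr0_norm// => /(_ d1).
by rewrite !ler_norml gtr0_norm//; split => //; lra.
Qed.

Definition oboxes (bs : seq Box) : set V := \bigcup_(b in [set` bs]) obox b.

Lemma oboxes_sub bs : oboxes bs `<=` boxes bs.
Proof. by move=> x [b bb bx]; exists b => //; exact: obox_sub. Qed.

Lemma enlarge_boxes (bs : seq Box) e : 0 < e -> exists cs,
  [/\ (forall b, b \in bs -> exists2 c, c \in cs &
          exists2 d, 0 < d & c = enlarge b d),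
      boxes bs `<=` oboxes cs &
      \sum_(c <- cs) box_vol c <= \sum_(b <- bs) box_vol b + e].
Proof.
elim: bs e => [|b bs ih] e e0.
  by exists [::]; split => [//|x []//|]; rewrite !big_nil add0r ltW.
have e20 : 0 < e / 2 by lra.
have [cs [h1 h2 h3]] := ih _ e20; have [d [d0 hd _]] := enlarge_small b e20.
exists (enlarge b d :: cs); split.
- move=> c; rewrite inE => /orP[/eqP->|/h1[c' c'cs hc']].
    by exists (enlarge b d); [rewrite mem_head|exists d].
  by exists c' => //; rewrite inE c'cs orbT.
- move=> x; rewrite boxes_cons => -[bx|/h2[c ccs cx]].
    by exists (enlarge b d); [rewrite /= mem_head|exact: enlarge_obox].
  by exists c => //=; rewrite inE ccs orbT.
- by rewrite !big_cons; lra.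
Qed.

Lemma ub_ocover A v e : ub (\1_A) v -> 0 < e ->
  exists bs, A `<=` oboxes bs /\ \sum_(b <- bs) box_vol b <= v + e.
Proof.
move=> h e0; have e20 : 0 < e / 2 by lra.
have [bs [Abs hv]] := ub_cover h e20; have [cs [_ h1 h2]] := enlarge_boxes bs e20.
by exists cs; split; [exact: subset_trans h1|lra].
Qed.

Definition cbox b : set V := [set x | forall i, b.1 0 i <= x 0 i <= b.2 0 i].

Lemma cbox_closed b : closed (cbox b).
Proof.
have -> : cbox b = \bigcap_i [set x | b.1 0 i <= x 0 i <= b.2 0 i].
  by apply/seteqP; split => [x h i _|x h i]; [exact: h|exact: (h i)].
apply: closed_bigI => i _.
set S := (X in closed X); have -> : S =
   (fun x : V => x 0 i) @^-1` [set y | b.1 0 i <= y] `&`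
   (fun x : V => x 0 i) @^-1` [set y | y <= b.2 0 i].
  by apply/seteqP; split => [x /andP[]|x [h1 h2]] //; apply/andP.
have /continuous_closedP h := @coord_continuous R 1 m 0 i.
by apply: closedI; apply: h; [exact: closed_ge|exact: closed_le].
Qed.

Lemma enlarge_cbox b d x : 0 < d -> cbox b x -> obox (enlarge b d) x.
Proof. by move=> d0 h i; have := h i; rewrite !mxE; lra. Qed.

Lemma shrink_cbox b d x : 0 < d -> cbox (enlarge b (- d)) x -> obox b x.
Proof. by move=> d0 h i; have := h i; rewrite !mxE; lra. Qed.

Lemma box_sub_cbox b : box b `<=` cbox b.
Proof. by move=> x h i; have /andP[-> /ltW ->] := h i. Qed.

(** A finite union of closed boxes is closed, so the closed versions of finitely many covering boxes
    cover the closure; slightly larger boxes contain them. *)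
Lemma ub_closure A v : ub (\1_A) v -> ub (\1_(closure A)) v.
Proof.
move=> h; apply: (@ub_lim _ _ _ _ 2) => // e e0.
have [bs [Abs hv]] := ub_cover h e0; have [cs [h1 _ h2]] := enlarge_boxes bs e0.
apply: (@ub_le _ _ _ (\sum_(c <- cs) box_vol c)); first lra.
apply: ub_indicS (ub_boxes cs).
have cl : closed (\bigcup_(b in [set` bs]) cbox b).
  by apply: closed_bigcup => [|b _]; [exact: finite_seq|exact: cbox_closed].
have : closure A `<=` \bigcup_(b in [set` bs]) cbox b.
  move/closure_id: cl => ->; apply: closure_subset => x /Abs[b bb bx].
  by exists b => //; exact: box_sub_cbox.
move=> hc x /hc[b /= /h1[c ccs [d d0 cE]] bx]; apply: oboxes_sub.
by exists c => //; rewrite cE; exact: enlarge_cbox.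
Qed.

Lemma ub_interior A v : ub (fun x => - \1_A x) (- v) ->
  ub (fun x => - \1_(A°) x) (- v).
Proof.
move=> h; apply: (@ub_lim _ _ _ _ 1) => // e e0; rewrite mul1r.
have e20 : 0 < e / 2 by lra.
have [n [B [tB BA vB]]] := ub_pack h e20.
have e'0 : 0 < e / 2 / n.+1%:R by rewrite divr_gt0.
have /choice[d hd] : forall i, exists d, 0 < d /\
    box_vol (B i) - e / 2 / n.+1%:R <= box_vol (enlarge (B i) (- d)).
  by move=> i; have [d [? ? ?]] := enlarge_small (B i) e'0; exists d.
pose D i := enlarge (B i) (- d i).
have DB i : box (D i) `<=` obox (B i).
  by move=> x Dx; apply: (@shrink_cbox _ (d i)); [exact: (hd i).1|exact: box_sub_cbox].
have DA i : box (D i) `<=` A°.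
  move=> x /DB Dx; apply: obox_interior Dx => y By; apply: BA; by exists i.
apply: (@ub_le _ _ _ (- \sum_i box_vol (D i))).
  suff : \sum_i box_vol (B i) <= \sum_i box_vol (D i) + e / 2 by lra.
  have : \sum_i box_vol (B i) <= \sum_i (box_vol (D i) + e / 2 / n.+1%:R).
    by apply: ler_sum => i _; rewrite -lerBlDr; exact: (hd i).2.
  move=> /le_trans; apply; rewrite big_split/= lerD2l sumr_const card_ord.
  by rewrite -[_ / _ *+ _]mulr_natr mulrAC ler_pdivrMr// ler_pM2l// ler_nat.
apply: ub_disjoint => //.
move=> i j _ _ [y [/DB/obox_sub Bi /DB/obox_sub Bj]].
by apply: tB => //; exists y.
Qed.

Lemma ub_boundary A : jordan_measurable A -> ub (\1_(closure A `\` A°)) 0.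
Proof.
move=> /jordanP[w [h1 h2]].
rewrite -(subrr w); apply: ub_mono (ub_add (ub_closure h1) (ub_interior h2)) => x.
rewrite !indicE in_setD.
have : x \in (A° : set V) -> x \in (closure A : set V).
  by move=> /set_mem/interior_subset Ax; apply: mem_set; exact: subset_closure.
by case: (x \in (A° : set V)); case: (x \in (closure A : set V)) => //= h;
  first [by rewrite subrr lexx | lra | by have := h isT].
Qed.

Lemma box_cover K (P : Box -> Prop) : compact K ->
  (forall x, K x -> exists b, P b /\ obox b x) ->
  exists bs, (forall b, b \in bs -> P b) /\ K `<=` oboxes bs.
Proof.
rewrite compact_cover => cK h.
have [||D hD KD] := cK Box [set b | P b] obox.
- by move=> b _; exact: obox_open.
- by move=> x /h[b [Pb bx]]; exists b.
exists (finmap.enum_fset D); split => [b bD|x /KD[b bD bx]].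
  by have := hD b; rewrite inE; apply.
by exists b.
Qed.

End nullsets.

Section nullcover.
Context {R : realType} {m : nat}.
Local Notation V := 'rV[R]_m.+1.
Local Notation Box := (V * V)%type.
Implicit Types (b c : Box) (x : V) (s t : seq (R * Box)) (F f : V -> R) (A N X : set V).

(** Lebesgue nullity in a form suited to compactness: the boxes are open, and bounds on partial sums
    replace a series of extended reals. *)
Definition nullc N := forall e, 0 < e -> exists B : nat -> Box,
  N `<=` \bigcup_k obox (B k) /\ forall n, \sum_(k < n) box_vol (B k) <= e.

Lemma nullcS N N' : N `<=` N' -> nullc N' -> nullc N.
Proof.
move=> NN h e /h[B [h1 h2]]; exists B; split => //.
exact: subset_trans h1.
Qed.

(** Half of [e] pays for the given cover, the other half, spread as a geometric series, for opening
    its boxes. *)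
Lemma lebesgue_null_nullc N : lebesgue_null N -> nullc N.
Proof.
move=> N0 e e0.
have : (lebesgue_outer N < (e / 2)%:E)%E by rewrite N0 lte_fin; lra.
move=> /ereal_inf_lt[_ [B NB <-] Be].
have Bn n : \sum_(k < n) box_vol (B k) <= e / 2.
  rewrite -lee_fin; apply: le_trans (ltW Be).
  rewrite -(big_mkord xpredT (fun k => box_vol (B k))) -sumEFin.
  by apply: nneseries_lim_ge => k _ _; rewrite lee_fin box_vol_ge0.
have /choice[d hd] : forall k, exists d, 0 < d /\
    box_vol (enlarge (B k) d) <= box_vol (B k) + e / 2 * 2^-1 ^+ k.+1.
  move=> k; have ek : 0 < e / 2 * 2^-1 ^+ k.+1 by rewrite mulr_gt0 ?exprn_gt0//; lra.
  by have [d [? ? ?]] := enlarge_small (B k) ek; exists d.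
exists (fun k => enlarge (B k) (d k)); split => [x /NB[k _ Bx]|n].
  by exists k => //; apply: enlarge_obox => //; exact: (hd k).1.
have geo : \sum_(k < n) e / 2 * 2^-1 ^+ k.+1 <= e / 2.
  by apply: sum_geometric_half; lra.
have : \sum_(k < n) box_vol (enlarge (B k) (d k)) <=
    \sum_(k < n) (box_vol (B k) + e / 2 * 2^-1 ^+ k.+1).
  by apply: ler_sum => k _; exact: (hd k).2.
by rewrite big_split/=; have := Bn n; lra.
Qed.

Lemma box_vol0 : box_vol ((0, 0) : Box) = 0.
Proof. by rewrite /box_vol (bigD1 ord0)//= !mxE subrr maxxx mul0r. Qed.

Lemma ub_nullc N : ub (\1_N) 0 -> nullc N.
Proof.
move=> h e e0; have [bs [Nbs hv]] := ub_ocover h e0.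
exists (fun k => nth (0, 0) bs k); split => [x /Nbs[b /= bb bx]|n].
  by exists (index b bs) => //; rewrite nth_index.
move: hv; rewrite add0r => /(le_trans _); apply.
rewrite -(big_mkord xpredT (fun k => box_vol (nth (0, 0) bs k))).
rewrite (big_nth (0, 0)) /=.
have [nb|nb] := leqP n (size bs).
  rewrite [leRHS](big_cat_nat _ nb)//= lerDl sumr_ge0// => k _; exact: box_vol_ge0.
rewrite (big_cat_nat _ (ltnW nb))//= [X in _ + X]big1_seq ?addr0// => k.
rewrite mem_index_iota => /andP[_ /andP[kb _]].
by rewrite nth_default ?box_vol0.
Qed.

Lemma nullcU N N' : nullc N -> nullc N' -> nullc (N `|` N').
Proof.
move=> h h' e e0; have e20 : 0 < e / 2 by lra.
have [B [h1 h2]] := h _ e20; have [B' [h1' h2']] := h' _ e20.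
exists (fun k => if odd k then B k./2 else B' k./2); split => [x [/h1|/h1'] [k _ kx]|n].
- by exists k.*2.+1 => //=; rewrite odd_double uphalf_double.
- by exists k.*2 => //=; rewrite odd_double doubleK.
have D k : \sum_(j < k.*2) box_vol (if odd j then B j./2 else B' j./2) =
    \sum_(j < k) box_vol (B j) + \sum_(j < k) box_vol (B' j).
  elim: k => [|k ih]; first by rewrite !big_ord0 addr0.
  by rewrite doubleS !big_ord_recr/= ih odd_double/= uphalf_double doubleK; ring.
have nn : (n <= n.*2)%N by rewrite -addnn leq_addr.
apply: (@le_trans _ _ (\sum_(j < n.*2) box_vol (if odd j then B j./2 else B' j./2))).
  rewrite -!(big_mkord xpredT (fun j => box_vol (if odd j then B j./2 else B' j./2))).
  by rewrite [leRHS](big_cat_nat _ nn)//= lerDl sumr_ge0// => k _; exact: box_vol_ge0.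
by rewrite D; have := h2 n; have := h2' n; lra.
Qed.

Lemma bounded_closure A : bounded_set A -> bounded_set (closure A).
Proof. by move=> /bounded_ubP[w hw]; apply/bounded_ubP; exists w; exact: ub_closure. Qed.

(** By compactness, finitely many boxes cover the closure of [X], each satisfying [P] or belonging
    to a small cover of [N]. They may overlap; since [P] passes to subsets, it holds on the disjoint
    cells into which a common grid cuts the boxes of the first kind. Compactness also bounds the
    indices of those of the second kind, which form [ds]. *)
Lemma decomp X N (P : set V -> Prop) e :
  (forall A B, A `<=` B -> P B -> P A) -> bounded_set X -> nullc N ->
  (forall x, closure X x -> N x \/ exists b, P (box b) /\ obox b x) ->
  0 < e -> exists n (Q : 'I_n -> Box) (ds : seq Box),
   [/\ trivIset setT (fun i => box (Q i)), forall i, P (box (Q i)),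
       X `<=` (\bigcup_i box (Q i)) `|` boxes ds &
       \sum_(d <- ds) box_vol d <= e].
Proof.
move=> PS bX N0 hP e0; have [B [NB Be]] := N0 _ e0.
have cX : compact (closure X).
  by apply: bounded_closed_compact; [exact: bounded_closure|exact: closed_closure].
have [|bs [hbs Xbs]] := @box_cover R m.+1 (closure X)
    (fun b => P (box b) \/ exists k, b = B k) cX.
  move=> x /hP[/NB[k _ kx]|[b [Pb bx]]]; first by exists (B k); split => //; right; exists k.
  by exists b; split => //; left.
have [n hn] : exists n, forall b, b \in bs -> P (box b) \/ exists2 k, (k < n)%N & b = B k.
  elim: bs hbs {Xbs} => [|b bs ih] hbs; first by exists 0%N.
  have [|n hn] := ih; first by move=> c cb; apply: hbs; rewrite inE cb orbT.
  have [Pb|[k bk]] := hbs b (mem_head _ _).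
    by exists n => c; rewrite inE => /orP[/eqP->|/hn//]; left.
  exists (maxn n k.+1) => c; rewrite inE => /orP[/eqP->|/hn[?|[l ln cl]]].
  - by right; exists k => //; rewrite leq_max leqnn orbT.
  - by left.
  - by right; exists l => //; rewrite leq_max ln.
have [I [C gC]] := exists_grid bs.
pose J := [pred i | `[<P (box (C i))>]].
exists #|J|, (fun k => C (enum_val k)), [seq B (val k) | k <- enum 'I_n]; split.
- apply/trivIsetP => i j _ _ ij; have /trivIsetP := grid_triv gC; apply => //.
  by apply: contraNN ij => /eqP/enum_val_inj->.
- by move=> i; have := enum_valP i => /asboolP.
- move=> x Xx; have [b /= bb /obox_sub bx] := Xbs _ (subset_closure Xx).
  have [Pb|[k kn bk]] := hn _ bb; last first.
    right; exists (B k); last by rewrite -bk.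
    by apply/mapP; exists (Ordinal kn); rewrite ?mem_enum.
  left; have [i Ci] := grid_cover gC bb bx.
  have Ji : i \in J.
    apply/asboolP; apply: PS Pb => y Cy; exact: (grid_cst gC bb Ci Cy bx).
  by exists (enum_rank_in Ji i) => //; rewrite enum_rankK_in.
- by rewrite big_map big_enum/=; exact: Be.
Qed.

Lemma ub_indicI_boundary b : ub (\1_(box b `\` obox b)) 0.
Proof.
have h : ub (fun x => - \1_(obox b) x) (- box_vol b).
  have := (integ_step [:: (1, b)]).2; rewrite stint1 => h.
  have h' : ub (fun x => - \1_(box b) x) (- box_vol b).
    by apply: ub_mono h => x; rewrite stval1.
  apply: (@ub_lim _ _ _ _ 1) => // e e0; rewrite mul1r.
  have [d [d0 _ hd]] := enlarge_small b e0.
  apply: (@ub_le _ _ _ (- box_vol (enlarge b (- d)))); first lra.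
  have := (integ_step [:: (1, enlarge b (- d))]).2; rewrite stint1.
  apply: ub_mono => x; rewrite stval1 lerN2 !indicE ler_nat.
  case: (boolP (x \in box (enlarge b (-d)))) => // /set_mem bx.
  by rewrite mem_set//; apply: shrink_cbox d0 _; exact: box_sub_cbox.
rewrite -(subrr (box_vol b)); apply: ub_mono (ub_add (ub_box b) h) => x.
rewrite !indicE in_setD.
have : x \in obox b -> x \in box b by move=> /set_mem/obox_sub/mem_set.
by case: (x \in obox b); case: (x \in box b) => //= k;
  first [by rewrite subrr lexx | lra | by have := k isT].
Qed.

(** A Chebyshev estimate. Enclose [F] between step functions [s] and [t] whose integrals differ by
    at most [n * e]: a point of large oscillation has [t - s >= n] or lies on the boundary of a grid
    cell. The former set has content at most [e], the latter content 0. *)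
Lemma ub_osc X F w n : jordan_measurable X -> 0 < n ->
  integ (fun x => F x * \1_X x) w ->
  ub (\1_[set x | X° x /\ ~ exists b, [/\ obox b x, box b `<=` X &
     forall y z, box b y -> box b z -> `|F y - F z| <= n]]) 0.
Proof.
move=> jX n0 hF; set N := (X in \1_X).
apply: (@ub_lim _ _ _ _ 1) => // e e0; rewrite mul1r add0r.
have en0 : 0 < n * e by rewrite mulr_gt0.
have [s [t [hs ht st]]] := (integ_sandwich (fun x => F x * \1_X x)).2 (ex_intro _ w hF) _ en0.
have [bX _] := jX; have /bounded_ubP[v hv] := bX.
have [xs [Xxs _]] := ub_cover hv ltr01.
(* The boxes [xs] cover [X], so that each of its points lies in some cell. *)
pose bs := [seq p.2 | p <- s] ++ [seq p.2 | p <- t] ++ xs.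
have [I [C gC]] := exists_grid bs.
have ss : {subset [seq p.2 | p <- s] <= bs} by move=> b h; rewrite mem_cat h.
have ts : {subset [seq p.2 | p <- t] <= bs} by move=> b h; rewrite !mem_cat h orbT.
have hsum : ub (fun x => n^-1 * stval (t ++ sscale (-1) s) x +
    \sum_i \1_(box (C i) `\` obox (C i)) x) (n^-1 * (n * e) + \sum_(i : I) 0).
  apply: ub_add; last by apply: ub_sum => i _; exact: ub_indicI_boundary.
  apply: ub_scale; first by rewrite invr_ge0 ltW.
  by apply: ub_le (ub_step _); rewrite stint_cat stint_scale; lra.
have -> : e = n^-1 * (n * e) + \sum_(i : I) 0 by rewrite big1// addr0 mulKf ?gt_eqF.
apply: ub_mono hsum => x.
have d0 y : 0 <= stval t y - stval s y by have := hs y; have := ht y; lra.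
have b0 : 0 <= \sum_i (\1_(box (C i) `\` obox (C i)) x : R).
  by apply: sumr_ge0 => i _; have := indic_le1 (box (C i) `\` obox (C i)) x (R := R); lra.
have n'0 : 0 < n^-1 by rewrite invr_gt0.
have [Nx|nN] := pselect (N x); last first.
  rewrite indicE memNset//= addr_ge0// mulr_ge0 ?(ltW n'0)// stval_cat stval_scale.
  by have := d0 x; lra.
rewrite indicE mem_set//=; have [Xx nb] := Nx.
have [b bxs bx] := Xxs _ (interior_subset Xx).
have [|i Ci] := grid_cover gC (b := b) _ bx; first by rewrite !mem_cat bxs !orbT.
have [oC|noC] := pselect (obox (C i) x); last first.
  have -> : (1 : R) = 0 + 1 by rewrite add0r.
  apply: lerD.
    by rewrite mulr_ge0 ?(ltW n'0)// stval_cat stval_scale; have := d0 x; lra.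
  rewrite (bigD1 i)//= [X in X + _]indicE mem_set//= lerDl.
  by apply: sumr_ge0 => j _; have := indic_le1 (box (C j) `\` obox (C j)) x (R := R); lra.
suff : n <= stval t x - stval s x.
  move=> h; rewrite -[leLHS]addr0; apply: lerD => //.
  have : n^-1 * n <= n^-1 * (stval t x - stval s x) by rewrite ler_pM2l.
  by rewrite mulVf ?lt0r_neq0// stval_cat stval_scale mulN1r.
rewrite leNgt; apply/negP => tn; apply: nb.
have [c [cx cX]] : exists c, obox c x /\ box c `<=` X.
  have /nbhs_ballP[d /= dpos hd] := Xx.
  have d20 : 0 < d / 2 by lra.
  exists (cube x (d / 2)); split => [j|y /cubeE yc]; first by rewrite !mxE; lra.
  apply: hd; rewrite -ball_normE/=; apply: le_lt_trans (_ : d / 2 < d); last lra.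
  apply: mx_norm_le => [|k j]; first lra.
  by rewrite ord1 !mxE ler_norml; have := yc j; lra.
exists (boxI c (C i)); split.
- by move=> j; have := cx j; have := oC j; rewrite !mxE gt_max lt_min => /andP[-> ->] /andP[-> ->].
- by rewrite boxIE => y [/cX].
- move=> y z; rewrite boxIE => -[/cX Xy Cy] [/cX Xz Cz].
  have := hs y; have := ht y; have := hs z; have := ht z.
  rewrite !indicE !mem_set// !mulr1.
  rewrite !(grid_stval gC ss Cy, grid_stval gC ss Cz, grid_stval gC ts Cy, grid_stval gC ts Cz).
  move: tn; rewrite (grid_stval gC ss Ci) (grid_stval gC ts Ci) ler_norml; lra.
Qed.

End nullcover.

(** * Volume of linear and nearly linear images *)

Section linear_images.
Context {R : realType} {m : nat}.
Local Notation V := 'rV[R]_m.+1.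
Local Notation Box := (V * V)%type.
Implicit Types (b c : Box) (x : V) (s t : seq (R * Box)) (F f : V -> R) (A N X S : set V).
Implicit Types (T : 'M[R]_m.+1).

Lemma ub_set0 : ub (\1_(set0 : set V)) (0 : R).
Proof. by apply: ub_mono ub0 => x; rewrite indicE in_set0. Qed.

Lemma ub_bigcup (J : eqType) (r : seq J) (A : J -> set V) (v : J -> R) :
  (forall j, j \in r -> ub (\1_(A j)) (v j)) ->
  ub (\1_(\bigcup_(j in [set` r]) A j)) (\sum_(j <- r) v j).
Proof.
elim: r => [|j r ih] h.
  by rewrite big_nil; apply: ub_indicS ub_set0 => x [].
have hr : forall k, k \in r -> ub (\1_(A k)) (v k).
  by move=> k kr; apply: h; rewrite inE kr orbT.
rewrite big_cons; apply: ub_mono (ub_add (h j (mem_head _ _)) (ih hr)) => x.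
rewrite !indicE -natrD ler_nat.
case: (boolP (x \in \bigcup_(j in _) _)) => // /set_mem[k /=].
rewrite inE => /orP[/eqP-> Ax|kr Ax]; first by rewrite mem_set.
by rewrite [X in (_ + nat_of_bool X)%N]mem_set ?leq_addl//; exists k.
Qed.

(** In each direction, one tile more than the integer part of side length over [sg i]. The overhang
    is what adds [sg i] to the sides of the box. *)
Lemma box_tile b (sg : 'I_m.+1 -> R) : (forall i, 0 < sg i) ->
  exists ps : seq V,
   box b `<=` \bigcup_(p in [set` ps]) box (p, p + \row_i sg i) /\
   (size ps)%:R * \prod_i sg i <= \prod_i (Num.max 0 (b.2 0 i - b.1 0 i) + sg i).
Proof.
move=> sg0; have [[x0 bx0]|nb] := pselect (exists x, box b x); last first.
  exists [::]; split => [x bx|]; first by exfalso; apply: nb; exists x.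
  rewrite mul0r; apply: prodr_ge0 => i _.
  by rewrite addr_ge0 ?(ltW (sg0 i))// le_max lexx.
pose w i := b.2 0 i - b.1 0 i.
have w0 i : 0 < w i by have := bx0 i; rewrite /w; lra.
pose n i := (Num.truncn (w i / sg i)).+1.
have wn i : 0 <= w i / sg i by rewrite divr_ge0// ltW.
have n1 i : w i / sg i < (n i)%:R by have /andP[] := truncn_itv (wn i).
have n2 i : (n i)%:R * sg i <= w i + sg i.
  have /andP[h _] := truncn_itv (wn i).
  rewrite /n -natr1 mulrDl mul1r lerD2r -ler_pdivlMr//.
pose pt (phi : {dffun forall i : 'I_m.+1, 'I_(n i)}) : V :=
  \row_i (b.1 0 i + sg i * (phi i)%:R).
exists [seq pt phi | phi : {dffun forall i : 'I_m.+1, 'I_(n i)}]; split => [x bx|].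
  have k_lt (i : 'I_m.+1) : (Num.truncn ((x 0 i - b.1 0 i)%R / sg i)%R < n i)%N.
    rewrite ltnS; apply: le_truncn; rewrite ler_pM2r ?invr_gt0//.
    by have := bx i; rewrite /w; lra.
  pose phi : {dffun forall i : 'I_m.+1, 'I_(n i)} := [ffun i => Ordinal (k_lt i)].
  exists (pt phi); first by apply/mapP; exists phi; rewrite ?mem_enum.
  move=> i; rewrite !mxE ffunE /=.
  have x0i : 0 <= (x 0 i - b.1 0 i) / sg i.
    by rewrite divr_ge0 ?(ltW (sg0 i))//; have := bx i; lra.
  have /andP[h1 h2] := truncn_itv x0i.
  move: h1 h2; set k := Num.truncn _; rewrite ler_pdivlMr// ltr_pdivrMr// -natr1 => h1 h2.
  by apply/andP; split; lra.
rewrite size_map -cardE card_dep_ffun foldrE big_map big_enum/=.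
rewrite natr_prod -big_split/=; apply: ler_prod => i _.
rewrite card_ord mulr_ge0 ?(ltW (sg0 i))//=.
by apply: le_trans (n2 i) _; rewrite lerD2r le_max lexx orbT.
Qed.

(** Only an upper bound on the volume of images; for an invertible matrix, the matching lower bound
    is the upper bound for the inverse. *)
Definition linbound T (c : R) := forall b,
  ub (\1_((fun x => x *m T) @` box b)) (c * box_vol b).

Lemma linboundM T1 T2 (c1 c2 : R) : 0 <= c2 -> linbound T1 c1 -> linbound T2 c2 ->
  linbound (T1 *m T2) (c2 * c1).
Proof.
move=> c20 h1 h2 b; apply: (@ub_lim _ _ _ _ c2) => // e e0.
have [bs [hbs hv]] := ub_cover (h1 b) e0.
apply: (@ub_le _ _ _ (\sum_(c <- bs) c2 * box_vol c)).
  by rewrite -mulr_sumr -mulrA -mulrDr ler_wpM2l.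
apply: ub_indicS (ub_bigcup (A := fun c => (fun x => x *m T2) @` box c) (fun c _ => h2 c)).
move=> _ [x bx <-]; have [|c cbs xc] := hbs (x *m T1); first by exists x.
by exists c => //; exists (x *m T1) => //; rewrite mulmxA.
Qed.

Lemma linbound_perm (s : 'S_m.+1) : linbound (perm_mx s) 1.
Proof.
move=> b; rewrite mul1r.
pose c : Box := (col_perm s^-1%g b.1, col_perm s^-1%g b.2).
have -> : box_vol b = box_vol c.
  rewrite /box_vol (reindex_inj (@perm_inj _ s^-1%g))/=.
  by apply: eq_bigr => i _; rewrite !mxE.
apply: ub_indicS (ub_box c) => _ [x bx <-] i.
have -> : x *m perm_mx s = col_perm s^-1%g x by rewrite col_permE invgK.
by rewrite !mxE; exact: bx.
Qed.

(* For T triangular, tile by boxes of sides d ^ (r i + 1) with d small: the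
   off-diagonal entries then move a tile by little compared to its sides. *)
Lemma linbound_trig (r : 'I_m.+1 -> nat) T :
  (forall i j, T i j != 0 -> i = j \/ (r j < r i)%N) ->
  linbound T (\prod_i `|T i i|).
Proof.
move=> hT b; have [[x0 bx0]|nb] := pselect (exists x, box b x); last first.
  rewrite (box_empty_vol nb) mulr0; apply: ub_indicS ub_set0 => y [x bx _].
  by apply: nb; exists x.
pose w i := b.2 0 i - b.1 0 i.
have w0 i : 0 < w i by have := bx0 i; rewrite /w; lra.
have volE : box_vol b = \prod_i w i by rewrite (box_vol_nonempty bx0).
pose K0 := \sum_i \sum_j `|T i j|.
have K00 : 0 <= K0.
  by rewrite /K0 sumr_ge0// => i _; rewrite sumr_ge0.
pose K := 2 * K0 + 1.
pose W := \sum_i w i.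
have W0 : 0 <= W by apply: sumr_ge0 => i _; exact: ltW.
have wW i : w i <= W.
  by rewrite /W (bigD1 i)//= lerDl sumr_ge0// => j _; exact: ltW.
have TK i j : `|T i j| <= K0.
  rewrite /K0 (bigD1 i)//= (bigD1 j)//= -addrA lerDl addr_ge0 ?sumr_ge0// => k _.
  exact: sumr_ge0.
pose M := (W + 1) * (K0 + K) + 1.
have M1 : 1 <= M by rewrite /M lerDr mulr_ge0// /K; lra.
pose n := size (index_enum 'I_m.+1).
pose D := K0 + W * K + K.
have D0 : 0 <= D by rewrite !addr_ge0 ?mulr_ge0// /K; lra.
apply: (@ub_lim _ _ _ _ (n%:R * M ^+ n * D)) => [|e e0].
  by rewrite !mulr_ge0// exprn_ge0//; lra.
pose d := Num.min 1 e.
have d0 : 0 < d by rewrite lt_min ltr01.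
have d1 : d <= 1 by rewrite ge_min lexx.
have de : d <= e by rewrite ge_min lexx orbT.
pose sg i := d ^+ (r i).+1.
have sg0 i : 0 < sg i by rewrite exprn_gt0.
have sgd i : sg i <= d by rewrite /sg exprS ler_piMr ?(ltW d0)// exprn_ile1// ltW.
have [ps [bps hps]] := box_tile b sg0.
apply: (@ub_le _ _ _ ((size ps)%:R * \prod_j (sg j * (`|T j j| + K * d)))).
  rewrite big_split/= mulrA.
  apply: (@le_trans _ _ (\prod_i (w i + sg i) * \prod_i (`|T i i| + K * d))).
    apply: ler_wpM2r; first by apply: prodr_ge0 => i _; rewrite addr_ge0// mulr_ge0 ?(ltW d0)// /K; lra.
    apply: le_trans hps _; rewrite le_eqVlt; apply/orP; left; apply/eqP.
    by apply: eq_bigr => i _; rewrite max_r//; exact: ltW (w0 i).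
  rewrite volE -!big_split/=.
  have hd : `|\prod_i ((w i + sg i) * (`|T i i| + K * d)) - \prod_i (`|T i i| * w i)| <=
      n%:R * M ^+ n * (D * d).
    have hM i : 0 <= (w i + sg i) * (`|T i i| + K * d) <= M.
      have k1 : 0 <= w i + sg i <= W + 1.
        by have := wW i; have := w0 i; have := sg0 i; have := sgd i; lra.
      have k2 : 0 <= `|T i i| + K * d <= K0 + K.
        have Kd : 0 <= K * d <= K by rewrite /K; apply/andP; split; nra.
        by have := TK i i; have := normr_ge0 (T i i); lra.
      apply/andP; split; first by have /andP[? _] := k1; have /andP[? _] := k2; exact: mulr_ge0.
      apply: (@le_trans _ _ ((W + 1) * (K0 + K))); last by rewrite /M lerDl.
      by have /andP[? ?] := k1; have /andP[? ?] := k2; exact: ler_pM.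
    apply: prod_lipschitz => // i.
    - by have /andP[h1 h2] := hM i; rewrite ger0_norm.
    - rewrite ger0_norm ?mulr_ge0 ?(ltW (w0 i))//.
      have /andP[_] := hM i; apply: le_trans; rewrite mulrC.
      by apply: ler_pM; rewrite ?(ltW (w0 i))// lerDl ?(ltW (sg0 i))// mulr_ge0 ?(ltW d0)// /K; lra.
    - have -> : (w i + sg i) * (`|T i i| + K * d) - `|T i i| * w i =
        sg i * `|T i i| + w i * (K * d) + sg i * (K * d) by ring.
      have Kd : 0 <= K * d by rewrite mulr_ge0 ?(ltW d0)// /K; lra.
      rewrite ger0_norm; last first.
        by rewrite !addr_ge0// mulr_ge0 ?(ltW (sg0 i)) ?(ltW (w0 i)).
      have h1 : sg i * `|T i i| <= d * K0.
        by apply: ler_pM; rewrite ?(ltW (sg0 i)).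
      have h2 : w i * (K * d) <= W * (K * d) by apply: ler_wpM2r.
      have h3 : sg i * (K * d) <= 1 * (K * d).
        by apply: ler_wpM2r => //; exact: le_trans (sgd i) d1.
      rewrite /D; lra.
  have hde : n%:R * M ^+ n * (D * d) <= n%:R * M ^+ n * D * e.
    rewrite -[leRHS]mulrA; apply: ler_wpM2l; last exact: ler_wpM2l.
    by rewrite mulr_ge0// exprn_ge0//; lra.
  move: hd; rewrite ler_norml => /andP[_]; lra.
(* On the tile at [p], the diagonal term stays between 0 and [T j j * sg j], and the off-diagonal
   terms add at most [K0 * d * sg j] in absolute value. The last [d * sg j] in [hi] makes the upper
   inequality strict; the three margins account for [K = 2 * K0 + 1]. *)
pose lo (p : V) : V := \row_j ((p *m T) 0 j + Num.min 0 (T j j * sg j) - K0 * d * sg j).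
pose hi (p : V) : V := \row_j ((p *m T) 0 j + Num.max 0 (T j j * sg j) + K0 * d * sg j + d * sg j).
have volp p : box_vol (lo p, hi p) = \prod_j (sg j * (`|T j j| + K * d)).
  apply: eq_bigr => j _; rewrite !mxE /K.
  have -> : `|T j j| = (Num.max 0 (T j j * sg j) - Num.min 0 (T j j * sg j)) / sg j.
    apply: (mulIf (lt0r_neq0 (sg0 j))); rewrite divfK ?lt0r_neq0//.
    rewrite -[X in _ * X = _](gtr0_norm (sg0 j)) -normrM.
    by case: (lerP 0 (T j j * sg j)) => h; [rewrite ger0_norm|rewrite ltr0_norm]; rewrite //; lra.
  have hmm : Num.min 0 (T j j * sg j) <= Num.max 0 (T j j * sg j).
    by case: (lerP 0 (T j j * sg j)) => h; lra.
  have hp : 0 <= K0 * d * sg j by rewrite !mulr_ge0 ?(ltW d0) ?(ltW (sg0 j)).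
  have hp' : 0 <= d * sg j by rewrite !mulr_ge0 ?(ltW d0) ?(ltW (sg0 j)).
  rewrite max_r; last by lra.
  have sgn0 : sg j != 0 by rewrite lt0r_neq0.
  by field.
have -> : (size ps)%:R * \prod_j (sg j * (`|T j j| + K * d)) =
   \sum_(p <- ps) box_vol (lo p, hi p).
  under [in RHS]eq_bigr do rewrite volp.
  by rewrite big_const_seq count_predT iter_addr_0 mulr_natl.
apply: ub_indicS (ub_bigcup (A := fun p => box (lo p, hi p)) (fun p _ => ub_box _)).
move=> _ [x /bps[p pps xp] <-]; exists p => // j; rewrite [lo p]lock [hi p]lock !mxE -!lock.
rewrite /= ![(\row_j _) _ _]mxE.
pose z i := x 0 i - p 0 i.
have z0 i : 0 <= z i < sg i by have := xp i; rewrite !mxE /z; lra.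
have -> : \sum_i x 0 i * T i j = (p *m T) 0 j + z j * T j j + \sum_(i | i != j) z i * T i j.
  have E : \sum_i z i * T i j = z j * T j j + \sum_(i | i != j) z i * T i j.
    by rewrite (bigD1 j).
  rewrite mxE -addrA -E -big_split/=.
  by apply: eq_bigr => i _; rewrite /z; ring.
have hrest : `|\sum_(i | i != j) z i * T i j| <= K0 * d * sg j.
  apply: le_trans (ler_norm_sum _ _ _) _.
  apply: (@le_trans _ _ (\sum_(i | i != j) `|T i j| * (d * sg j))).
    apply: ler_sum => i ij; rewrite normrM mulrC.
    have [->|Tn] := eqVneq (T i j) 0; first by rewrite normr0 !mul0r.
    apply: ler_wpM2l => //; have /andP[zi0 zi1] := z0 i; rewrite ger0_norm//.
    apply: le_trans (ltW zi1) _; have [ij'|rij] := hT i j Tn; first by rewrite ij' eqxx in ij.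
    by rewrite /sg -exprS ler_wiXn2l// ltW.
  rewrite -mulr_suml -[leRHS]mulrA ler_wpM2r//; first by rewrite mulr_ge0 ?(ltW d0) ?(ltW (sg0 j)).
  apply: (@le_trans _ _ (\sum_i `|T i j|)).
    by rewrite [leRHS](bigD1 j)//= lerDr.
  by apply: ler_sum => i _; rewrite (bigD1 j)//= lerDl sumr_ge0.
move: hrest; rewrite ler_norml => /andP[hr1 hr2].
have dsg : 0 < d * sg j by rewrite mulr_gt0.
have : Num.min 0 (T j j * sg j) <= z j * T j j <= Num.max 0 (T j j * sg j).
  have /andP[zj0 zj1] := z0 j.
  set u := T j j * sg j.
  have [m1 m2] : Num.min 0 u <= 0 /\ Num.min 0 u <= u by rewrite !ge_min !lexx orbT.
  have [m3 m4] : 0 <= Num.max 0 u /\ u <= Num.max 0 u by rewrite !le_max !lexx orbT.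
  rewrite mulrC; apply/andP; case: (lerP 0 (T j j)) => hTj.
    have l1 : 0 <= T j j * z j by rewrite mulr_ge0.
    have l2 : T j j * z j <= u by rewrite ler_wpM2l// ltW.
    by split; [exact: le_trans m1 l1|exact: le_trans l2 m4].
  have l1 : T j j * z j <= 0 by rewrite mulr_le0_ge0// ltW.
  have l2 : u <= T j j * z j by rewrite ler_wnM2l// ltW.
  by split; [exact: le_trans m2 l2|exact: le_trans l1 m3].
by move=> /andP[h1 h2]; apply/andP; split; lra.
Qed.

End linear_images.

Section near_linear.
Context {R : realType} {m : nat}.
Local Notation V := 'rV[R]_m.+1.
Local Notation Box := (V * V)%type.
Implicit Types (b : Box) (x : V) (s t : seq (R * Box)) (F f : V -> R) (A N X S : set V).
Implicit Types (T : 'M[R]_m.+1).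

(** The LUP decomposition reduces the claim to a permutation matrix and two triangular ones. The
    rank required by [linbound_trig] is the index for the lower factor and the reversed index for
    the upper one. *)
Lemma linbound_det T : linbound T `|\det T|.
Proof.
have := cormen_lup_perm T; have := cormen_lup_correct T; have := cormen_lup_detL T.
have := @cormen_lup_lower R m T; have := @cormen_lup_upper R m T.
case: (cormen_lup T) => [[P L] U] /= hU hL detL PT /is_perm_mxP[s Ps].
have ET : T = perm_mx s^-1%g *m (L *m U).
  have : perm_mx s *m T = L *m U by rewrite -Ps.
  by move=> <-; rewrite mulmxA -perm_mxM mulVg perm_mx1 mul1mx.
have bL : linbound L 1.
  have -> : (1 : R) = \prod_i `|L i i| by rewrite big1// => i _; rewrite hL// eqxx normr1.
  apply: (@linbound_trig R m (fun i => val i)) => i j Lij; have [ij|ij] := leqP i j; last by right.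
  by left; apply: contraNeq Lij => /negPf ij0; rewrite hL// ij0.
have bU : linbound U `|\det U|.
  have -> : `|\det U| = \prod_i `|U i i|.
    rewrite -det_tr det_trig ?normr_prod; last first.
      by apply/is_trig_mxP => i j ij; rewrite mxE hU.
    by apply: eq_bigr => i _; rewrite mxE.
  apply: (@linbound_trig R m (fun i => (m - val i)%N)) => i j Uij.
  have [ij|ij|/val_inj ij] := ltngtP i j; last by left.
    by right; rewrite ltn_sub2l// (leq_trans ij)// -ltnS.
  by rewrite hU ?eqxx in Uij.
have -> : `|\det T| = (`|\det U| * 1) * 1.
  by rewrite !mulr1 ET !det_mulmx detL mul1r normrM det_perm normrX normrN1 expr1n mul1r.
rewrite ET; apply: linboundM; [by rewrite mulr1|exact: linbound_perm|].
exact: linboundM.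
Qed.

(** Up to translation and scaling, this contains the image of any cube under a map that is [e]-close
    to [T] in the sense of [ub_nearlin]. *)
Definition fat T (e : R) : set V :=
  [set y | exists2 x, box (0, const_mx 1) x & `|y - x *m T| <= e].

Lemma ub_fatten (bs : seq Box) n : 0 < n -> exists2 e, 0 < e &
  ub (\1_[set y | exists2 x, boxes bs x & `|y - x| <= e])
     (\sum_(b <- bs) box_vol b + n).
Proof.
elim: bs n => [|b bs ih] n n0.
  by exists 1 => //; apply: ub_indicS (ub_le _ ub_set0) => [y [x []]//|]; rewrite big_nil; lra.
have n20 : 0 < n / 2 by lra.
have [e e0 he] := ih _ n20; have [d [d0 hd _]] := enlarge_small b n20.
pose e' := Num.min e (d / 2).
have e'0 : 0 < e' by rewrite lt_min e0/=; lra.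
have e'e : e' <= e by rewrite ge_min lexx.
have e'd : e' <= d / 2 by rewrite ge_min lexx orbT.
exists e' => //; rewrite big_cons.
have := ub_add (ub_le hd (ub_box (enlarge b d))) he.
have -> : box_vol b + n / 2 + (\sum_(b0 <- bs) box_vol b0 + n / 2) =
   box_vol b + \sum_(b0 <- bs) box_vol b0 + n by lra.
apply: ub_mono => y; rewrite !indicE -natrD ler_nat.
set A := mkset _; case: (boolP (y \in A)) => // /set_mem[x + xy].
rewrite boxes_cons => -[bx|bsx].
  rewrite [X in (nat_of_bool X + _)%N]mem_set ?leq_addr// => i.
  have := le_trans (ler_entry_norm (y - x) 0 i) xy; rewrite !mxE ler_norml.
  have := bx i; lra.
rewrite [X in (_ + nat_of_bool X)%N]mem_set ?leq_addl//; exists x => //.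
exact: le_trans xy e'e.
Qed.

Lemma box_vol_cst (p : V) k : 0 <= k -> box_vol (p, p + const_mx k) = k ^+ m.+1.
Proof.
move=> k0; rewrite /box_vol (eq_bigr (fun=> k)) => [|i _].
  by rewrite prodr_const card_ord.
by rewrite !mxE max_r; lra.
Qed.

Lemma ub_fat T n : 0 < n -> exists2 e, 0 < e & ub (\1_(fat T e)) (`|\det T| + n).
Proof.
move=> n0; have n20 : 0 < n / 2 by lra.
have [bs [hbs hv]] := ub_cover (linbound_det T (0, const_mx 1)) n20.
have [e e0 he] := ub_fatten bs n20; exists e => //.
have vol1 : box_vol ((0, const_mx 1) : Box) = 1.
  by rewrite -[const_mx 1]add0r box_vol_cst// expr1n.
move: hv; rewrite vol1 mulr1 => hv.
apply: ub_indicS (ub_le _ he); last lra.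
by move=> y [x bx xy]; exists (x *m T) => //; apply: hbs; exists x.
Qed.

Lemma ub_affine A (c : V) k v : 0 < k -> ub (\1_A) v ->
  ub (\1_((fun z => c + k *: z) @` A)) (k ^+ m.+1 * v).
Proof.
move=> k0 h; apply: (@ub_lim _ _ _ _ (k ^+ m.+1)) => [|e e0].
  by rewrite exprn_ge0// ltW.
have [bs [Abs hv]] := ub_cover h e0.
pose D (b : Box) : Box := (c + k *: b.1, c + k *: b.2).
have volD b : box_vol (D b) = k ^+ m.+1 * box_vol b.
  rewrite /box_vol -[X in k ^+ X]card_ord -prodr_const -big_split/=.
  apply: eq_bigr => i _; rewrite !mxE maxr_pMr ?ltW// mulr0; congr Num.max; ring.
apply: (@ub_le _ _ _ (\sum_(b <- bs) box_vol (D b))).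
  under eq_bigr do rewrite volD.
  by rewrite -mulr_sumr -mulrDr ler_wpM2l// exprn_ge0// ltW.
apply: ub_indicS (ub_bigcup (A := fun b => box (D b)) (fun b _ => ub_box (D b))).
move=> _ [x /Abs[b bb bx] <-]; exists b => // i; rewrite !mxE.
by have /andP[h1 h2] := bx i; rewrite lerD2l ler_pM2l// h1 ltrD2l ltr_pM2l.
Qed.

(* Stated for a source map a and a target map g so as to apply to G (a = id) as
   well as to its local inverse (g = id), with no need to define the latter. *)
Lemma ub_nearlin S (a g : V -> V) T (e v : R) b : 0 <= e -> 0 <= v ->
  ub (\1_(fat T e)) v ->
  (forall p q, S p -> S q ->
     `|g p - g q - (a p - a q) *m T| <= e * `|a p - a q|) ->
  ub (\1_(g @` (S `&` a @^-1` box b))) (v * box_vol b).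
Proof.
move=> e0 v0 hv hS.
have [[x0 bx0]|nb] := pselect (exists x, box b x); last first.
  rewrite (box_empty_vol nb) mulr0; apply: ub_indicS ub_set0 => y [x [_ bx] _].
  by apply: nb; exists (a x).
pose w i := b.2 0 i - b.1 0 i.
have w0 i : 0 < w i by have := bx0 i; rewrite /w; lra.
pose W := \sum_i w i.
have wW i : w i <= W.
  by rewrite /W (bigD1 i)//= lerDl sumr_ge0// => j _; exact: ltW.
have W0 : 0 <= W by rewrite /W sumr_ge0// => i _; exact: ltW.
pose M := W + 1; have M1 : 1 <= M by rewrite /M; lra.
pose n := size (index_enum 'I_m.+1).
apply: (@ub_lim _ _ _ _ (v * (n%:R * M ^+ n))) => [|u u0].
  by rewrite !mulr_ge0// exprn_ge0//; lra.
pose d := Num.min 1 u.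
have d0 : 0 < d by rewrite lt_min ltr01.
have d1 : d <= 1 by rewrite ge_min lexx.
have du : d <= u by rewrite ge_min lexx orbT.
have [ps [bps hps]] := box_tile b (sg := fun=> d) (fun=> d0).
have hvol : (size ps)%:R * d ^+ m.+1 <= box_vol b + n%:R * M ^+ n * u.
  have : (size ps)%:R * d ^+ m.+1 <= \prod_i (w i + d).
    apply: le_trans (le_trans hps _).
      by rewrite prodr_const card_ord.
    rewrite le_eqVlt; apply/orP; left; apply/eqP.
    by apply: eq_bigr => i _; rewrite max_r//; exact: ltW (w0 i).
  move=> /le_trans; apply; rewrite (box_vol_nonempty bx0).
  have : `|\prod_i (w i + d) - \prod_i w i| <= n%:R * M ^+ n * d.
    apply: prod_lipschitz => // i; have := wW i; have := w0 i => ? ?.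
    - by rewrite ger0_norm /M; lra.
    - by rewrite ger0_norm /M; lra.
    - by rewrite addrAC subrr add0r gtr0_norm.
  have : n%:R * M ^+ n * d <= n%:R * M ^+ n * u.
    by apply: ler_wpM2l => //; rewrite mulr_ge0// exprn_ge0//; lra.
  rewrite ler_norml /w; lra.
apply: (@ub_le _ _ _ (\sum_(p <- ps) d ^+ m.+1 * v)).
  rewrite big_const_seq count_predT iter_addr_0 -[_ *+ size ps]mulr_natl mulrA mulrC.
  by apply: le_trans (ler_wpM2l v0 hvol) _; rewrite mulrDr !mulrA.
apply: ub_indicS (ub_bigcup (A := fun p => g @` (S `&` a @^-1` box (p, p + const_mx d))) _).
  move=> _ [x [Sx bx] <-]; have [p pp xp] := bps _ bx; exists p => //; exists x => //.
  by split => //; move: xp; congr (box (_, _ + _) _); apply/rowP => i; rewrite !mxE.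
(* A tile that meets the range of [a] on [S] supplies a base point [q]. Any other point of the tile
   is within [d] of it after applying [a], so scaling the image by [d^-1] puts it into a translate
   of [fat T e]. *)
move=> p _; have [->|/set0P[q [Sq qp]]] := eqVneq (S `&` a @^-1` box (p, p + const_mx d)) set0.
  by rewrite image_set0; apply: ub_le ub_set0; rewrite mulr_ge0// exprn_ge0// ltW.
apply: ub_indicS (ub_affine (g q - (a q - p) *m T) d0 hv) => _ [x [Sx xp] <-].
exists (d^-1 *: (g x - (g q - (a q - p) *m T))); last first.
  by rewrite scalerA divff ?lt0r_neq0// scale1r addrC subrK.
exists (d^-1 *: (a x - p)).
  move=> i; have := xp i; rewrite !mxE => /andP[h1 h2]; apply/andP; split.
    by rewrite mulr_ge0 ?invr_ge0 ?(ltW d0)//; lra.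
  by rewrite mulrC ltr_pdivrMr//; lra.
rewrite -scalemxAl -scalerBr normrZ gtr0_norm ?invr_gt0// mulrC ler_pdivrMr//.
have -> : g x - (g q - (a q - p) *m T) - (a x - p) *m T = g x - g q - (a x - a q) *m T.
  rewrite !mulmxBl; move: (a q *m T) (p *m T) (a x *m T) => y1 y2 y3.
  by apply/rowP => i; rewrite !mxE; ring.
apply: le_trans (hS _ _ Sx Sq) _; apply: ler_wpM2l => //.
apply: mx_norm_le => [|j i]; first exact: ltW.
by rewrite ord1 !mxE; have := xp i; have := qp i; rewrite !mxE ler_norml; lra.
Qed.

(** A Lipschitz map is nearly linear with [T = 0] and error [L]. The ball of radius [L] fits into a
    half-open cube of side [2 * (L + 1)], the 1 making room for the strict inequality. *)
Lemma ub_lipschitz_image S (a g : V -> V) (L : R) b : 0 <= L ->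
  (forall p q, S p -> S q -> `|g p - g q| <= L * `|a p - a q|) ->
  ub (\1_(g @` (S `&` a @^-1` box b))) ((2 * (L + 1)) ^+ m.+1 * box_vol b).
Proof.
move=> L0 h; have h0 : 0 <= 2 * (L + 1) by lra.
apply: (@ub_nearlin S a g 0 L) => //; first by rewrite exprn_ge0.
  rewrite -(box_vol_cst (- const_mx (L + 1)) h0).
  apply: ub_indicS (ub_box _) => y [x _]; rewrite mulmx0 subr0 => yL i.
  have := le_trans (ler_entry_norm y 0 i) yL; rewrite !mxE ler_norml; lra.
by move=> p q Sp Sq; rewrite mulmx0 subr0; exact: h.
Qed.

End near_linear.

(** * Points of strong differentiability *)

(* A module, never imported, keeps the instance local. *)
Module RowComplete.

HB.instance Definition _ (R : realType) (m n : nat) := Complete.on 'M[R]_(m, n).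

Lemma fixed_point (R : realType) (m : nat) (U : set 'rV[R]_m) (phi : 'rV[R]_m -> 'rV[R]_m)
    (q : R) : 0 <= q < 1 -> closed U -> U !=set0 -> (forall x, U x -> U (phi x)) ->
  (forall x y, U x -> U y -> `|phi x - phi y| <= q * `|x - y|) ->
  exists2 p, U p & p = phi p.
Proof.
move=> /andP[q0 q1] Ucl U0 phiU lip.
have ctr : is_contraction (mkfun_fun (phiU : set_fun U U phi)).
  by exists (NngNum q0); split => //= -[x y] [/= Ux Uy]; exact: lip.
by have [p Up pE] := banach_fixed_point ctr Ucl U0; exists p.
Qed.

End RowComplete.

Section local.
Context {R : realType} {m : nat}.
Local Notation V := 'rV[R]_m.+1.
Local Notation Box := (V * V)%type.
Implicit Types (b : Box) (x : V) (s t : seq (R * Box)) (F f : V -> R) (A N X S : set V).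
Implicit Types (T M : 'M[R]_m.+1) (G : V -> V).

Definition mxbound T : R := \sum_i \sum_j `|T i j|.

Lemma mxbound_ge0 T : 0 <= mxbound T.
Proof. by rewrite /mxbound sumr_ge0// => i _; rewrite sumr_ge0. Qed.

Lemma norm_mulmx_le (v : V) T : `|v *m T| <= mxbound T * `|v|.
Proof.
apply: mx_norm_le => [|i j]; first by rewrite mulr_ge0// mxbound_ge0.
rewrite ord1 mxE; apply: le_trans (ler_norm_sum _ _ _) _.
rewrite /mxbound mulr_suml; apply: ler_sum => k _; rewrite normrM mulrC.
apply: ler_pM => //; last exact: ler_entry_norm.
by rewrite (bigD1 j)//= lerDl sumr_ge0.
Qed.

Lemma strong_diffE X G u : strongly_differentiable X G u ->
  [/\ differentiable G u & forall e, 0 < e -> exists2 d, 0 < d &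
    forall x y, `|x - u| < d -> `|y - u| < d ->
      X x /\ `|G x - G y - (x - y) *m 'J G u| <= e * `|x - y|].
Proof.
move=> [Xu [A hA]].
have AE v : A v = v *m lin1_mx A by rewrite mul_rV_lin1.
have Ac : continuous A.
  apply: bounded_linear_continuous; apply/linear_boundedP.
  near=> r => v; rewrite AE; apply: le_trans (norm_mulmx_le _ _) _.
  by apply: ler_wpM2r => //; near: r; apply: nbhs_pinfty_ge; rewrite num_real.
have main e : 0 < e -> exists2 d, 0 < d &
    forall x y, `|x - u| < d -> `|y - u| < d ->
      X x /\ `|G x - G y - A (x - y)| <= e * `|x - y|.
  move=> e0; have /nbhs_ballP[d1 /= d10 hd1] := Xu.
  have : \forall p \near within [set p | [/\ X p.1, X p.2 & p.1 != p.2]] (nbhs (u, u)),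
     `|(`|p.1 - p.2|^-1 *: (G p.1 - G p.2 - A (p.1 - p.2)))| < e.
    exact: (cvgr0_norm_lt _ hA).
  move=> /nbhs_ballP[d2 /= d20 hd2].
  exists (Num.min d1 d2) => [|x y]; first by rewrite lt_min d10.
  rewrite !lt_min => /andP[xd1 xd2] /andP[yd1 yd2].
  have Xx : X x by apply: hd1; rewrite -ball_normE/= distrC.
  have Xy : X y by apply: hd1; rewrite -ball_normE/= distrC.
  split => //; have [->|xy] := eqVneq x y.
    by rewrite !subrr linear0 subr0 !normr0 mulr0.
  have := hd2 (x, y); rewrite /= => /(_ _ _)/ltW; rewrite normrZ normfV normr_id.
  rewrite mulrC ler_pdivrMr ?normr_gt0 ?subr_eq0//; apply => //.
  by split; rewrite -ball_normE/= distrC.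
(* With the second point fixed at [u], the strong estimate is ordinary differentiability; uniqueness
   of the differential then identifies [A] with the Jacobi matrix. *)
have o : (G \o shift u : V -> V) = cst (G u) + (A : V -> V) +o_ (0 : V) id.
  apply/eqaddoP => e e0; have [d d0 hd] := main _ e0.
  apply/nbhs_ballP; exists d => //= h; rewrite -ball_normE/= sub0r normrN => hdlt.
  have [|| _] := hd (h + u) u; rewrite ?addrK ?subrr ?normr0//.
  by rewrite /= !fctE/= opprD addrA.
have dA := diff_unique Ac o.
have JA v : v *m 'J G u = A v by rewrite mul_rV_lin1 dA.
split; first by apply/diff_locallyP; rewrite dA.
by move=> e /main[d d0 hd]; exists d => // x y xd yd; rewrite JA; exact: hd.
Unshelve. all: by end_near. Qed.

(** For a target [y] near [G x], the simplified Newton map [phi] is a contraction of ratio 1/2, and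
    its fixed point is a preimage of [y]. The radius [rho] is chosen so that [phi] moves [x] by at
    most [r / 2], which keeps the ball of radius [r] invariant. *)
Lemma local_surjective G M x r e :
  0 < r -> M \in unitmx -> mxbound (invmx M) * e <= 1 / 2 ->
  (forall y z, `|y - x| <= r -> `|z - x| <= r ->
     `|G y - G z - (y - z) *m M| <= e * `|y - z|) ->
  (G @` [set y | `|y - x| <= r])° (G x).
Proof.
move=> r0 Mu ce hG; set c := mxbound (invmx M) in ce *.
have c0 : 0 <= c by exact: mxbound_ge0.
pose rho := r / (2 * (c + 1)).
have rho0 : 0 < rho by rewrite divr_gt0// mulr_gt0//; lra.
apply/nbhs_ballP; exists rho => //= y; rewrite -ball_normE/= => yx.
pose U : set V := [set z | `|z - x| <= r].
pose phi z := z + (y - G z) *m invmx M.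
have lip z z' : U z -> U z' -> `|phi z - phi z'| <= 1 / 2 * `|z - z'|.
  move=> Uz Uz'.
  have -> : phi z - phi z' = - ((G z - G z' - (z - z') *m M) *m invmx M).
    have E : (z - z') *m M *m invmx M = z - z' by rewrite -mulmxA mulmxV// mulmx1.
    rewrite [in RHS]mulmxBl E /phi !mulmxBl.
    move: (y *m _) (G z *m _) (G z' *m _) => y1 y2 y3.
    by apply/rowP => i; rewrite !mxE; ring.
  rewrite normrN; apply: le_trans (norm_mulmx_le _ _) _.
  apply: le_trans (ler_wpM2l c0 (hG _ _ Uz Uz')) _.
  by rewrite mulrA ler_wpM2r.
have phix : `|phi x - x| <= r / 2.
  rewrite /phi addrAC subrr add0r; apply: le_trans (norm_mulmx_le _ _) _.
  have h : `|y - G x| <= rho by rewrite distrC ltW.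
  apply: le_trans (ler_wpM2l c0 h) _.
  rewrite /rho -/c mulrA ler_pdivrMr; last lra.
  have -> : r / 2 * (2 * (c + 1)) = r * c + r by field.
  lra.
have Ux : U x by rewrite /U/= subrr normr0 ltW.
have phiU : set_fun U U phi.
  move=> z Uz; rewrite /U/=.
  have -> : phi z - x = (phi z - phi x) + (phi x - x) by rewrite subrKA.
  apply: le_trans (ler_normD _ _) _; apply: le_trans (lerD (lip _ _ Uz Ux) phix) _.
  by have : `|z - x| <= r by []; lra.
have Ucl : closed U.
  have -> : U = cbox (x - const_mx r, x + const_mx r).
    apply/seteqP; split => z.
      move=> zr i; have := le_trans (ler_entry_norm (z - x) 0 i) zr.
      by rewrite !mxE ler_norml; lra.
    move=> zr; apply: mx_norm_le => [|j i]; first exact: ltW.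
    by rewrite ord1; have := zr i; rewrite !mxE ler_norml; lra.
  exact: cbox_closed.
have [|p Up pE] := RowComplete.fixed_point (q := 1 / 2) _ Ucl (ex_intro _ x Ux) phiU lip.
  by apply/andP; split; lra.
exists p => //; move: pE; rewrite /= /phi => /eqP.
rewrite -subr_eq0 opprD addrA subrr sub0r oppr_eq0 => /eqP h.
have : (y - G p) *m invmx M *m M = 0 by rewrite h mul0mx.
by rewrite -mulmxA mulVmx// mulmx1 => /eqP; rewrite subr_eq0 => /eqP.
Qed.

End local.

(** * Determinants, oscillation and Riemann integrability *)

Lemma det_lipschitz (R : realType) (n : nat) (M : R) : 1 <= M ->
  exists2 C, 0 <= C & forall (A B : 'M[R]_n) d,
    (forall i j, `|A i j| <= M) -> (forall i j, `|B i j| <= M) ->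
    (forall i j, `|A i j - B i j| <= d) -> `|\det A - \det B| <= C * d.
Proof.
move=> M1; pose K := (size (index_enum 'I_n))%:R * M ^+ size (index_enum 'I_n).
have K0 : 0 <= K by rewrite mulr_ge0// exprn_ge0//; lra.
exists (\sum_(s : 'S_n) K) => [|A B d hA hB hd]; first exact: sumr_ge0.
rewrite /determinant -sumrB mulr_suml; apply: le_trans (ler_norm_sum _ _ _) _.
apply: ler_sum => s _; rewrite -mulrBr normrM normrX normrN1 expr1n mul1r.
exact: prod_lipschitz.
Qed.

Section oscillation.
Context {R : realType} {m : nat}.
Local Notation V := 'rV[R]_m.+1.
Local Notation Box := (V * V)%type.
Implicit Types (b : Box) (x : V) (s t : seq (R * Box)) (F f : V -> R) (A N X S : set V).
Implicit Types (T M : 'M[R]_m.+1) (G : V -> V).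

Definition osc_bad X F (n : R) : set V :=
  [set x | X° x /\ ~ exists b, [/\ obox b x, box b `<=` X &
     forall y z, box b y -> box b z -> `|F y - F z| <= n]].

Lemma exists_boxI_finite (J : finType) (B : J -> Box) x : (forall j, obox (B j) x) ->
  exists b, obox b x /\ forall j, box b `<=` box (B j).
Proof.
move=> h; suff [b [h1 h2]] : exists b, obox b x /\
    forall j, j \in enum J -> box b `<=` box (B j).
  by exists b; split => // j; apply: h2; rewrite mem_enum.
elim: (enum J) => [|j r [b [bx hb]]].
  by exists (cube x 1); split => // i; rewrite !mxE; lra.
exists (boxI (B j) b); split => [i|k].
  have /andP[h1 h2] := h j i; have /andP[h3 h4] := bx i.
  by rewrite !mxE gt_max lt_min h1 h2 h3 h4.
by rewrite inE boxIE => /orP[/eqP->|/hb kb] y [? ?] //; exact: kb.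
Qed.

Lemma mx_integrable_bounded X (h : V -> 'M[R]_m.+1) : mx_riemann_integrable X h ->
  exists2 M, 1 <= M & forall x i j, X x -> `|h x i j| <= M.
Proof.
move=> hh.
have /choice[C hC] : forall ij : 'I_m.+1 * 'I_m.+1,
    exists C, 0 <= C /\ forall x, X x -> `|h x ij.1 ij.2| <= C.
  move=> [i j]; have [_ /boundedP[C hC] _] := hh i j.
  by exists `|C|; split => // x Xx; apply: le_trans (hC x Xx) _; exact: ler_norm.
exists (1 + \sum_ij C ij) => [|x i j Xx].
  by rewrite lerDl sumr_ge0// => ij _; exact: (hC ij).1.
apply: le_trans ((hC (i, j)).2 x Xx) _; rewrite (bigD1 (i, j))//=.
have : 0 <= \sum_(k | k != (i, j)) C k by rewrite sumr_ge0// => k _; exact: (hC k).1.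
lra.
Qed.

(** The determinant is Lipschitz on matrices with bounded entries, so where [|\det h|] oscillates by
    more than [n], some entry of [h] oscillates by more than a fixed fraction of [n]. This leaves
    finitely many sets of content 0. *)
Lemma det_osc_null X (h : V -> 'M[R]_m.+1) n : jordan_measurable X ->
  mx_riemann_integrable X h -> 0 < n ->
  nullc (osc_bad X (fun x => `|\det (h x)|) n).
Proof.
move=> jX hh n0; have [M M1 hM] := mx_integrable_bounded hh.
have [C C0 hC] := det_lipschitz m.+1 M1.
pose d := n / (C + 1).
have d0 : 0 < d by rewrite divr_gt0//; lra.
have Cd : C * d <= n by rewrite /d mulrA ler_pdivrMr; [nra|lra].
pose E (ij : 'I_m.+1 * 'I_m.+1) := osc_bad X (fun x => h x ij.1 ij.2) d.
apply: (nullcS (N' := \bigcup_(ij in [set` index_enum ('I_m.+1 * 'I_m.+1)%type]) E ij)).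
  move=> x [Xx nb]; apply: contrapT => nE; apply: nb.
  have /choice[B hB] : forall ij : 'I_m.+1 * 'I_m.+1, exists b,
      [/\ obox b x, box b `<=` X & forall y z, box b y -> box b z ->
         `|h y ij.1 ij.2 - h z ij.1 ij.2| <= d].
    move=> ij; apply: contrapT => nb; apply: nE.
    by exists ij; [rewrite /= mem_index_enum|split].
  have [b [bx bB]] := @exists_boxI_finite _ B x (fun ij => let: And3 k _ _ := hB ij in k).
  have bX : box b `<=` X.
    by move=> y /(bB (ord0, ord0)) yb; have [_ k _] := hB (ord0, ord0); exact: k.
  exists b; split => // y z yb zb; apply: le_trans (ler_dist_dist _ _) _.
  apply: le_trans (hC _ _ d _ _ _) Cd => i j; rewrite ?hM//; try exact: bX.
  by have [_ _ k] := hB (i, j); exact: (k _ _ (bB (i, j) _ yb) (bB (i, j) _ zb)).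
apply: ub_nullc.
have -> : (0 : R) = \sum_(ij <- index_enum ('I_m.+1 * 'I_m.+1)%type) 0 by rewrite big1.
apply: ub_bigcup => -[i j] _; apply: ub_osc => //; first exact: riemann_integ (hh i j).
Qed.

Lemma boundary_cases X x : closure X x -> (closure X `\` X°) x \/ X° x.
Proof. by move=> cx; have [|] := pselect (X° x); [right|left]. Qed.

(** The sufficiency half of Lebesgue's criterion. It provides the integral of [|\det h|] and the
    integrability of the extended Jacobi matrix. *)
Lemma integ_of_osc X F (M : R) : jordan_measurable X ->
  (forall x, X x -> `|F x| <= M) -> (forall n, 0 < n -> nullc (osc_bad X F n)) ->
  exists w, integ (fun x => F x * \1_X x) w.
Proof.
move=> jX FM0 hN.
have [M1 M10 FM] : exists2 M1, 0 <= M1 & forall x, X x -> `|F x| <= M1.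
  by exists `|M| => // x /FM0/le_trans; apply; exact: ler_norm.
have [bX _] := jX; have /bounded_ubP[W hW] := bX.
have W0 : 0 <= W.
  rewrite -(@stint_nil R m.+1); apply: ub_ge hW => x; rewrite stval_nil.
  by have := indic_le1 X x (R := R); lra.
apply/integ_sandwich => e e0.
(* The two step functions below differ by [2 * n] on cells of total volume at most [W] and by
   [2 * M1] on boxes of total volume at most [n]. The 1 keeps the denominator positive. *)
pose n := e / (2 * W + 2 * M1 + 1).
have n0 : 0 < n by rewrite divr_gt0//; lra.
have ne : n * (2 * W + 2 * M1 + 1) = e by rewrite /n divfK// lt0r_neq0//; lra.
pose P A := A `<=` X /\ forall y z, A y -> A z -> `|F y - F z| <= n.
have [||k [Q [ds [tQ PQ Xcov dsn]]]] := decomp (P := P) (e := n) _ bX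
  (nullcU (ub_nullc (ub_boundary jX)) (hN n n0)) _ n0.
- move=> A B AB [BX hB]; split; first exact: subset_trans BX.
  by move=> y z /AB By /AB Bz; exact: hB.
- move=> x /boundary_cases[bx|ix]; first by left; left.
  have [[b [b1 b2 b3]]|nb] := pselect (exists b, [/\ obox b x, box b `<=` X &
     forall y z, box b y -> box b z -> `|F y - F z| <= n]); last by left; right; split.
  by right; exists b; split => //; split.
have /choice[c hc] : forall i, exists c, forall x, box (Q i) x -> `|F x - c| <= n.
  move=> i; have [[y Qy]|nQ] := pselect (exists y, box (Q i) y); last first.
    by exists 0 => x Qx; exfalso; apply: nQ; exists x.
  by exists (F y) => x Qx; have [_] := PQ i; apply.
pose D (a : R) : seq (R * Box) := [seq (a, d) | d <- ds].
pose st (a : R) : seq (R * Box) := [seq (c i + a, Q i) | i <- enum 'I_k].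
have sD a x : stval (D a) x = a * \sum_(d <- ds) \1_(box d) x.
  by rewrite /stval big_map mulr_sumr.
have iD a : stint (D a) = a * \sum_(d <- ds) box_vol d.
  by rewrite /stint big_map mulr_sumr.
have ist a : stint (st a) = stint (st 0) + a * \sum_i box_vol (Q i).
  have istE a' : stint (st a') = \sum_i (c i + a') * box_vol (Q i).
    by rewrite /stint big_map big_enum.
  rewrite !istE mulr_sumr -big_split/=.
  by apply: eq_bigr => i _; rewrite addr0; ring.
have sstQ a i x : box (Q i) x -> stval (st a) x = c i + a.
  move=> Qx; rewrite /stval big_map big_enum/= (bigD1 i)//= indicE mem_set// mulr1.
  rewrite big1 ?addr0// => j ji; rewrite indicE memNset ?mulr0// => Qj.
  by move/eqP: ji; apply; apply: tQ => //; exists x.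
have sst0 a x : ~ (exists i, box (Q i) x) -> stval (st a) x = 0.
  move=> nQ; rewrite /stval big_map big_enum/= big1// => i _.
  by rewrite indicE memNset ?mulr0// => Qx; apply: nQ; exists i.
have D0 x : 0 <= \sum_(d <- ds) (\1_(box d) x : R).
  by rewrite sumr_ge0// => d _; have := indic_le1 (box d) x (R := R); lra.
have D1 x : X x -> ~ (exists i, box (Q i) x) -> 1 <= \sum_(d <- ds) (\1_(box d) x : R).
  move=> Xx nQ; have [[i _ Qx]|[d /= dds dx]] := Xcov x Xx; first by exfalso; apply: nQ; exists i.
  rewrite (big_rem d)//= [X in X + _]indicE mem_set// lerDl.
  by apply: sumr_ge0 => d1 _; have := indic_le1 (box d1) x (R := R); lra.
exists (st (- n) ++ D (- M1)), (st n ++ D M1); split => [x|x|].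
- rewrite stval_cat sD; have [[i Qx]|nQ] := pselect (exists i, box (Q i) x).
    rewrite (sstQ _ i)// indicE mem_set ?mulr1; last by have [QX _] := PQ i; exact: QX.
    have := hc i x Qx; rewrite ler_norml; have := D0 x; nra.
  rewrite sst0// add0r; have [Xx|nX] := pselect (X x); last first.
    by rewrite indicE memNset// mulr0; have := D0 x; nra.
  rewrite indicE mem_set// mulr1; have := FM x Xx; rewrite ler_norml.
  by have := D1 x Xx nQ; nra.
- rewrite stval_cat sD; have [[i Qx]|nQ] := pselect (exists i, box (Q i) x).
    rewrite (sstQ _ i)// indicE mem_set ?mulr1; last by have [QX _] := PQ i; exact: QX.
    have := hc i x Qx; rewrite ler_norml; have := D0 x; nra.
  rewrite sst0// add0r; have [Xx|nX] := pselect (X x); last first.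
    by rewrite indicE memNset// mulr0; have := D0 x; nra.
  rewrite indicE mem_set// mulr1; have := FM x Xx; rewrite ler_norml.
  by have := D1 x Xx nQ; nra.
rewrite !stint_cat !iD (ist n) (ist (- n)).
have := disjoint_vol_le tQ (fun i => (PQ i).1) hW.
set q := \sum_i _ => qW.
have n2 : n * q <= n * W by rewrite ler_pM2l.
have m2 : M1 * \sum_(d <- ds) box_vol d <= M1 * n by rewrite ler_wpM2l.
have : n * (2 * W + 2 * M1 + 1) = 2 * (n * W) + 2 * (M1 * n) + n by ring.
by rewrite ne; lra.
Qed.

End oscillation.

(** * Transport of upper integrals *)

Section transport.
Context {R : realType} {m : nat}.
Local Notation V := 'rV[R]_m.+1.
Local Notation Box := (V * V)%type.
Implicit Types (b : Box) (x : V) (s t : seq (R * Box)) (F f : V -> R) (A N X S : set V).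

(** Each cell [b] of a step function is replaced by a set [I b] of content at most [al * box_vol b].
    Pushing takes for [I b] the image of a part of [b], pulling takes a part of its preimage; no
    inverse map is ever formed. *)
Lemma ub_transport (al : R) (I : Box -> set V) F A s : 0 <= al ->
  (forall b, ub (\1_(I b)) (al * box_vol b)) -> (forall x, 0 <= stval s x) ->
  (forall y, A y -> exists x, F y <= stval s x /\ forall b, box b x -> I b y) ->
  ub (fun y => F y * \1_A y) (al * stint s).
Proof.
move=> al0 hI s0 hA; have [J [C gC]] := exists_grid [seq p.2 | p <- s].
have sC j : (exists x, box (C j) x) -> 0 <= scell s (C j).
  by move=> [x Cx]; rewrite -(grid_stval gC _ Cx).
(* On an empty cell [scell] may be negative, while [ub_scale] asks for a nonnegative factor. *)
pose c j := if `[<exists x, box (C j) x>] then scell s (C j) else 0.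
have c0 j : 0 <= c j by rewrite /c; case: asboolP => // /sC.
rewrite (grid_stint gC)// mulr_sumr.
have -> : \sum_i al * (scell s (C i) * box_vol (C i)) =
    \sum_i c i * (al * box_vol (C i)).
  apply: eq_bigr => i _; rewrite /c; case: asboolP => [_|nC]; first by ring.
  by rewrite box_empty_vol// !mulr0.
apply: ub_mono (ub_sum _ (fun i _ => ub_scale (c0 i) (hI (C i)))) => y.
have pos i : 0 <= c i * \1_(I (C i)) y.
  by rewrite mulr_ge0//; have := indic_le1 (I (C i)) y (R := R); lra.
have [Ay|nA] := pselect (A y); last by rewrite [\1_A y]indicE memNset// mulr0 sumr_ge0.
rewrite [\1_A y]indicE mem_set// mulr1; have [x [Fs hx]] := hA y Ay.
apply: le_trans Fs _.
have [[j Cx]|nC] := pselect (exists j, box (C j) x); last first.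
  by rewrite (grid_stval0 gC) ?sumr_ge0// => j Cj; apply: nC; exists j.
rewrite (bigD1 j)//= {1}/c (asboolT (ex_intro _ x Cx)) indicE mem_set; last exact: hx.
by rewrite mulr1 (grid_stval gC _ Cx)// lerDl sumr_ge0.
Qed.

Lemma sum_smul_le n (e : 'I_n -> seq (R * Box)) t :
  (forall x, 0 <= stval t x) -> (forall x, \sum_i stval (e i) x <= 1) ->
  \sum_i stint (smul t (e i)) <= stint t.
Proof.
move=> t0 e1.
have -> : \sum_i stint (smul t (e i)) = stint (flatten [seq smul t (e i) | i <- enum 'I_n]).
  by rewrite {2}/stint big_flatten/= big_map big_enum.
apply: le_stint => x; rewrite {1}/stval big_flatten/= big_map big_enum/=.
under eq_bigr => i _ do rewrite -/(stval _ _) stval_mul.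
by rewrite -mulr_sumr ler_piMr.
Qed.

(** A Lipschitz map sends a small countable cover of [K] to a small countable cover of [G(K)]. By
    compactness, finitely many of its open boxes cover a closed box slightly smaller than [b], so
    that this box would have arbitrarily small volume. *)
Lemma box_not_sub_null_image X K (G : V -> V) (L : R) b : 0 <= L ->
  (forall x y, X x -> X y -> `|G x - G y| <= L * `|x - y|) ->
  K `<=` X -> nullc K -> (exists y, obox b y) -> ~ (box b `<=` G @` K).
Proof.
move=> L0 lipG KX nK [y0 by0] bK.
have vb : 0 < box_vol b.
  rewrite (box_vol_nonempty (obox_sub by0)); apply: prodr_gt0 => i _.
  by have := by0 i; lra.
have vb2 : 0 < box_vol b / 2 by lra.
have [d [d0 _ hd]] := enlarge_small b vb2.
pose c := enlarge b (- d); pose C0 := (2 * (L + 1)) ^+ m.+1.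
have C00 : 0 <= C0 by rewrite exprn_ge0//; lra.
suff : box_vol c <= 0 by rewrite /c; lra.
have step e : 0 < e -> box_vol c <= (C0 + 1) * e.
  move=> e0; have [B [KB Be]] := nK e e0.
  have /choice[bs hbs] : forall k, exists bs : seq Box,
      G @` (X `&` box (B k)) `<=` oboxes bs /\
      \sum_(b <- bs) box_vol b <= C0 * box_vol (B k) + e * 2^-1 ^+ k.+1.
    move=> k; apply: ub_ocover; last by rewrite mulr_gt0// exprn_gt0// invr_gt0.
    by apply: (@ub_lipschitz_image R m X id G L).
  have cc : compact (cbox c).
    apply: bounded_closed_compact; last exact: cbox_closed.
    have : cbox c `<=` box b by move=> x /(shrink_cbox d0)/obox_sub.
    move=> cb; apply/bounded_ubP; exists (box_vol b); exact: ub_indicS cb (ub_box b).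
  have [|l [hl cl]] := box_cover (P := fun b' => exists k, b' \in bs k) cc.
    move=> y /(shrink_cbox d0)/obox_sub/bK[x Kx <-].
    have [k _ /obox_sub kx] := KB x Kx.
    have [|b' b'bs b'y] := (hbs k).1 (G x); first by exists x => //; split => //; exact: KX.
    by exists b'; split => //; exists k.
  have [n hn] : exists n, forall b', b' \in l -> exists2 k, (k < n)%N & b' \in bs k.
    elim: l hl {cl} => [|b' l ih] hl; first by exists 0%N.
    have [|n hn] := ih; first by move=> b'' h; apply: hl; rewrite inE h orbT.
    have [k bk] := hl b' (mem_head _ _).
    exists (maxn n k.+1) => b''; rewrite inE => /orP[/eqP->|/hn[j jn bj]].
      by exists k => //; rewrite leq_max leqnn orbT.
    by exists j => //; rewrite leq_max jn.
  have hc : box c `<=` boxes (flatten [seq bs (val k) | k <- enum 'I_n]).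
    move=> y /box_sub_cbox/cl[b' /= /hn[k kn bk] /obox_sub yb']; exists b' => //=.
    by apply/flatten_mapP; exists (Ordinal kn) => //; rewrite mem_enum.
  have := ub_ge (s := [:: (1, c)]) _ (ub_indicS hc (ub_boxes _)).
  rewrite stint1 big_flatten/= big_map big_enum/= => h.
  apply: le_trans (h _) _; first by move=> x; rewrite stval1.
  apply: (@le_trans _ _ (\sum_(k < n) (C0 * box_vol (B k) + e * 2^-1 ^+ k.+1))).
    by apply: ler_sum => k _; exact: (hbs k).2.
  rewrite big_split/= -mulr_sumr mulrDl mul1r; apply: lerD.
    by apply: ler_wpM2l => //; exact: Be.
  exact: sum_geometric_half (ltW e0).
apply/ler_addgt0Pr => e e0; rewrite add0r.
have e'0 : 0 < e / (C0 + 1) by rewrite divr_gt0//; lra.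
by have := step _ e'0; rewrite mulrC divfK// lt0r_neq0//; lra.
Qed.

End transport.

(** * Boxes on which the map is nearly affine *)

Section change_of_variables.
Context {R : realType} {m : nat}.
Local Notation V := 'rV[R]_m.+1.
Local Notation Box := (V * V)%type.
Implicit Types (b : Box) (x : V) (s t : seq (R * Box)) (F f : V -> R) (A B N S : set V).

Variables (X : set V) (G : V -> V) (h : V -> 'M[R]_m.+1).
Hypothesis jX : jordan_measurable X.
Hypothesis nstrong : nullc (X° `\` [set x | strongly_differentiable X G x]).
Hypothesis hint : mx_riemann_integrable X h.
Hypothesis nJ : nullc (X° `\` [set x | differentiable G x /\ h x = jacobi_mx G x]).

(* a stands for |det (J_G u)| at a nearby point u; the last but one clause bounds the
   volume of preimages and makes G open on A. *)
Definition good (n : R) A := A `<=` X /\ exists a, [/\ 0 <= a,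
  forall b, box b `<=` A -> ub (\1_(G @` box b)) ((a + n) * box_vol b),
  a = 0 \/ ((forall b, ub (\1_(A `&` G @^-1` box b)) (a^-1 * (1 + n) * box_vol b)) /\
            (forall B, B `<=` A -> forall x, B° x -> (G @` B)° (G x))) &
  forall x, A x -> `| `|\det (h x)| - a| <= n].

Lemma goodS n A B : A `<=` B -> good n B -> good n A.
Proof.
move=> AB [BX [a [a0 h1 h2 h3]]]; split; first exact: subset_trans BX.
exists a; split => // [b bA||x /AB]; last exact: h3.
  by apply: h1; exact: subset_trans AB.
case: h2 => [->|[h2 h4]]; [by left|right; split => [b|C CA]].
  by apply: ub_indicS (h2 b) => x [/AB Bx bx].
by apply: h4; exact: subset_trans AB.
Qed.

Lemma good_at n u : 0 < n -> X° u -> strongly_differentiable X G u ->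
  h u = jacobi_mx G u -> ~ osc_bad X (fun x => `|\det (h x)|) n u ->
  exists b, good n (box b) /\ obox b u.
Proof.
move=> n0 Xu su hu nosc.
have [b0 [b0u b0X b0osc]] : exists b, [/\ obox b u, box b `<=` X &
    forall y z, box b y -> box b z -> `| `|\det (h y)| - `|\det (h z)| | <= n].
  by apply: contrapT => nb; apply: nosc; split.
have [dG hG] := strong_diffE su; set M := 'J G u in hG *; pose a := `|\det M|.
have hua : `|\det (h u)| = a by rewrite hu /jacobi_mx det_tr.
have [e1 e10 he1] := ub_fat M n0.
(* If [a] is not 0, [e] must serve three ends: the volume bound for images ([e1]), the ratio 1/2 in
   [local_surjective], and the volume bound for preimages, where inverting [G] is compared with
   [invmx M] up to an error [e2]. *)
have [e [e0 ee1 he]] : exists e, [/\ 0 < e, e <= e1 &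
    a = 0 \/ [/\ M \in unitmx, mxbound (invmx M) * e <= 1 / 2 &
      exists2 e2, 2 * mxbound (invmx M) * mxbound (invmx M) * e <= e2 &
        0 <= e2 /\ ub (\1_(fat (invmx M) e2)) (a^-1 * (1 + n))]].
  have [aE|aN] := eqVneq a 0; first by exists e1; split => //; left.
  have Mu : M \in unitmx by rewrite unitmxE unitfE -normr_eq0.
  set c := mxbound (invmx M); have c0 : 0 <= c := mxbound_ge0 _.
  have a0 : 0 < a by rewrite lt_neqAle eq_sym aN normr_ge0.
  have an0 : 0 < a^-1 * n by rewrite mulr_gt0// invr_gt0.
  have [e2 e20 he2] := ub_fat (invmx M) an0.
  pose f1 := 1 / (2 * (c + 1)); pose f2 := e2 / (2 * (c + 1) * (c + 1)).
  have f10 : 0 < f1 by rewrite divr_gt0// mulr_gt0//; lra.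
  have f20 : 0 < f2 by rewrite divr_gt0// !mulr_gt0//; lra.
  exists (Num.min e1 (Num.min f1 f2)); set e := Num.min _ _.
  have e0 : 0 < e by rewrite !lt_min e10 f10.
  have ef1 : e <= f1 by rewrite !ge_min lexx orbT.
  have ef2 : e <= f2 by rewrite !ge_min lexx !orbT.
  split => //; first by rewrite ge_min lexx.
  right; split => //.
    move: ef1; rewrite /f1 ler_pdivlMr; last by lra.
    by move=> ?; nra.
  exists e2; last split; rewrite ?(ltW e20)//.
    move: ef2; rewrite /f2 ler_pdivlMr; last by rewrite !mulr_gt0//; lra.
    move=> ef2; apply: le_trans ef2.
    have -> : 2 * c * c * e = e * (2 * c * c) by ring.
    by apply: ler_wpM2l; [exact: ltW|nra].
  by move: he2; rewrite det_inv normfV mulrDr mulr1.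
have [d d0 hd] := hG e e0.
have d20 : 0 < d / 2 by lra.
pose b := boxI b0 (cube u (d / 2)).
have bd x : box b x -> `|x - u| < d.
  rewrite boxIE => -[_ /cubeE xu]; apply: (@le_lt_trans _ _ (d / 2)); last lra.
  apply: mx_norm_le => [|i j]; first exact: ltW.
  by rewrite ord1 !mxE ler_norml; have := xu j; lra.
have bh x y : box b x -> box b y -> `|G x - G y - (x - y) *m M| <= e * `|x - y|.
  by move=> /bd xd /bd yd; have [] := hd x y xd yd.
have bX : box b `<=` X by rewrite boxIE => x [/b0X].
exists b; split; last first.
  by move=> i; have := b0u i; rewrite !mxE gt_max lt_min => /andP[-> ->] /=; lra.
split => //; exists a; split => //.
- exact: normr_ge0.
- move=> c cb.
  have h' x y : box c x -> box c y -> `|G x - G y - (x - y) *m M| <= e1 * `|x - y|.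
    by move=> /cb bx /cb by_; apply: le_trans (bh _ _ bx by_) _; rewrite ler_wpM2r.
  apply: ub_indicS (ub_nearlin (a := id) c (ltW e10) _ he1 h').
    by move=> _ [x cx <-]; exists x.
  by rewrite addr_ge0// ltW.
- case: he => [->|[Mu ce [e2 ce2 [e20 he2]]]]; [by left|right; split => [c|B Bb x Bx]].
    have c0 := mxbound_ge0 (invmx M); set k := mxbound (invmx M) in ce ce2 c0.
    have h' x y : box b x -> box b y ->
        `|x - y - (G x - G y) *m invmx M| <= e2 * `|G x - G y|.
      move=> bx by_; set w := G x - G y - (x - y) *m M.
      have E : x - y - (G x - G y) *m invmx M = - (w *m invmx M).
        rewrite /w [in RHS]mulmxBl -[(x - y) *m M *m _]mulmxA mulmxV// mulmx1.
        by rewrite opprB.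
      have wk : `|w *m invmx M| <= k * (e * `|x - y|).
        by apply: le_trans (norm_mulmx_le _ _) _; apply: ler_wpM2l => //; exact: bh.
      (* The error term is at most half of [|x - y|] and is absorbed. The error [k * e * |x - y|]
         thereby becomes [2 * k * k * e * |G x - G y|], the origin of the condition on [e2]. *)
      have xy : `|x - y| <= 2 * k * `|G x - G y|.
        have k1 : `|x - y| <= `|(G x - G y) *m invmx M| + `|w *m invmx M|.
          have -> : x - y = (G x - G y) *m invmx M + - (w *m invmx M).
            by rewrite -E addrCA subrr addr0.
          by apply: le_trans (ler_normD _ _) _; rewrite normrN.
        have k2 := norm_mulmx_le (G x - G y) (invmx M).
        have k3 : k * (e * `|x - y|) <= 1 / 2 * `|x - y|.
          by rewrite mulrA ler_wpM2r.
        rewrite -/k in k2; lra.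
      rewrite E normrN; apply: le_trans wk _.
      have : k * e * `|x - y| <= k * e * (2 * k * `|G x - G y|).
        by apply: ler_wpM2l => //; rewrite mulr_ge0// ltW.
      have : 2 * k * k * e * `|G x - G y| <= e2 * `|G x - G y| by rewrite ler_wpM2r.
      lra.
    have v0 : 0 <= a^-1 * (1 + n) by rewrite mulr_ge0 ?invr_ge0 ?normr_ge0//; lra.
    apply: ub_indicS (ub_nearlin (a := G) (g := id) c e20 v0 he2 h').
    by move=> x [bx cx]; exists x.
  have /nbhs_ballP[r /= r0 hr] := Bx.
  have r20 : 0 < r / 2 by lra.
  have cB : [set y | `|y - x| <= r / 2] `<=` B.
    by move=> y xy; apply: hr; rewrite -ball_normE/= distrC; apply: le_lt_trans xy _; lra.
  have := @local_surjective R m G M x (r / 2) e r20 Mu ce.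
  have hB y z : `|y - x| <= r / 2 -> `|z - x| <= r / 2 ->
      `|G y - G z - (y - z) *m M| <= e * `|y - z|.
    by move=> /cB/Bb by_ /cB/Bb bz; exact: bh.
  move=> /(_ hB); apply: interiorS; exact: image_subset.
- move=> x; rewrite boxIE => -[b0x _]; rewrite -hua.
  by apply: b0osc => //; exact: obox_sub.
Qed.

Lemma decomp_good n e : 0 < n -> 0 < e ->
  exists k (Q : 'I_k -> Box) (ds : seq Box),
   [/\ trivIset setT (fun i => box (Q i)), forall i, good n (box (Q i)),
       X `<=` (\bigcup_i box (Q i)) `|` boxes ds &
       \sum_(d <- ds) box_vol d <= e].
Proof.
move=> n0 e0; have [bX _] := jX.
apply: (decomp _ bX (nullcU (nullcU nstrong nJ) (nullcU (ub_nullc (ub_boundary jX))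
  (det_osc_null jX hint n0))) _ e0); first exact: goodS.
move=> x /boundary_cases[bx|ix]; first by left; right; left.
have [bad|nbad] := pselect (osc_bad X (fun x => `|\det (h x)|) n x).
  by left; right; right.
have [su|nsu] := pselect (strongly_differentiable X G x); last by left; left; left.
have [hJ|nhJ] := pselect (differentiable G x /\ h x = jacobi_mx G x).
  by right; apply: good_at => //; case: hJ.
by left; left; right.
Qed.

End change_of_variables.

(** * Comparison of upper integrals in both directions *)

Section push_pull.
Context {R : realType} {m : nat}.
Local Notation V := 'rV[R]_m.+1.
Local Notation Box := (V * V)%type.
Implicit Types (b : Box) (x : V) (s t : seq (R * Box)) (F f : V -> R) (A B N S : set V).

Variables (X K : set V) (G : V -> V) (h : V -> 'M[R]_m.+1).
Hypotheses (jX : jordan_measurable X) (KX : K `<=` X) (nK : nullc K).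
Hypothesis nstrong : nullc (X° `\` [set x | strongly_differentiable X G x]).
Hypothesis injG : forall x y, X x -> ~ K x -> X y -> ~ K y -> G x = G y -> x = y.
Hypothesis hint : mx_riemann_integrable X h.
Hypothesis nJ : nullc (X° `\` [set x | differentiable G x /\ h x = jacobi_mx G x]).

Let psi f x := f (G x) * `|\det (h x)|.
Let lip (L : R) := forall x y, X x -> X y -> `|G x - G y| <= L * `|x - y|.

Lemma ub_image_boxes (L : R) (ds : seq Box) : 0 <= L -> lip L ->
  ub (\1_(G @` (X `&` boxes ds))) ((2 * (L + 1)) ^+ m.+1 * \sum_(d <- ds) box_vol d).
Proof.
move=> L0 lipG.
rewrite mulr_sumr.
apply: ub_indicS (ub_bigcup (A := fun d => G @` (X `&` id @^-1` box d))
   (fun d _ => ub_lipschitz_image (a := id) d L0 lipG)).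
by move=> _ [x [Xx [d dds dx]] <-]; exists d => //; exists x.
Qed.

Lemma boxI_vol_le b c : box_vol (boxI b c) <= box_vol b.
Proof. by rewrite -[leLHS]outer_box outer_box_le// boxIE => x []. Qed.

(** Images of different cells may overlap; as [f] is nonnegative on [G(X)], overlaps only enlarge
    the dominating sum. Points covered by [ds] cost at most [M] times the content of their image,
    which the Lipschitz constant controls. *)
Lemma ub_push (L W : R) f M v : 0 <= L -> lip L -> 0 <= W -> ub (\1_X) W -> 0 <= M -> (forall x, X x -> 0 <= f (G x) <= M) ->
  ub (fun x => psi f x * \1_X x) v -> ub (fun y => f y * \1_(G @` X) y) v.
Proof.
move=> L0 lipG W0 hW M0 fM hv; pose C0 := (2 * (L + 1)) ^+ m.+1; have C00 : 0 <= C0 by rewrite exprn_ge0//; lra.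
apply: (@ub_lim _ _ _ _ (1 + 2 * M * W + M * C0)) => [|e e0].
  by rewrite !addr_ge0// ?mulr_ge0.
have [t [ht tv]] := hv e e0.
have t0 x : 0 <= stval t x.
  apply: le_trans (ht x); have [Xx|nX] := pselect (X x).
    by rewrite indicE mem_set// mulr1 mulr_ge0//; have := fM x Xx; lra.
  by rewrite indicE memNset// mulr0.
have [k [Q [ds [tQ gQ Xcov dse]]]] := decomp_good jX nstrong hint nJ e0 e0.
have QX i : box (Q i) `<=` X by have [] := gQ i.
have hi i : ub (fun y => f y * \1_(G @` box (Q i)) y)
    (stint (smul t [:: (1, Q i)]) + 2 * M * e * box_vol (Q i)).
  have [_ [a [a0 g1 _ g3]]] := gQ i.
  have ae0 : 0 < a + e by lra.
  (* The added [2 * M * e] gives [(a + e) * f (G x) <= stval s x], as [|\det (h x)|] is within [e]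
     of [a]. Working with [a + e] instead of [a] permits the later division even when [a = 0]. *)
  pose s := smul t [:: (1, Q i)] ++ [:: (2 * M * e, Q i)].
  have sE x : stval s x = stval t x * \1_(box (Q i)) x + 2 * M * e * \1_(box (Q i)) x.
    by rewrite stval_cat stval_mul stval1 stval_cons stval_nil addr0.
  have -> : stint (smul t [:: (1, Q i)]) + 2 * M * e * box_vol (Q i) = stint s.
    by rewrite stint_cat stint_cons stint_nil addr0.
  have Me0 : 0 <= 2 * M * e by rewrite !mulr_ge0// ltW.
  have s0 x : 0 <= stval s x.
    by rewrite sE addr_ge0// mulr_ge0//; have := indic_le1 (box (Q i)) x (R := R); lra.
  have hI b : ub (\1_(G @` (box b `&` box (Q i)))) ((a + e) * box_vol b).
    rewrite -boxIE; apply: ub_le (g1 _ _); last by rewrite boxIE => x [].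
    by rewrite ler_wpM2l ?(ltW ae0)// boxI_vol_le.
  have := @ub_transport R m (a + e) _ (fun y => (a + e) * f y) (G @` box (Q i)) s (ltW ae0) hI s0.
  have inv0 : 0 <= (a + e)^-1 by rewrite invr_ge0 ltW.
  move=> ht'; have {ht'} := ub_scale inv0 (ht' _); rewrite mulrA mulVf ?mul1r ?lt0r_neq0//.
  move=> ht'; apply: ub_mono (ht' _) => y.
    by rewrite !mulrA mulVf ?mul1r ?lt0r_neq0.
  move=> [x Qx <-]; exists x; split; last by move=> b bx; exists x.
  rewrite sE indicE mem_set// !mulr1; have Xx := QX i x Qx.
  have := ht x; rewrite indicE mem_set// mulr1 /psi => tx.
  have := g3 x Qx; rewrite ler_norml => /andP[k1 k2]; have /andP[f0 fm] := fM x Xx.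
  have k3 : f (G x) * a <= f (G x) * (`|\det (h x)| + e) by rewrite ler_wpM2l//; lra.
  have k4 : f (G x) * e <= M * e by rewrite ler_wpM2r// ltW.
  lra.
have himg := ub_scale M0 (ub_image_boxes ds L0 lipG).
apply: (@ub_le _ _ _ (\sum_i (stint (smul t [:: (1, Q i)]) + 2 * M * e * box_vol (Q i)) +
    M * (C0 * \sum_(d <- ds) box_vol d))).
  rewrite big_split/= -mulr_sumr.
  have q1 : \sum_i stint (smul t [:: (1, Q i)]) <= stint t.
    apply: (@sum_smul_le R m k (fun i => [:: (1, Q i)]) t) => // x.
    under eq_bigr do rewrite stval1.
    have := @sum_indic_le R m.+1 _ (fun i => box (Q i)) setT x tQ (@subsetT _ _).
    by rewrite indicT.
  have q2 : 2 * M * e * \sum_i box_vol (Q i) <= 2 * M * e * W.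
    apply: ler_wpM2l; first by rewrite !mulr_ge0// ltW.
    exact: disjoint_vol_le hW.
  have q3 : M * (C0 * \sum_(d <- ds) box_vol d) <= M * (C0 * e).
    by apply: ler_wpM2l => //; apply: ler_wpM2l.
  lra.
apply: ub_mono (ub_add (ub_sum _ (fun i _ => hi i)) himg) => y /=.
have [[x Xx <-]|nGX] := pselect ((G @` X) y); last first.
  rewrite [\1_(G @` X) y]indicE memNset// mulr0 addr_ge0//.
    apply: sumr_ge0 => i _; rewrite indicE memNset ?mulr0// => -[x Qx xy].
    by apply: nGX; exists x => //; exact: QX Qx.
  by rewrite mulr_ge0//; have := indic_le1 (G @` (X `&` boxes ds)) y (R := R); lra.
have /andP[f0 fm] := fM x Xx.
have S0 (P : pred 'I_k) : 0 <= \sum_(i | P i) f (G x) * \1_(G @` box (Q i)) (G x).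
  by apply: sumr_ge0 => i _; rewrite mulr_ge0//;
     have := indic_le1 (G @` box (Q i)) (G x) (R := R); lra.
rewrite [\1_(G @` X) _]indicE mem_set ?mulr1; last by exists x.
have [[i _ Qx]|dx] := Xcov x Xx.
  have M10 : 0 <= M * \1_(G @` (X `&` boxes ds)) (G x).
    by rewrite mulr_ge0//; have := indic_le1 (G @` (X `&` boxes ds)) (G x) (R := R); lra.
  rewrite (bigD1 i)//= [\1_(G @` box (Q i)) _]indicE mem_set ?mulr1; last by exists x.
  by have := S0 (fun j => j != i); lra.
rewrite [\1_(G @` (X `&` _)) _]indicE mem_set ?mulr1; last by exists x.
by have := S0 xpredT; lra.
Qed.

(** The boxes [cs] come before [f] and [t], so that one packing serves [f = 1] and every other [f].
    In the bound, [1 + n] comes from the volume of preimages, [M * n] from replacing [|\det h|] by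
    [a], and [M * D * d] from the rim that shrinking [Q] leaves out. *)
Lemma good_cell (L D : R) n d Q : 0 <= L -> lip L ->
  0 <= D -> (forall x, X x -> `|\det (h x)| <= D) -> 0 < n -> 0 < d -> good X G h n (box Q) ->
  exists cs : seq Box, (forall c, c \in cs -> box c `<=` G @` box Q) /\
  forall e f M t, (forall y, stval e y = \1_(boxes cs) y) -> 0 <= M ->
    (forall x, X x -> 0 <= f (G x) <= M) -> (forall y, 0 <= stval t y) ->
    (forall y, boxes cs y -> f y <= stval t y) ->
    ub (fun x => psi f x * \1_(box Q) x)
       ((1 + n) * stint (smul t e) + M * n * box_vol Q + M * D * d).
Proof.
move=> L0 lipG D0 hD n0 d0 [QX [a [a0 g1 g2 g3]]].
have Mnb M : 0 <= M -> ub (fun x => M * n * \1_(box Q) x) (M * n * box_vol Q).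
  by move=> M0; apply: ub_scale (ub_box Q); rewrite mulr_ge0// ltW.
have te0 t e (cs : seq Box) : (forall y, stval e y = \1_(boxes cs) y) -> (forall y, 0 <= stval t y) ->
    0 <= (1 + n) * stint (smul t e).
  move=> he t0; rewrite mulr_ge0//; first lra.
  apply: stint_ge0 => x; by rewrite stval_mul he mulr_ge0.
(* If [a = 0], the map need not be open and nothing is packed; [psi f] is at most [M * n] on the
   cell. *)
have [aE|aN] := eqVneq a 0.
  exists [::]; split => // e f M t he M0 fM t0 ft.
  apply: (@ub_le _ _ _ (M * n * box_vol Q)).
    have : 0 <= M * D * d by rewrite !mulr_ge0// ltW.
    by have := te0 t e [::] he t0; lra.
  apply: ub_mono (Mnb M M0) => x; have [Qx|nQ] := pselect (box Q x); last first.
    by rewrite indicE memNset// !mulr0.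
  rewrite indicE mem_set// !mulr1 /psi; apply: ler_pM => //.
  - by have := fM x (QX _ Qx); lra.
  - by have := fM x (QX _ Qx); lra.
  - by have := g3 x Qx; rewrite aE subr0 normr_id.
case: g2 => [aE|[g2 g4]]; first by rewrite aE eqxx in aN.
have a1 : 0 < a by rewrite lt_neqAle eq_sym aN.
have [dd [dd0 _ hdd]] := enlarge_small Q d0.
pose Q' := enlarge Q (- dd).
have Q'Q x : cbox Q' x -> obox Q x by exact: shrink_cbox.
have Q'c : compact (cbox Q').
  apply: bounded_closed_compact; last exact: cbox_closed.
  by apply/bounded_ubP; exists (box_vol Q); apply: ub_indicS (ub_box Q) => x /Q'Q/obox_sub.
have [|bs [hbs Q'bs]] := box_cover (P := fun b => exists c,
    box c `<=` G @` box Q /\ forall x, box b x -> X x -> box c (G x)) Q'c.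
  move=> x /Q'Q Qx.
  have Qi : (box Q)° x by exact: obox_interior Qx.
  have /nbhs_ballP[r /= r0 hr] := g4 _ (@subset_refl _ _) x Qi.
  have rr : 0 < r / 2 / (L + 1) by rewrite !divr_gt0//; lra.
  (* By the Lipschitz bound, the points of [X] in this cube are mapped into the cube of half-side
     [r / 2] about [G x], which lies in the image of [box Q]. *)
  exists (cube x (r / 2 / (L + 1))); split; last by move=> i; rewrite !mxE; lra.
  exists (cube (G x) (r / 2)); split.
    move=> y /cubeE hy; apply: hr; rewrite -ball_normE/=.
    apply: (@le_lt_trans _ _ (r / 2)); last lra.
    apply: mx_norm_le => [|j i]; first lra.
    by rewrite ord1 !mxE ler_norml; have := hy i; lra.
  move=> y /cubeE hy Xy; apply/cubeE => i.
  have : `|(G y - G x) 0 i| < r / 2.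
    apply: le_lt_trans (ler_entry_norm (G y - G x) 0 i) _.
    have Xx : X x by apply: QX; exact: obox_sub.
    apply: le_lt_trans (lipG _ _ Xy Xx) _.
    have hyx : `|y - x| <= r / 2 / (L + 1).
      apply: mx_norm_le => [|j l]; first exact: ltW.
      by rewrite ord1 !mxE ler_norml; have := hy l; lra.
    apply: le_lt_trans (ler_wpM2l L0 hyx) _.
    have r20 : 0 < r / 2 by lra.
    by rewrite mulrA ltr_pdivrMr; [nra|lra].
  by rewrite !mxE ltr_norml; lra.
have /choice[c hc] : forall b, exists c, b \in bs ->
    box c `<=` G @` box Q /\ forall x, box b x -> X x -> box c (G x).
  move=> b; have [bb|nbb] := boolP (b \in bs); last by exists b.
  by have [c hc] := hbs b bb; exists c.
exists [seq c b | b <- bs]; split => [_ /mapP[b bb ->]|]; first exact: (hc b bb).1.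
move=> e f M t he M0 fM t0 ft; pose cs := [seq c b | b <- bs]; rewrite -/cs in he ft.
have GQ' x : box Q' x -> boxes cs (G x).
  move=> /box_sub_cbox Q'x; have [b /= bb /obox_sub bx] := Q'bs _ Q'x.
  exists (c b); first exact: map_f.
  by apply: (hc b bb).2 => //; apply: QX; apply: obox_sub; exact: Q'Q.
have te x : (0 : R) <= stval (smul t e) x.
  by rewrite stval_mul he mulr_ge0.
(* Only points of [Q'] are treated here, since their images are known to lie in [boxes cs], where
   [t] dominates [f]. The factor [a^-1] disappears below when this bound is scaled by [a]. *)
have u1 : ub (fun x => f (G x) * \1_(box Q') x) (a^-1 * (1 + n) * stint (smul t e)).
  apply: (ub_transport (I := fun b => box Q `&` G @^-1` box b)) => //.
    by rewrite mulr_ge0 ?invr_ge0//; lra.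
  move=> x Q'x; exists (G x); split => [|b bx].
    by rewrite stval_mul he indicE mem_set ?mulr1; [exact/ft/GQ'|exact: GQ'].
  by split => //; apply: obox_sub; apply: Q'Q; exact: box_sub_cbox.
have u2 : ub (\1_(box Q `\` box Q')) d.
  have h2 := (integ_step [:: (1, Q')]).2; rewrite stint1 in h2.
  apply: ub_le (ub_mono _ (ub_add (ub_box Q) h2)); first by rewrite /Q'; lra.
  move=> x; rewrite stval1 !indicE in_setD.
  have : x \in box Q' -> x \in box Q.
    by move=> /set_mem/box_sub_cbox/Q'Q/obox_sub/mem_set.
  by case: (x \in box Q'); case: (x \in box Q) => //= k;
    first [by rewrite subrr lexx | lra | by have := k isT].
have MD0 : 0 <= M * D by rewrite mulr_ge0.
have := ub_add (ub_add (ub_scale a0 u1) (Mnb M M0)) (ub_scale MD0 u2).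
rewrite !mulrA mulfV// mul1r; apply: ub_mono => x.
have [Qx|nQ] := pselect (box Q x); last first.
  rewrite [\1_(box Q) x]indicE memNset// !mulr0 addr0 addr_ge0//.
    rewrite indicE memNset ?mulr0// => /box_sub_cbox/Q'Q/obox_sub; exact: nQ.
  by rewrite mulr_ge0//; have := indic_le1 (box Q `\` box Q') x (R := R); lra.
have Xx := QX _ Qx; have /andP[f0 fm] := fM x Xx.
rewrite [\1_(box Q) x]indicE mem_set// !mulr1 /psi.
have [Q'x|nQ'] := pselect (box Q' x).
  rewrite [\1_(box Q') x]indicE mem_set// [\1_(box Q `\` box Q') x]indicE memNset; last by case.
  rewrite mulr0 addr0 mulr1; have := g3 x Qx; rewrite ler_norml => /andP[k1 k2].
  have k3 : f (G x) * `|\det (h x)| <= f (G x) * (a + n) by rewrite ler_wpM2l//; lra.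
  have k4 : f (G x) * n <= M * n by rewrite ler_wpM2r// ltW.
  lra.
rewrite [\1_(box Q') x]indicE memNset// [\1_(box Q `\` box Q') x]indicE mem_set//.
rewrite !mulr0 add0r mulr1.
have k1 : f (G x) * `|\det (h x)| <= M * D by apply: ler_pM => //; exact: hD.
have : 0 <= M * n by rewrite mulr_ge0// ltW.
lra.
Qed.

(** The [e i] are indicators of the sets packed into the images of the cells. Injectivity off [K]
    makes these sets disjoint, whence the bound on their sum; with [sum_smul_le] it ensures that the
    pieces of [t] do not add up to more than [t]. *)
Lemma ub_pull (L W D : R) n : 0 <= L -> lip L -> 0 <= W -> ub (\1_X) W ->
  0 <= D -> (forall x, X x -> `|\det (h x)| <= D) -> 0 < n -> exists k (e : 'I_k -> seq (R * Box)),
  [/\ forall i y, stval (e i) y = 0 \/ stval (e i) y = 1,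
      forall y, \sum_i stval (e i) y <= \1_(G @` X) y &
      forall f M t, 0 <= M -> (forall x, X x -> 0 <= f (G x) <= M) ->
        (forall y, 0 <= stval t y) ->
        (forall i y, stval (e i) y = 1 -> f y <= stval t y) ->
        ub (fun x => psi f x * \1_X x)
           ((1 + n) * (\sum_i stint (smul t (e i))) + M * (W + 2 * D) * n)].
Proof.
move=> L0 lipG W0 hW D0 hD n0; have [k [Q [ds [tQ gQ Xcov dsn]]]] := decomp_good jX nstrong hint nJ n0 n0.
(* The tolerance for the rim of one cell: all [k] rims together cost at most [M * D * n]. *)
have nk0 : 0 < n / k.+1%:R by rewrite divr_gt0.
have /choice[cs hcs] := fun i => good_cell L0 lipG D0 hD n0 nk0 (gQ i).
have /choice[e he] := fun i => union_step (cs i).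
have QX i : box (Q i) `<=` X by have [] := gQ i.
have csG i : boxes (cs i) `<=` G @` box (Q i).
  by move=> y [c /= cc cy]; exact: ((hcs i).1 c cc).
have tcs : trivIset setT (fun i => boxes (cs i)).
  apply/trivIsetP => i j _ _ ij; apply/seteqP; split => // y [[b /= bi yb] [c /= cj yc]].
  have [y' y'o] : exists y', obox (boxI b c) y'.
    by apply: (@box_meet_obox _ _ _ y); rewrite boxIE.
  apply: (box_not_sub_null_image L0 lipG KX nK (ex_intro _ y' y'o)).
  rewrite boxIE => z [bz cz].
  have [x Qx xz] := (hcs i).1 b bi z bz; have [x' Qx' xz'] := (hcs j).1 c cj z cz.
  have [Kx|nKx] := pselect (K x); first by exists x.
  have [Kx'|nKx'] := pselect (K x'); first by exists x'.
  have xx' : x = x' by apply: injG => //; [exact: QX Qx|exact: QX Qx'|rewrite xz xz'].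
  move/eqP: ij => []; apply: tQ => //; exists x; split => //; by rewrite xx'.
exists k, e; split => [i y|y|f M t M0 fM t0 ft].
- by rewrite he indicE; case: (_ \in _); [right|left].
- under eq_bigr do rewrite he.
  apply: sum_indic_le => // z [i _ /csG[x Qx <-]]; exists x => //; exact: QX Qx.
have ui i := (hcs i).2 (e i) f M t (he i) M0 fM t0.
have MD0 : 0 <= M * D by rewrite mulr_ge0.
have u i : ub (fun x => psi f x * \1_(box (Q i)) x)
    ((1 + n) * stint (smul t (e i)) + M * n * box_vol (Q i) + M * D * (n / k.+1%:R)).
  by apply: ui => y cy; apply: (ft i); rewrite he indicE mem_set.
apply: (@ub_le _ _ _ (\sum_i ((1 + n) * stint (smul t (e i)) + M * n * box_vol (Q i) +
   M * D * (n / k.+1%:R)) + M * D * \sum_(d <- ds) box_vol d)).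
  have q0 : \sum_i (1 + n) * stint (smul t (e i)) <= (1 + n) * \sum_i stint (smul t (e i)).
    by rewrite mulr_sumr.
  have q1 : \sum_i M * n * box_vol (Q i) <= M * n * W.
    rewrite -mulr_sumr; apply: ler_wpM2l; first by rewrite mulr_ge0// ltW.
    exact: disjoint_vol_le hW.
  have q2 : \sum_(i < k) M * D * (n / k.+1%:R) <= M * D * n.
    rewrite -mulr_sumr; apply: ler_wpM2l => //.
    rewrite sumr_const card_ord -[_ *+ k]mulr_natr mulrAC ler_pdivrMr//.
    by rewrite ler_pM2l// ler_nat.
  have q3 : M * D * \sum_(d <- ds) box_vol d <= M * D * n by apply: ler_wpM2l.
  have -> : M * (W + 2 * D) * n = M * n * W + M * D * n + M * D * n by ring.
  rewrite !big_split/= !addrA; exact: lerD (lerD (lerD q0 q1) q2) q3.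
apply: ub_mono (ub_add (ub_sum _ (fun i _ => u i)) (ub_scale MD0 (ub_boxes ds))) => x /=.
have [Xx|nX] := pselect (X x); last first.
  rewrite [\1_X x]indicE memNset// mulr0 addr_ge0//.
    apply: sumr_ge0 => i _; rewrite indicE memNset ?mulr0// => Qx.
    by apply: nX; exact: QX Qx.
  by rewrite mulr_ge0//; have := indic_le1 (boxes ds) x (R := R); lra.
have /andP[f0 fm] := fM x Xx.
have p0 : 0 <= psi f x by rewrite mulr_ge0.
have S0 (P : pred 'I_k) : 0 <= \sum_(i | P i) psi f x * \1_(box (Q i)) x.
  by apply: sumr_ge0 => i _; rewrite mulr_ge0//;
     have := indic_le1 (box (Q i)) x (R := R); lra.
rewrite [\1_X x]indicE mem_set// mulr1; have [[i _ Qx]|dx] := Xcov x Xx.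
  have h0 : 0 <= M * D * \1_(boxes ds) x.
    by rewrite mulr_ge0//; have := indic_le1 (boxes ds) x (R := R); lra.
  rewrite (bigD1 i)//= [\1_(box (Q i)) _]indicE mem_set// mulr1.
  by have := S0 (fun j => j != i); lra.
rewrite [\1_(boxes ds) x]indicE mem_set// mulr1.
have : psi f x <= M * D by apply: ler_pM => //; exact: hD.
by have := S0 xpredT; lra.
Qed.

End push_pull.

(** * Content of the image and equality of upper integrals *)

Section covariance.
Context {R : realType} {m : nat}.
Local Notation V := 'rV[R]_m.+1.
Implicit Types (x : V) (f : V -> R).

Lemma change_of_variables_ub (X K : set V) (G : V -> V) (h : V -> 'M[R]_m.+1) (L : R) :
  jordan_measurable X -> K `<=` X -> nullc K -> 0 <= L ->
  (forall x y, X x -> X y -> `|G x - G y| <= L * `|x - y|) ->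
  nullc (X° `\` [set x | strongly_differentiable X G x]) ->
  (forall x y, X x -> ~ K x -> X y -> ~ K y -> G x = G y -> x = y) ->
  mx_riemann_integrable X h ->
  nullc (X° `\` [set x | differentiable G x /\ h x = jacobi_mx G x]) ->
  (exists w, integ (\1_(G @` X)) w) /\
  (forall f M v, (forall x, X x -> `|f (G x)| <= M) ->
    ub (fun x => f (G x) * `|\det (h x)| * \1_X x) v <->
    ub (fun y => f y * \1_(G @` X) y) v).
Proof.
move=> jX KX nK L0 lipG nstrong injG hint nJ.
have [C C1 hC] := mx_integrable_bounded hint.
have [D' D'0 hD'] := det_lipschitz m.+1 C1.
pose D := D' * C; have D0 : 0 <= D by rewrite mulr_ge0//; lra.
have hD x : X x -> `|\det (h x)| <= D.
  move=> Xx; have := hD' (h x) 0 C; rewrite det0 subr0; apply.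
  - by move=> i j; exact: hC.
  - by move=> i j; rewrite mxE normr0; lra.
  - by move=> i j; rewrite mxE subr0; exact: hC.
have [bX _] := jX; have /bounded_ubP[W hW] := bX.
have W0 : 0 <= W.
  rewrite -(@stint_nil R m.+1); apply: ub_ge hW => x; rewrite stval_nil.
  by have := indic_le1 X x (R := R); lra.
have push := ub_push jX nstrong hint nJ L0 lipG W0 hW.
have pull f M v : 0 <= M -> (forall x, X x -> 0 <= f (G x) <= M) ->
    ub (fun y => f y * \1_(G @` X) y) v ->
    ub (fun x => f (G x) * `|\det (h x)| * \1_X x) v.
  move=> M0 fM hv.
  have F0 y : 0 <= f y * \1_(G @` X) y.
    have [[x Xx <-]|nG] := pselect ((G @` X) y); last by rewrite indicE memNset// mulr0.
    by rewrite mulr_ge0//; have := fM x Xx; lra.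
  have v0 : 0 <= v.
    by rewrite -(@stint_nil R m.+1); apply: ub_ge hv => y; rewrite stval_nil.
  have WD0 : 0 <= M * (W + 2 * D) by rewrite mulr_ge0//; lra.
  (* As [n <= 1], [(1 + n) * (v + n)] is at most [v + (v + 2) * n]; the remaining constant is the
     error term of [ub_pull]. *)
  apply: (@ub_lim _ _ _ _ (v + 2 + M * (W + 2 * D))) => [|e e0]; first lra.
  pose n := Num.min 1 e.
  have n0 : 0 < n by rewrite lt_min ltr01.
  have n1 : n <= 1 by rewrite ge_min lexx.
  have ne : n <= e by rewrite ge_min lexx orbT.
  have [t [ht tv]] := hv n n0.
  have t0 y : 0 <= stval t y by exact: le_trans (F0 y) (ht y).
  have [k [s [s01 sG hs]]] := ub_pull jX KX nK nstrong injG hint nJ L0 lipG W0 hW D0 hD n0.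
  apply: ub_le (hs f M t M0 fM t0 _); last first.
    move=> i y sy; apply: le_trans (ht y).
    have -> : \1_(G @` X) y = 1 :> R; last by rewrite mulr1.
    apply/eqP; rewrite eq_le; have /andP[_ ->] := indic_le1 (G @` X) y (R := R).
    apply: le_trans (sG y); rewrite (bigD1 i)//= sy lerDl.
    by apply: sumr_ge0 => j _; case: (s01 j y) => ->; rewrite ?lexx ?ler01.
  have q1 : \sum_i stint (smul t (s i)) <= v + n.
    apply: le_trans tv; apply: sum_smul_le => // y; apply: le_trans (sG y) _.
    by have /andP[] := indic_le1 (G @` X) y (R := R).
  have q2 : M * (W + 2 * D) * n <= M * (W + 2 * D) * e by apply: ler_wpM2l.
  have q3 : (1 + n) * \sum_i stint (smul t (s i)) <= (1 + n) * (v + n).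
    by apply: ler_wpM2l => //; lra.
  have q4 : v * n <= v * e by apply: ler_wpM2l.
  have q5 : n * n <= 1 * n by apply: ler_wpM2r => //; exact: ltW.
  lra.
have [w hw] : exists w, integ (fun x => `|\det (h x)| * \1_X x) w.
  apply: (@integ_of_osc R m X (fun x => `|\det (h x)|) D) => //.
    by move=> x Xx; rewrite normr_id; exact: hD.
  by move=> n n0; exact: det_osc_null.
have one01 x : X x -> 0 <= ((fun=> 1) (G x) : R) <= 1 by rewrite ler01 lexx.
have w0 : 0 <= w.
  rewrite -(@stint_nil R m.+1); apply: ub_ge hw.1 => x; rewrite stval_nil.
  by rewrite mulr_ge0//; have := indic_le1 X x (R := R); lra.
have det1 : ub (fun x => 1 * `|\det (h x)| * \1_X x) w.
  by apply: ub_mono hw.1 => x; rewrite mul1r.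
have iG1 : ub (\1_(G @` X)) w.
  by apply: ub_mono (push (fun=> 1) 1 w ler01 one01 det1) => y; rewrite mul1r.
have iG : integ (\1_(G @` X)) w.
  split => //.
  apply: (@ub_lim _ _ _ _ (w + W + 2 * D)) => [|n n0]; first lra.
  have [k [s [s01 sG hs]]] := ub_pull jX KX nK nstrong injG hint nJ L0 lipG W0 hW D0 hD n0.
  (* [ub_pull] asks for [f <= t] on the packed sets only, so the sum [es] of their indicators may
     play the role of [t] for [f = 1]. Hence [w] exceeds the volume of these subsets of [G(X)] by at
     most a multiple of [n], which bounds the inner content from below. *)
  pose es := flatten [seq s i | i <- enum 'I_k].
  have esE y : stval es y = \sum_i stval (s i) y.
    by rewrite /stval big_flatten/= big_map big_enum.
  have s0 i y : 0 <= stval (s i) y by case: (s01 i y) => ->; rewrite ?lexx ?ler01.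
  have es0 y : 0 <= stval es y by rewrite esE sumr_ge0.
  have hes : ub (fun x => `|\det (h x)| * \1_X x)
     ((1 + n) * (\sum_i stint (smul es (s i))) + 1 * (W + 2 * D) * n).
    have es1 i y : stval (s i) y = 1 -> 1 <= stval es y.
      by move=> sy; rewrite esE (bigD1 i)//= sy lerDl sumr_ge0.
    by apply: ub_mono (hs (fun=> 1) 1 es ler01 one01 es0 es1) => x; rewrite mul1r.
  have q1 : \sum_i stint (smul es (s i)) <= stint es.
    apply: sum_smul_le => // y; apply: le_trans (sG y) _.
    by have /andP[] := indic_le1 (G @` X) y (R := R).
  have q2 : stint es <= w by apply: ub_ge iG1 => y; rewrite esE.
  have q3 := ub_ge0 hes hw.2.
  have q4 : (1 + n) * \sum_i stint (smul es (s i)) <= stint es + n * w.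
    apply: (@le_trans _ _ ((1 + n) * stint es)); first by apply: ler_wpM2l => //; lra.
    by rewrite mulrDl mul1r lerD2l ler_pM2l.
  apply: (@ub_le _ _ _ (- stint es)); first lra.
  by apply: ub_mono (integ_step es).2 => y; rewrite lerN2 esE.
split; first by exists w.
move=> f M v fM.
(* Adding [M1] makes [f] nonnegative on [G(X)]. The resulting [M1 * w] can be added on one side and
   removed on the other because [|\det h|] and the indicator of [G(X)] are both integrable with
   integral [w]. *)
have [M1 M10 fM1] : exists2 M1, 0 <= M1 & forall x, X x -> `|f (G x)| <= M1.
  by exists `|M| => // x /fM/le_trans; apply; exact: ler_norm.
have fM2 x : X x -> 0 <= (fun y => f y + M1) (G x) <= 2 * M1.
  by move=> /fM1; rewrite ler_norml; lra.
have M20 : 0 <= 2 * M1 by lra.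
split=> hv.
  have u1 : ub (fun y => (f y + M1) * \1_(G @` X) y) (v + M1 * w).
    apply: push fM2 _ => //.
    by apply: ub_mono (ub_add hv (ub_scale M10 hw.1)) => x; lra.
  have := ub_add u1 (ub_scale M10 iG.2).
  rewrite mulrN addrK; apply: ub_mono => y; lra.
have u1 : ub (fun x => (f (G x) + M1) * `|\det (h x)| * \1_X x) (v + M1 * w).
  apply: (pull (fun y => f y + M1) (2 * M1)) fM2 _ => //.
  by apply: ub_mono (ub_add hv (ub_scale M10 iG.1)) => x; lra.
have := ub_add u1 (ub_scale M10 hw.2).
rewrite mulrN addrK; apply: ub_mono => y; lra.
Qed.

End covariance.

(** * An integrable extension of the Jacobi matrix *)

Section clarke.
Context {R : realType} {m : nat}.
Local Notation V := 'rV[R]_m.+1.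
Implicit Types (x y u : V) (f : V -> R) (X : set V).

Definition quotients X (G : V -> V) i j x (d : R) : set R :=
  [set q | exists y t, [/\ `|y - x| < d, t != 0, `|t| < d &
     [/\ X y, X (y + t *: delta_mx 0 j) &
         q = (G (y + t *: delta_mx 0 j) 0 i - G y 0 i) / t]]].

(* As in Clarke's generalized derivative: at a point of strong differentiability
   this is the partial derivative, and it is continuous there even if other
   points of non-differentiability accumulate. *)
Definition clarke X G i j x : R :=
  inf [set s | exists2 d, 0 < d & s = sup (quotients X G i j x d)].

Lemma norm_delta_le j : `|delta_mx 0 j : V| <= 1.
Proof.
apply: mx_norm_le => // k l; rewrite mxE.
by case: (_ && _); rewrite ?normr1 ?normr0 ?ler01 ?lexx.
Qed.

Section fixed.
Variables (X : set V) (G : V -> V).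

Lemma quotients_bound (L : R) i j x d q :
  (forall x y, X x -> X y -> `|G x - G y| <= L * `|x - y|) ->
  0 <= L -> quotients X G i j x d q -> `|q| <= L.
Proof.
move=> lipG L0 [y [t [_ t0 _ [Xy Xyt ->]]]].
rewrite normrM normfV ler_pdivrMr ?normr_gt0//.
have := ler_entry_norm (G (y + t *: delta_mx 0 j) - G y) 0 i; rewrite !mxE => /le_trans; apply.
apply: le_trans (lipG _ _ Xyt Xy) _; apply: ler_wpM2l => //.
rewrite addrAC subrr add0r normrZ; have := norm_delta_le j; have := normr_ge0 t; nra.
Qed.

Lemma sup_quotients (L : R) i j x d :
  (forall x y, X x -> X y -> `|G x - G y| <= L * `|x - y|) -> 0 <= L ->
  `|sup (quotients X G i j x d)| <= L.
Proof.
move=> lipG L0; have [->|/set0P[q hq]] := eqVneq (quotients X G i j x d) set0.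
  by rewrite sup0 normr0.
have hb p : quotients X G i j x d p -> - L <= p <= L.
  by move=> /(quotients_bound lipG L0); rewrite ler_norml.
rewrite ler_norml; apply/andP; split.
  apply: le_trans (_ : q <= _); first by have := hb q hq; lra.
  apply: sup_upper_bound => //; split; first by exists q.
  by exists L => p /hb/andP[].
by apply: ge_sup; [exists q|move=> p /hb/andP[]].
Qed.

Lemma clarke_lbound (L : R) i j x :
  (forall x y, X x -> X y -> `|G x - G y| <= L * `|x - y|) -> 0 <= L ->
  lbound [set s | exists2 d, 0 < d & s = sup (quotients X G i j x d)] (- L).
Proof.
by move=> lipG L0 _ [d _ ->]; have := sup_quotients i j x d lipG L0; rewrite ler_norml => /andP[].
Qed.

Lemma clarke_bound (L : R) i j x :
  (forall x y, X x -> X y -> `|G x - G y| <= L * `|x - y|) -> 0 <= L ->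
  `|clarke X G i j x| <= L.
Proof.
move=> lipG L0; have hl := clarke_lbound (i := i) (j := j) (x := x) lipG L0.
rewrite ler_norml; apply/andP; split.
  by apply: lb_le_inf => //; exists (sup (quotients X G i j x 1)), 1.
apply: le_trans (_ : sup (quotients X G i j x 1) <= L).
  by apply: ge_inf; [exists (- L)|exists 1].
by have := sup_quotients i j x 1 lipG L0; rewrite ler_norml => /andP[].
Qed.

Lemma clarke_near (L : R) i j x (d a e : R) :
  (forall x y, X x -> X y -> `|G x - G y| <= L * `|x - y|) -> 0 <= L -> 0 < d ->
  (forall q, quotients X G i j x d q -> `|q - a| <= e) -> X° x ->
  `|clarke X G i j x - a| <= e.
Proof.
move=> lipG L0 d0 hq ix.
have qmon d1 d2 : d1 <= d2 -> quotients X G i j x d1 `<=` quotients X G i j x d2.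
  move=> d12 q [y [t [h1 h2 h3 h4]]]; exists y, t; split => //; exact: lt_le_trans d12.
(* The supremum of the empty set is 0 by convention; at an interior point, quotients exist at every
   scale. *)
have qn0 d1 : 0 < d1 -> quotients X G i j x d1 !=set0.
  move=> d10; have /nbhs_ballP[r /= r0 hr] := ix.
  pose t := Num.min d1 r / 2.
  have t0 : 0 < t by rewrite divr_gt0// lt_min d10.
  have md : Num.min d1 r <= d1 by rewrite ge_min lexx.
  have mr : Num.min d1 r <= r by rewrite ge_min lexx orbT.
  have td : t < d1 by rewrite /t; lra.
  have tr : t < r by rewrite /t; lra.
  exists ((G (x + t *: delta_mx 0 j) 0 i - G x 0 i) / t), x, t; split => //.
  - by rewrite subrr normr0.
  - by rewrite lt0r_neq0.
  - by rewrite gtr0_norm.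
  split => //; first exact: interior_subset.
  apply: hr; rewrite -ball_normE/= opprD addrA subrr add0r normrN normrZ gtr0_norm//.
  by have := norm_delta_le j; nra.
have ha q : quotients X G i j x d q -> a - e <= q <= a + e.
  by move=> /hq; rewrite ler_norml; lra.
rewrite ler_norml; apply/andP; split.
  rewrite lerBrDr; apply: lb_le_inf; first by exists (sup (quotients X G i j x 1)), 1.
  move=> _ [d1 d10 ->].
  have m0 : 0 < Num.min d1 d by rewrite lt_min d10.
  have [q qm] := qn0 _ m0.
  apply: (@le_trans _ _ q).
    have /ha : quotients X G i j x d q by apply: qmon qm; rewrite ge_min lexx orbT.
    lra.
  apply: sup_upper_bound; last by apply: qmon qm; rewrite ge_min lexx.
  split; first exact: qn0.
  by exists L => p /(quotients_bound lipG L0); rewrite ler_norml => /andP[].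
rewrite lerBlDr; apply: le_trans (_ : sup (quotients X G i j x d) <= _).
  by apply: ge_inf; [exists (- L); exact: clarke_lbound|exists d].
apply: ge_sup; first exact: qn0.
by move=> q /ha; lra.
Qed.

Lemma clarke_strong (L : R) i j u (e : R) :
  (forall x y, X x -> X y -> `|G x - G y| <= L * `|x - y|) -> 0 <= L ->
  strongly_differentiable X G u -> 0 < e ->
  exists2 d, 0 < d & forall x, `|x - u| < d ->
    X x /\ `|clarke X G i j x - 'J G u j i| <= e.
Proof.
move=> lipG L0 su e0; have [_ /(_ e e0)[d d0 hd]] := strong_diffE su.
have Xu x : `|x - u| < d -> X x by move=> xd; have [] := hd x x xd xd.
have d40 : 0 < d / 4 by lra.
(* The three displacements, from [u] to [x], to [y] and to [y + t *: delta_mx 0 j], add up to less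
   than [d]. *)
exists (d / 4) => // x xu; have Xx : X x by apply: Xu; lra.
split => //; apply: (clarke_near lipG L0 d40); last first.
  apply/nbhs_ballP; exists (d / 4) => //= y; rewrite -ball_normE/= => xy; apply: Xu.
  have -> : y - u = - (x - y) + (x - u) by rewrite opprB addrA subrK.
  by apply: le_lt_trans (ler_normD _ _) _; rewrite normrN; lra.
move=> q [y [t [yx t0 td [Xy Xyt ->]]]].
have tn : `|t *: delta_mx 0 j : V| <= `|t|.
  by rewrite normrZ ler_piMr// norm_delta_le.
have yu : `|y - u| < d / 2.
  rewrite -(subrKA x y); apply: le_lt_trans (ler_normD _ _) _; lra.
have ytu : `|y + t *: delta_mx 0 j - u| < d.
  rewrite addrAC; apply: le_lt_trans (ler_normD _ _) _; lra.
have yud : `|y - u| < d by lra.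
have [_ hJ] := hd _ _ ytu yud.
have -> : (G (y + t *: delta_mx 0 j) 0 i - G y 0 i) / t - 'J G u j i =
  (G (y + t *: delta_mx 0 j) - G y -
     (y + t *: delta_mx 0 j - y) *m 'J G u) 0 i / t.
  rewrite [y + _ - y]addrAC subrr add0r -scalemxAl -rowE !mxE.
  by field.
rewrite normrM normfV ler_pdivrMr ?normr_gt0//.
apply: le_trans (ler_entry_norm _ _ _) _; apply: le_trans hJ _.
by rewrite [y + _ - y]addrAC subrr add0r ler_wpM2l// ltW.
Qed.

End fixed.
End clarke.

Lemma lebesgue_nullS (R : realType) (m : nat) (A B : set 'rV[R]_m) :
  A `<=` B -> lebesgue_null B -> lebesgue_null A.
Proof.
move=> AB B0; apply/eqP; rewrite eq_le; apply/andP; split.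
  rewrite -B0; apply: ereal_inf_le_tmp => _ [D BD <-]; exists D => //.
  exact: subset_trans BD.
apply: le_ereal_inf_tmp => _ [D _ <-]; apply: nneseries_ge0 => k _ _.
by rewrite lee_fin; apply: prodr_ge0 => i _; rewrite le_max lexx.
Qed.

(** By [clarke_strong], the points where an entry oscillates by more than a given amount are not
    points of strong differentiability, so [integ_of_osc] applies. The same estimate at the point
    itself, for every [e], identifies the entry with that of the Jacobi matrix. *)
Lemma exists_jacobi_extension (R : realType) (m : nat) (X : set 'rV[R]_m.+1)
    (G : 'rV[R]_m.+1 -> 'rV[R]_m.+1) (L : R) :
  jordan_measurable X -> 0 <= L ->
  (forall x y, X x -> X y -> `|G x - G y| <= L * `|x - y|) ->
  lebesgue_null (X° `\` [set x | strongly_differentiable X G x]) ->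
  exists g : 'rV[R]_m.+1 -> 'M[R]_m.+1,
     mx_riemann_integrable X g /\ ae_jacobi_mx X G g.
Proof.
move=> jX L0 lipG ns; exists (fun x => \matrix_(i, j) clarke X G i j x); split.
  move=> i j.
  have E : (fun x => (\matrix_(i, j) clarke X G i j x) i j) = clarke X G i j.
    by apply/funext => x; rewrite mxE.
  rewrite E; have [w hw] : exists w, integ (fun x => clarke X G i j x * \1_X x) w.
    apply: (integ_of_osc (M := L)) => // [x _|n n0]; first exact: clarke_bound.
    apply: nullcS (lebesgue_null_nullc ns) => x [ix nb]; split => // sx; apply: nb.
    have n20 : 0 < n / 2 by lra.
    have [d d0 hd] := clarke_strong i j lipG L0 sx n20.
    have d20 : 0 < d / 2 by lra.
    have bd y : box (cube x (d / 2)) y -> `|y - x| < d.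
      move=> /cubeE h; apply: (@le_lt_trans _ _ (d / 2)); last lra.
      apply: mx_norm_le => [|k l]; first exact: ltW.
      by rewrite ord1 !mxE ler_norml; have := h l; lra.
    exists (cube x (d / 2)); split.
    - by move=> k; rewrite !mxE; lra.
    - by move=> y /bd/hd[].
    - move=> y z /bd/hd[_ h1] /bd/hd[_ h2].
      by move: h1 h2; rewrite !ler_norml; lra.
  have [] // := integ_riemann jX _ hw.
  by apply/boundedP; exists L => x _; exact: clarke_bound.
apply: lebesgue_nullS ns => x [ix nJ]; split => // sx; apply: nJ.
have [dG _] := strong_diffE sx; split => //; apply/matrixP => i j; rewrite mxE [RHS]mxE.
apply/eqP; rewrite -subr_eq0 -normr_le0; apply/ler_addgt0Pr => e e0; rewrite add0r.
have [d d0 hd] := clarke_strong i j lipG L0 sx e0.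
have xx : `|x - x| < d by rewrite subrr normr0.
by have [_] := hd x xx.
Qed.

Theorem theorem19 (R : realType) (m : nat) (X K : set 'rV[R]_m)
    (G : 'rV[R]_m -> 'rV[R]_m) (f : 'rV[R]_m -> R)
    (m_ge1 : (1 <= m)%N)
    (jordan_X : jordan_measurable X)
    (K_sub_X : K `<=` X)
    (null_K : lebesgue_null K)
    (lipschitz_G : [lipschitz G x | x in X])
    (strong_diff_G : lebesgue_null (X° `\` [set x | strongly_differentiable X G x]))
    (inj_G : {in X `\` K &, injective G})
    (bounded_f : [bounded f y | y in G @` X]) :
  (exists g : 'rV[R]_m -> 'M[R]_m,
     mx_riemann_integrable X g /\ ae_jacobi_mx X G g)
  /\
  (forall h : 'rV[R]_m -> 'M[R]_m,
     mx_riemann_integrable X h -> ae_jacobi_mx X G h ->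
     let psi := fun x => f (G x) * `|\det (h x)| in
     (riemann_integrable X psi <-> riemann_integrable (G @` X) f) /\
     (riemann_integrable (G @` X) f \/ riemann_integrable X psi ->
      riemann_integral (G @` X) f = riemann_integral X psi)).
Proof.
case: m X K G f m_ge1 jordan_X K_sub_X null_K lipschitz_G strong_diff_G inj_G bounded_f
  => [//|m] X K G f _ jX KX nK lipG ns injG bf.
have [L [L0 hL]] : exists L, 0 <= L /\
    forall x y, X x -> X y -> `|G x - G y| <= L * `|x - y|.
  have [M0 [_ hM]] := lipG; exists (`|M0| + 1).
  have ltM : M0 < `|M0| + 1 by rewrite (le_lt_trans (ler_norm M0))// ltrDl.
  by split => [|x y Xx Xy]; [rewrite addr_ge0|exact: (hM _ ltM (x, y))].
split; first exact: exists_jacobi_extension jX L0 hL ns.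
move=> h hh hJ psi.
have injG' x y : X x -> ~ K x -> X y -> ~ K y -> G x = G y -> x = y.
  by move=> Xx nKx Xy nKy; apply: injG; rewrite inE.
have [[w hw] cov] := change_of_variables_ub jX KX (lebesgue_null_nullc nK) L0 hL
  (lebesgue_null_nullc ns) injG' hh (lebesgue_null_nullc hJ).
have jGX : jordan_measurable (G @` X) by apply/jordanP; exists w.
have /boundedP[M fM] := bf.
have fMX x : X x -> `|f (G x)| <= M by move=> Xx; apply: fM; exists x.
have fMX' x : X x -> `|- f (G x)| <= M by rewrite normrN; exact: fMX.
have bpsi : [bounded psi x | x in X].
  have [C C1 hC] := mx_integrable_bounded hh.
  have [D D0 hD] := det_lipschitz m.+1 C1.
  apply/boundedP; exists (M * (D * C)) => x Xx; rewrite normrM normr_id.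
  apply: ler_pM => //; first exact: fMX.
  have := hD (h x) 0 C; rewrite det0 subr0; apply => i j; rewrite ?mxE ?subr0 ?normr0.
  - exact: hC.
  - lra.
  - exact: hC.
(* Upper integrals of [-f] stand for lower integrals of [f]; [cov] applies to both signs, as it only
   bounds [|f|]. *)
have integE v : integ (fun x => psi x * \1_X x) v <->
    integ (fun y => f y * \1_(G @` X) y) v.
  have c1 := cov f M v fMX; have c2 := cov (fun y => - f y) M (- v) fMX'.
  split=> -[h1 h2]; split.
  - exact/c1.
  - apply: ub_mono (c2.1 _) => [y|]; first by rewrite mulNr.
    by apply: ub_mono h2 => x; rewrite !mulNr.
  - exact/c1.
  - apply: ub_mono (c2.2 _) => [x|]; first by rewrite !mulNr.
    by apply: ub_mono h2 => y; rewrite mulNr.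
have key : riemann_integrable X psi -> riemann_integrable (G @` X) f /\
    riemann_integral (G @` X) f = riemann_integral X psi.
  by move=> /riemann_integ/integE; exact: integ_riemann.
have key' : riemann_integrable (G @` X) f -> riemann_integrable X psi.
  by move=> /riemann_integ/integE hf; have [] := integ_riemann jX bpsi hf.
split; first by split; [move=> /key[]|exact: key'].
by case=> [/key'|] /key[].
Qed.
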